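(* Let $\Omega\subset\mathbb R^2$ be an unbounded domain whose boundary $\partial\Omega$ is a smooth Jordan curve. (i) Let $U$ be the solution of the two-dimensional exterior Dirichlet problem described in the context. If some equipotential curve of $U$ is a circle, then $\partial\Omega$ is a circle. (ii) Let $U$ be the solution of the two-dimensional exterior Dirichlet problem described in the context. If there is an equipotential curve of $U$ on which $|\nabla U(\boldsymbol r)|$ is constant, then $\partial\Omega$ is a circle. (iii) Let $\mathbf 0\notin\Omega\cup\partial\Omega$, and let $G$ be the Green's function of the two-dimensional interior Dirichlet problem described in the context. If there is an equipotential curve of $G$ on which $|\nabla G(\boldsymbol r)|$ is constant, then $\partial\Omega$ is a circle centered at the origin.
   Context: Two-dimensional exterior Dirichlet problem: $U$ is a non-constant harmonic function in $\Omega$, smooth up to $\partial\Omega$, constant on $\partial\Omega$, with flux $-\oint_{\partial\Omega}\boldsymbol n\cdot\nabla U\,\mathrm ds=\Phi>0$ ($\boldsymbol n$ the unit normal on $\partial\Omega$ pointing into $\Omega$) and with $U(\boldsymbol r)+\frac{\Phi}{2\pi}\log|\boldsymbol r|$ bounded as $|\boldsymbol r|\to\infty$. Two-dimensional interior Dirichlet problem: $G$ is the Dirichlet Green's function, with pole at $\mathbf 0$, of the bounded domain $\mathbb R^2\smallsetminus(\Omega\cup\partial\Omega)$ enclosed by $\partial\Omega$: $G$ is harmonic in $\mathbb R^2\smallsetminus(\Omega\cup\partial\Omega\cup\{\mathbf 0\})$, $G=0$ on $\partial\Omega$, and $-\lim_{\varepsilon\to0^+}\oint_{|\boldsymbol r|=\varepsilon}\boldsymbol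 n\cdot\nabla G\,\mathrm ds=1$ with $\boldsymbol n$ the outward normal of the circle $|\boldsymbol r|=\varepsilon$ (so $G$ has the singularity $-\frac1{2\pi}\log|\boldsymbol r|$ at $\mathbf 0$). An equipotential curve is a level set of $U$ in $\Omega\cup\partial\Omega$ (respectively of $G$ in $\mathbb R^2\smallsetminus(\Omega\cup\{\mathbf 0\})$). *)

(* Defs.v *)
From HB Require Import structures.
From mathcomp Require Import all_boot all_order all_algebra.
From mathcomp Require Import all_classical all_reals all_analysis.

Set Implicit Arguments.
Unset Strict Implicit.
Unset Printing Implicit Defensive.

Import Order.TTheory GRing.Theory Num.Theory numFieldNormedType.Exports.

Local Open Scope classical_set_scope.
Local Open Scope ring_scope.

Section Plane.
Variable R : realType.
Local Notation plane := (R * R)%type.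
Implicit Types (p q r v : plane) (D E Omega L : set plane).

Definition dotp p q : R := p.1 * q.1 + p.2 * q.2.

(* The library norm `|p| on R * R is the sup norm, not the Euclidean one. *)
Definition enorm p : R := Num.sqrt (dotp p p).

Definition circle (a : plane) (rho : R) : set plane :=
  [set r | enorm (r - a) = rho].

Definition is_circle L := exists a rho, 0 < rho /\ L = circle a rho.

Definition frontier D : set plane := closure D `\` interior D.

Definition unbounded_domain Omega :=
  [/\ open Omega, connected Omega & ~ bounded_set Omega].

(* Closed simple curves of class C^oo with nowhere vanishing velocity,
   parametrized with period 1. *)
Record smooth_jordan_param (gam : R -> plane) : Prop := SmoothJordanParam {
  sj_smooth : forall (k : nat) (t : R), derivable (derive1n k gam) t 1 ;
  sj_regular : forall t, derive1 gam t != 0 ;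
  sj_periodic : forall t, gam (t + 1) = gam t ;
  sj_simple : forall s t : R, 0 <= s < 1 -> 0 <= t < 1 -> gam s = gam t -> s = t }.

Definition smooth_jordan_curve L :=
  exists gam, smooth_jordan_param gam /\ range gam = L.

Definition axis (b : bool) : plane := if b then (0, 1) else (1, 0).

(* Iterated partial derivatives: s lists the successive coordinates. *)
Definition pderiv (s : seq bool) (f : plane -> R) : plane -> R :=
  foldr (fun b g => 'D_(axis b) g) f s.

Definition grad (f : plane -> R) p : plane :=
  (pderiv [:: false] f p, pderiv [:: true] f p).

Definition laplacian (f : plane -> R) p : R :=
  pderiv [:: false; false] f p + pderiv [:: true; true] f p.

(* Class C^k on the open set D. *)
Definition Ck (k : nat) D (f : plane -> R) :=
  forall s : seq bool, (size s <= k)%N -> forall p, D p ->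
    {for p, continuous (pderiv s f)} /\
    ((size s < k)%N -> forall b, derivable (pderiv s f) p (axis b)).

(* Class C^oo on D, all partial derivatives extending continuously to
   closure D. *)
Definition smooth_upto_frontier D (f : plane -> R) :=
  [/\ forall k, Ck k D f,
      {within closure D, continuous f} &
      forall s : seq bool, exists g : plane -> R,
        {within closure D, continuous g} /\ {in D, g =1 pderiv s f}].

Definition harmonic_on D (f : plane -> R) :=
  Ck 2 D f /\ forall p, D p -> laplacian f p = 0.

(* For f of class C^1 on the open set D, the gradient of f on D and its
   continuous extension to closure D.  The values of f outside closure D are
   irrelevant, so that grad f itself is meaningless on the frontier of D. *)
Definition cgrad_exists D (f : plane -> R) r :=
  forall b : bool, cvg (pderiv [:: b] f p @[p --> within D (nbhs r)]).

Definition cgrad D (f : plane -> R) r : plane :=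
  (lim (pderiv [:: false] f p @[p --> within D (nbhs r)]),
   lim (pderiv [:: true] f p @[p --> within D (nbhs r)])).

Definition grad_norm_constant_on L D (f : plane -> R) :=
  exists k : R, forall r, L r -> cgrad_exists D f r /\ enorm (cgrad D f r) = k.

(* The integral over the curve gam of n . F with respect to arc length, n t
   being the normal at gam t. *)
Definition flux (gam n : R -> plane) (F : plane -> plane) : R :=
  \int[lebesgue_measure]_(t in `[0, 1])
    (dotp (n t) (F (gam t)) * enorm (derive1 gam t)).

Definition inward_unit_normal D (gam : R -> plane) (t : R) (n : plane) :=
  [/\ enorm n = 1, dotp n (derive1 gam t) = 0 &
      \forall e \near (0 : R)^'+, D (gam t + e *: n)].

Definition unit_circle_param (t : R) : plane :=
  (cos (2 * pi * t), sin (2 * pi * t)).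

Definition circle_param (e t : R) : plane := e *: unit_circle_param t.

Record exterior_dirichlet Omega (Phi : R) (U : plane -> R) : Prop :=
  ExteriorDirichlet {
    ed_harmonic : harmonic_on Omega U ;
    ed_nonconstant : ~ exists c, forall r, Omega r -> U r = c ;
    ed_smooth : smooth_upto_frontier Omega U ;
    ed_frontier : exists c, forall r, frontier Omega r -> U r = c ;
    ed_flux_gt0 : 0 < Phi ;
    ed_flux : exists gam n : R -> plane,
      [/\ smooth_jordan_param gam, range gam = frontier Omega,
          forall t, inward_unit_normal Omega gam t (n t) &
          - flux gam n (cgrad Omega U) = Phi] ;
    ed_infinity : exists M K : R, forall r, Omega r -> K <= enorm r ->
      `|U r + Phi / (2 * pi) * ln (enorm r)| <= M }.

Definition exterior_equipotential Omega (U : plane -> R) (c : R) : set plane :=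
  [set r | closure Omega r /\ U r = c].

(* The bounded domain enclosed by the frontier of Omega, minus the pole. *)
Definition punctured_interior Omega : set plane :=
  ~` (closure Omega `|` [set 0]).

(* Zero boundary values are attained continuously.  The limit of the flux alone
   does not determine the singularity at 0: it does not exclude the real part
   of a pole z^-1. *)
Record interior_green Omega (G : plane -> R) : Prop := InteriorGreen {
  ig_harmonic : harmonic_on (punctured_interior Omega) G ;
  ig_continuous : {within ~` (Omega `|` [set 0]), continuous G} ;
  ig_frontier : forall r, frontier Omega r -> G r = 0 ;
  ig_flux : - flux (circle_param e) unit_circle_param (grad G)
            @[e --> (0 : R)^'+] --> (1 : R) ;
  ig_pole : exists M : R, \forall r \near (0 : plane)^',
    `|G r + (2 * pi)^-1 * ln (enorm r)| <= M }.

Definition interior_equipotential Omega (G : plane -> R) (c : R) : set plane :=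
  [set r | ~ (Omega `|` [set 0]) r /\ G r = c].

End Plane.

(* Main.v *)
Require Import Defs.
From HB Require Import structures.
From mathcomp Require Import all_boot all_order all_algebra.
From mathcomp Require Import ring lra.
From mathcomp Require Import all_classical all_reals all_analysis.
Import Order.TTheory GRing.Theory Num.Theory numFieldNormedType.Exports.
Local Open Scope classical_set_scope.
Local Open Scope ring_scope.
Set Implicit Arguments.
Unset Strict Implicit.
Unset Printing Implicit Defensive.

(* Everything rests on the maximum principle and on unique continuation for
   holomorphic functions, which follows from Hadamard's three circles theorem.
   Write [c0] for the value of [U] on the frontier and [k = Phi / (4 pi)].

   (i) If the level circle, of center [a], meets the frontier of [Omega], it contains
   it, hence equals it.  Otherwise the frontier lies inside the circle, outside of
   which [U + k ln |z - a|^2] is constant; by unique continuation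
   [U_x - i U_y = - 2 k / (z - a)] on [Omega], so that the frontier is a circle.

   (ii) [U] has no critical point where [U < c0]: there the sublevel and the superlevel
   set (the latter completed by the complement of [Omega]), which are both connected,
   would cross each other, which a winding number forbids.  Hence
   [P = ln |grad U|^2 - U / k] is harmonic on [U < c]; it is bounded at infinity and
   constant on the frontier of that set, hence constant.  So [f = U_x - i U_y] satisfies
   [f' = f^2 / (2 k)], i.e. [z + 2 k / f] is a constant [a], and one concludes as in (i).

   (iii) Let [rho] and [r] be the smallest and the largest distance from [0] to the
   frontier of [D = {G > c}].  Comparing [G] with [c + ln (r / |z|) / (2 pi)] on [D] and
   with [c + ln (rho / |z|) / (2 pi)] on the disc of radius [rho] gives
   [|grad G| <= 1 / (2 pi r)] at a farthest and [|grad G| >= 1 / (2 pi rho)] at a nearest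
   point, so [rho = r] and [G] is a logarithm on [D].  By unique continuation it is one up
   to the circle about [0] through the nearest point of the frontier of [Omega].  [G]
   vanishes on this circle and is nonnegative, so the circle lies on the frontier, and a
   Jordan curve containing a circle is that circle. *)

(** * Harmonic functions *)

Section Calculus.
Variable R : realType.
Local Notation plane := (R * R)%type.
Implicit Types (p q v : plane) (D E : set plane) (f : plane -> R).

(** Holomorphic functions are pairs of real functions satisfying the Cauchy-Riemann equations, so
    that only derivatives along the axes occur. Logarithms are taken of squared distances, twice the
    usual ones, whence 4 pi instead of 2 pi in [k]. The condition at infinity bounds
    [U + k ln |z|^2] but says nothing about derivatives, whereas [P] involves the gradient: the
    decay of this error term and of its gradient has to be extracted from boundedness alone, by
    reflection and comparison. A level curve may be the frontier of [Omega] itself, where the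
    gradient exists only as a limit from one side; boundary conditions are therefore always stated
    as limits from inside an open set. [P] is the combination of [|grad U|] and [U] that is constant
    for a radial logarithm; it makes sense only where the gradient does not vanish, hence the
    exclusion of critical points. In (iii) a comparison at two points of the level curve takes its
    place, which asks neither for a gradient without zeros nor for any regularity of the curve. *)

Lemma is_derive_quotient (V1 V2 W : normedModType R) (f : V1 -> W) (g : V2 -> W)
    (x v : V1) (y w : V2) (d : W) :
  (forall h : R, f (h *: v + x) = g (h *: w + y)) ->
  is_derive x v f d -> is_derive y w g d.
Proof.
move=> fg [df dv].
have e0 : f x = g y by have := fg 0; rewrite !scale0r !add0r.
have E : (fun h : R => h^-1 *: ((f \o shift x) (h *: v) - f x)) =
         (fun h : R => h^-1 *: ((g \o shift y) (h *: w) - g y)).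
  by apply/funext => h /=; rewrite fg e0.
by split; [move: df; rewrite /derivable E | move: dv; rewrite /derive E].
Qed.

Lemma is_derive_line (W : normedModType R) (f : plane -> W) p v (d : W) (s : R) :
  is_derive (p + s *: v) v f d -> is_derive s 1 (fun t : R => f (p + t *: v)) d.
Proof.
apply: is_derive_quotient => h; congr f.
by rewrite -[h *: 1]/(h * 1) mulr1 scalerDl addrCA.
Qed.

Lemma is_derive_lineV (W : normedModType R) (f : plane -> W) p v (d : W) :
  is_derive (0 : R) 1 (fun t : R => f (p + t *: v)) d -> is_derive p v f d.
Proof.
apply: is_derive_quotient => h; congr f.
by rewrite -[h *: 1]/(h * 1) mulr1 addr0 addrC.
Qed.

Lemma is_derive_comp1 (f : R -> R) (g : plane -> R) p v (a b : R) :
  is_derive (g p) 1 f a -> is_derive p v g b -> is_derive p v (f \o g) (a * b).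
Proof.
move=> hf hg; apply: is_derive_lineV.
have hg' : is_derive (0 : R) 1 (fun t : R => g (p + t *: v)) b.
  by apply: is_derive_line; rewrite scale0r addr0.
apply: (@is_derive1_comp R f (fun t => g (p + t *: v)) 0 a b _ hg').
by rewrite scale0r addr0.
Qed.

Lemma is_derive_fst p v : is_derive p v (fst : plane -> R) v.1.
Proof.
by apply: (@is_derive_quotient R _ R (fun t => t) fst p.1 v.1) => h.
Qed.

Lemma is_derive_snd p v : is_derive p v (snd : plane -> R) v.2.
Proof.
by apply: (@is_derive_quotient R _ R (fun t => t) snd p.2 v.2) => h.
Qed.

Definition pdif D (b : bool) f (g : plane -> R) := forall p, D p -> is_derive p (axis R b) f (g p).

(** Only the pure second derivatives are kept, which is all that the Laplacian involves. Continuity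
    is a separate field because the existence of partial derivatives does not imply it. *)
Record jet2 D f (g h : bool -> plane -> R) : Prop := Jet2 {
  jet2_cont : forall p, D p -> {for p, continuous f} ;
  jet2_fst : forall b, pdif D b f (g b) ;
  jet2_snd : forall b, pdif D b (g b) (h b) }.

Lemma jet2_sub D E f g h : E `<=` D -> jet2 D f g h -> jet2 E f g h.
Proof. by move=> ED [c j1 j2]; split=> [p /ED/c//|b p /ED/j1|b p /ED/j2]. Qed.

Lemma jet2_cst D c : jet2 D (fun=> c) (fun _ _ => 0) (fun _ _ => 0).
Proof.
by split=> [p _|b p _|b p _]; [exact: cst_continuous|exact: is_derive_cst..].
Qed.

Lemma jet2D D f g h f' g' h' : jet2 D f g h -> jet2 D f' g' h' ->
  jet2 D (fun p => f p + f' p) (fun b p => g b p + g' b p) (fun b p => h b p + h' b p).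
Proof.
move=> [c j k] [c' j' k']; split=> [p Dp|b p Dp|b p Dp].
- by apply: cvgD; [exact: c|exact: c'].
- exact: is_deriveD (j b p Dp) (j' b p Dp).
- exact: is_deriveD (k b p Dp) (k' b p Dp).
Qed.

Lemma jet2Z D (c : R) f g h : jet2 D f g h ->
  jet2 D (fun p => c * f p) (fun b p => c * g b p) (fun b p => c * h b p).
Proof.
move=> [cf j k]; split=> [p Dp|b p Dp|b p Dp].
- by apply: cvgM; [exact: cvg_cst|exact: cf].
- exact: (@is_deriveZ _ _ _ _ c _ _ _ (j b p Dp)).
- exact: (@is_deriveZ _ _ _ _ c _ _ _ (k b p Dp)).
Qed.

Lemma jet2M D f g h f' g' h' : jet2 D f g h -> jet2 D f' g' h' ->
  jet2 D (fun p => f p * f' p) (fun b p => f p * g' b p + f' p * g b p)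
     (fun b p => f p * h' b p + 2 * g b p * g' b p + f' p * h b p).
Proof.
move=> [c j k] [c' j' k']; split=> [p Dp|b p Dp|b p Dp].
- by apply: cvgM; [exact: c|exact: c'].
- exact: is_deriveM (j b p Dp) (j' b p Dp).
- have H1 := is_deriveM (j b p Dp) (k' b p Dp).
  have H2 := is_deriveM (j' b p Dp) (k b p Dp).
  apply: (is_derive_eq (is_deriveD H1 H2)); rewrite /GRing.scale /=; ring.
Qed.

Lemma is_derive_inv (g : plane -> R) p v (a : R) : g p != 0 -> is_derive p v g a ->
  is_derive p v (fun q => (g q)^-1) (- (g p) ^- 2 * a).
Proof.
move=> g0; have H : is_derive (g p) 1 (fun x : R => x^-1) (- (g p) ^- 2).
  have := @is_deriveV R id (g p) 1 1 g0 (is_derive_id _ _).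
  by rewrite [_ *: 1]mulr1.
exact: is_derive_comp1.
Qed.

Lemma jet2_ln D f g h : jet2 D f g h -> (forall p, D p -> 0 < f p) ->
  jet2 D (fun p => ln (f p)) (fun b p => g b p / f p)
    (fun b p => h b p / f p - (g b p / f p) ^+ 2).
Proof.
move=> [c j k] f0; split=> [p Dp|b p Dp|b p Dp].
- by apply: continuous_comp; [exact: c|apply: continuous_ln; exact: f0].
- apply: (is_derive_eq (is_derive_comp1 (is_derive1_ln (f0 _ Dp)) (j b p Dp))).
  by rewrite mulrC.
- have fn0 : f p != 0 by rewrite gt_eqF// f0.
  have H := is_deriveM (k b p Dp) (is_derive_inv fn0 (j b p Dp)).
  apply: (is_derive_eq H); rewrite /GRing.scale /=; field; exact: fn0.
Qed.

Lemma jet2_fst_coord D : jet2 D fst (fun b _ => (axis R b).1) (fun _ _ => 0).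
Proof.
split=> [p _|b p _|b p _]; [exact: cvg_fst|exact: is_derive_fst|exact: is_derive_cst].
Qed.

Lemma jet2_snd_coord D : jet2 D snd (fun b _ => (axis R b).2) (fun _ _ => 0).
Proof.
split=> [p _|b p _|b p _]; [exact: cvg_snd|exact: is_derive_snd|exact: is_derive_cst].
Qed.

Definition subharmonic D f :=
  exists g h, jet2 D f g h /\ forall p, D p -> 0 <= h false p + h true p.

Definition harmonic D f :=
  exists g h, jet2 D f g h /\ forall p, D p -> h false p + h true p = 0.

Lemma harmonic_subharmonic D f : harmonic D f -> subharmonic D f.
Proof. by move=> [g [h [j l]]]; exists g, h; split=> // p /l ->. Qed.

Lemma harmonic_sub D E f : E `<=` D -> harmonic D f -> harmonic E f.
Proof.
move=> ED [g [h [j l]]]; exists g, h; split; first exact: jet2_sub j.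
by move=> p /ED/l.
Qed.

Lemma subharmonic_sub D E f : E `<=` D -> subharmonic D f -> subharmonic E f.
Proof.
move=> ED [g [h [j l]]]; exists g, h; split; first exact: jet2_sub j.
by move=> p /ED/l.
Qed.

Lemma harmonic_cst D c : harmonic D (fun=> c).
Proof. by do 2!eexists; split; [exact: jet2_cst|move=> p _ /=; rewrite addr0]. Qed.

Lemma harmonicD D f f' : harmonic D f -> harmonic D f' -> harmonic D (fun p => f p + f' p).
Proof.
move=> [g [h [j l]]] [g' [h' [j' l']]]; do 2!eexists; split; first exact: jet2D j j'.
by move=> p Dp /=; rewrite addrACA l// l'// addr0.
Qed.

Lemma subharmonicD D f f' :
  subharmonic D f -> subharmonic D f' -> subharmonic D (fun p => f p + f' p).
Proof.
move=> [g [h [j l]]] [g' [h' [j' l']]]; do 2!eexists; split; first exact: jet2D j j'.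
by move=> p Dp /=; rewrite addrACA addr_ge0// ?l// l'.
Qed.

Lemma harmonicZ D c f : harmonic D f -> harmonic D (fun p => c * f p).
Proof.
move=> [g [h [j l]]]; do 2!eexists; split; first exact: (jet2Z c j).
by move=> p Dp /=; rewrite -mulrDr l// mulr0.
Qed.

Lemma harmonicB D f f' : harmonic D f -> harmonic D f' -> harmonic D (fun p => f p - f' p).
Proof.
move=> hf /(harmonicZ (-1)) hg; have := harmonicD hf hg.
by under [X in harmonic _ X]eq_fun do rewrite mulN1r.
Qed.

Lemma subharmonic_cont D f p : subharmonic D f -> D p -> {for p, continuous f}.
Proof. by move=> [g [h [[c _ _] _]]] /c. Qed.

Lemma harmonic_cont D f p : harmonic D f -> D p -> {for p, continuous f}.
Proof. by move=> /harmonic_subharmonic; exact: subharmonic_cont. Qed.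

(** The square keeps distances polynomial, and [ln (sqn p)] is twice the logarithm of the Euclidean
    norm. *)
Definition sqn p : R := p.1 ^+ 2 + p.2 ^+ 2.

Lemma sqn_ge0 p : 0 <= sqn p.
Proof. by rewrite addr_ge0 ?sqr_ge0. Qed.

Lemma sqn_eq0 p : (sqn p == 0) = (p == 0).
Proof.
case: p => x y; rewrite /sqn/= paddr_eq0 ?sqr_ge0// !sqrf_eq0.
by rewrite -[(x, y) == 0]/((x == 0) && (y == 0)).
Qed.

Lemma sqn_gt0 p : (0 < sqn p) = (p != 0).
Proof. by rewrite lt0r sqn_eq0 sqn_ge0 andbT. Qed.

Lemma enorm_sqn p : enorm p = Num.sqrt (sqn p).
Proof. by rewrite /enorm /dotp /sqn !expr2. Qed.

Lemma sqn0 : sqn 0 = 0.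
Proof. by rewrite /sqn expr0n addr0. Qed.

Lemma sqnN p : sqn (- p) = sqn p.
Proof. by rewrite /sqn -[(- p).1]/(- p.1) -[(- p).2]/(- p.2) !sqrrN. Qed.

Lemma sqnZ (t : R) p : sqn (t *: p) = t ^+ 2 * sqn p.
Proof. by rewrite /sqn -[(t *: p).1]/(t * p.1) -[(t *: p).2]/(t * p.2); ring. Qed.

Lemma enorm_ge0 p : 0 <= enorm p. Proof. exact: sqrtr_ge0. Qed.

Lemma sqr_enorm p : enorm p ^+ 2 = sqn p.
Proof. by rewrite enorm_sqn sqr_sqrtr// sqn_ge0. Qed.

Lemma enorm_gt0 p : p != 0 -> 0 < enorm p.
Proof. by move=> p0; rewrite enorm_sqn sqrtr_gt0 sqn_gt0. Qed.

Lemma enormZ (t : R) p : 0 <= t -> enorm (t *: p) = t * enorm p.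
Proof.
by move=> t0; rewrite !enorm_sqn sqnZ sqrtrM ?sqr_ge0// sqrtr_sqr ger0_norm.
Qed.

Lemma sqn_lt p (a : R) : 0 <= a -> (sqn p < a ^+ 2) = (enorm p < a).
Proof. by move=> a0; rewrite -sqr_enorm ltr_pXn2r// nnegrE enorm_ge0. Qed.

Lemma jet2_sqn D (a : plane) :
  jet2 D (fun p => sqn (p - a))
    (fun b p => if b then 2 * (p.2 - a.2) else 2 * (p.1 - a.1)) (fun _ _ => 2).
Proof.
have H1 := jet2D (jet2_fst_coord D) (jet2_cst D (- a.1)).
have H2 := jet2D (jet2_snd_coord D) (jet2_cst D (- a.2)).
have [c j k] := jet2D (jet2M H1 H1) (jet2M H2 H2); split.
- by move=> p Dp; apply: (c p Dp).
- move=> [] p Dp; [apply: (is_derive_eq (j true p Dp))|apply: (is_derive_eq (j false p Dp))];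
  rewrite /axis /=; ring.
- move=> b p Dp; have := k b p Dp.
  have -> : (fun p0 : plane => (p0.1 - a.1) * ((axis R b).1 + 0) +
       (p0.1 - a.1) * ((axis R b).1 + 0) + ((p0.2 - a.2) * ((axis R b).2 + 0) +
       (p0.2 - a.2) * ((axis R b).2 + 0))) =
     (if b then fun p0 : plane => 2 * (p0.2 - a.2) else fun p0 => 2 * (p0.1 - a.1)).
    by apply/funext => q; case: b; rewrite /axis /=; ring.
  move=> H; have := is_derive_eq H; case: b {H} => H; apply: H; rewrite /axis /=; ring.
Qed.

Lemma harmonic_ln_sqn D (a : plane) : ~ D a -> harmonic D (fun p => ln (sqn (p - a))).
Proof.
move=> Da; have P p : D p -> 0 < sqn (p - a).
  by move=> Dp; rewrite sqn_gt0 subr_eq0; apply/eqP => pa; apply: Da; rewrite -pa.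
do 2!eexists; split; first exact: jet2_ln (jet2_sqn D a) P.
move=> p Dp /=; have := P p Dp; rewrite /sqn /= => H.
by field; rewrite gt_eqF.
Qed.

End Calculus.

(** * The maximum principle *)

Section MaximumPrinciple.
Variable R : realType.
Local Notation plane := (R * R)%type.
Implicit Types (p q v z : plane) (D E : set plane) (f : plane -> R).

(** Euclidean discs and the squares of the product topology generate the same neighbourhoods: the
    disc of radius [r] lies in the square of half side [r] and contains the one of half side
    [r / 2]. *)
Lemma nbhs_sqnP p (A : set plane) :
  nbhs p A <-> exists2 r : R, 0 < r & forall z, sqn (z - p) < r ^+ 2 -> A z.
Proof.
split.
- move=> /nbhs_ballP[r /= r0 rA]; exists r => // z zr; apply: rA.
  have H (x y : R) : x ^+ 2 + y ^+ 2 < r ^+ 2 -> `|x| < r.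
    move=> xy; rewrite -(ltr_pXn2r (_ : (0 < 2)%N))// ?nnegrE ?ltW//.
    by rewrite real_normK ?num_real// (le_lt_trans _ xy)// lerDl sqr_ge0.
  rewrite -ball_normE /ball_/= prod_normE/= gt_max distrC (distrC p.2).
  move: zr; rewrite /sqn/= => zr.
  by rewrite (H _ (z.2 - p.2))// (H _ (z.1 - p.1))// addrC.
- move=> [r r0 rA]; apply/nbhs_ballP; exists (r / 2) => /=; first by rewrite divr_gt0.
  move=> z; rewrite -ball_normE /ball_/= prod_normE/= gt_max => /andP[h1 h2].
  apply: rA; rewrite /sqn/= -(real_normK (num_real (_ - _))) -(real_normK (num_real (z.2 - _))).
  rewrite distrC (distrC _ p.2).
  have := normr_ge0 (p.1 - z.1); have := normr_ge0 (p.2 - z.2).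
  move: h1 h2; move: (`|_|) (`|_|) => x y; nra.
Qed.

Lemma near_line p v (A : set plane) : nbhs p A -> \forall t \near (0 : R), A (p + t *: v).
Proof.
move=> pA; have : {for (0 : R), continuous (fun t : R => p + t *: v)}.
  by apply: cvgD; [exact: cvg_cst|apply: cvgZr_tmp; exact: cvg_id].
by move=> /(_ A); rewrite scale0r addr0 => /(_ pA).
Qed.

Lemma is_derive_derivable (V W : normedModType R) (f : V -> W) (x v : V) d :
  is_derive x v f d -> derivable f x v.
Proof. by case. Qed.

Lemma is_derive_val (V W : normedModType R) (f : V -> W) (x v : V) d :
  is_derive x v f d -> 'D_v f x = d.
Proof. by case. Qed.

Lemma is_derive_cvg (V W : normedModType R) (f : V -> W) (x v : V) d :
  is_derive x v f d -> (fun h : R => h^-1 *: (f (h *: v + x) - f x)) @ 0^' --> d.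
Proof. by move=> [df <-]; exact: df. Qed.

Lemma pos_derive_right (f : R -> R) (x d : R) : is_derive x 1 f d -> 0 < d ->
  \forall t \near 0^'+, f x < f (x + t).
Proof.
move=> /is_derive_cvg/cvg_dnbhs_at_right/cvgrPdist_lt H /H{}H; near=> t.
have t0 : 0 < t by [].
have : `|d - t^-1 *: (f (t *: 1 + x) - f x)| < d by near: t.
rewrite -[t *: 1]/(t * 1) mulr1 ltr_norml => /andP[_].
rewrite -[_ *: _]/(_ * _) ltrBlDr ltrDl pmulr_rgt0 ?invr_gt0//.
by rewrite subr_gt0 addrC.
Unshelve. all: by end_near. Qed.

Lemma near_ltr (T : topologicalType) (f : T -> R) (x : T) (c : R) :
  {for x, continuous f} -> f x < c -> \forall z \near x, f z < c.
Proof. by move=> cf fx; apply: (cf [set y | y < c]); exact: lt_nbhsl. Qed.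

Lemma near_gtr (T : topologicalType) (f : T -> R) (x : T) (c : R) :
  {for x, continuous f} -> c < f x -> \forall z \near x, c < f z.
Proof. by move=> cf fx; apply: (cf [set y | c < y]); exact: lt_nbhsr. Qed.

Lemma near_right0P (P : R -> Prop) :
  (\forall t \near 0^'+, P t) <-> exists2 s : R, 0 < s & forall t, 0 < t -> t < s -> P t.
Proof.
split=> [/nbhs_right0P[s /= s0 sP]|[s s0 sP]].
  exists s => // t t0 ts; have := sP t; rewrite add0r; apply => //.
  by rewrite /= sub0r normrN gtr0_norm.
by near=> t; apply: sP; near: t; [exact: nbhs_right_gt|exact: nbhs_right_lt].
Unshelve. all: by end_near. Qed.

(** If [h q] were positive, [g], which vanishes at the maximum, would be positive just beyond [q] on
    the line, and by the mean value theorem [f] would exceed its maximum there. *)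
Lemma second_derivative_test D f g h (b : bool) q : nbhs q D ->
  pdif D b f g -> pdif D b g h -> (\forall z \near q, f z <= f q) -> h q <= 0.
Proof.
move=> qD df dg fmax; rewrite leNgt; apply/negP => h0.
have Dq : D q by exact: nbhs_singleton.
pose e := axis R b.
have H : \forall t \near (0 : R), D (q + t *: e) /\ f (q + t *: e) <= f q.
  by apply: filterI; [exact: near_line qD|exact: near_line fmax].
have [r /= r0 rP] : exists2 r : R, 0 < r & forall t : R, `|t| < r ->
    D (q + t *: e) /\ f (q + t *: e) <= f q.
  move: H => /nbhs_ballP[r /= r0 rP]; exists r => // t tr.
  by have := rP t; rewrite -ball_normE /ball_/= sub0r normrN; apply.
pose phi t := f (q + t *: e); pose psi t := g (q + t *: e).
have dphi (t : R) : `|t| < r -> is_derive t 1 phi (psi t).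
  by move=> /rP[Dt _]; apply: is_derive_line; exact: df.
have dpsi : is_derive (0:R) 1 psi (h q).
  by apply: is_derive_line; rewrite scale0r addr0; exact: dg.
have psi0 : psi 0 = 0.
  have r2 : - r < r by rewrite gtrN.
  have := @derive1_at_max R phi (- r) r 0 (ltW r2).
  have hin t : t \in `](- r), r[%R -> `|t| < r by rewrite in_itv/= ltr_norml.
  move=> /(_ (fun t tr => is_derive_derivable (dphi t (hin t tr)))).
  have i0 : 0 \in `](-r), r[%R by rewrite in_itv/= oppr_lt0 r0.
  move=> /(_ i0) H0; rewrite -(is_derive_val (dphi 0 _)) ?normr0//.
  apply/is_derive_val/H0 => t tr.
  by rewrite {2}/phi scale0r addr0; exact: (rP t (hin t tr)).2.
have /near_right0P[s s0 sP] : \forall t \near 0^'+, 0 < psi t.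
  have := pos_derive_right dpsi h0; rewrite psi0.
  by apply: filterS => t; rewrite add0r.
pose t := Num.min (r / 2) (s / 2).
have t0 : 0 < t by rewrite lt_min !divr_gt0.
have tr : t < r by rewrite gt_min ltr_pdivrMr// ltr_pMr// ltr1n.
have ts : t < s.
  by rewrite gt_min orbC ltr_pdivrMr// ltr_pMr// ltr1n.
have cphi : {within `[0, t], continuous phi}.
  apply: derivable_within_continuous => x; rewrite in_itv/= => /andP[x0 xt].
  by apply: (is_derive_derivable (dphi x _)); rewrite ger0_norm// (le_lt_trans xt).
have [x|c] := @MVT R phi psi 0 t t0 _ cphi.
  rewrite in_itv/= => /andP[x0 xt]; apply: dphi.
  by rewrite gtr0_norm// (lt_trans xt).
rewrite in_itv/= => /andP[c0 ct] E.
have : phi t <= phi 0.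
  rewrite {2}/phi scale0r addr0; apply: (rP t _).2; rewrite gtr0_norm//.
rewrite -subr_le0 E subr0 leNgt => /negP; apply.
apply: mulr_gt0 => //; apply: sP => //; exact: lt_trans ct ts.
Qed.

Lemma compact_bounded_closed (A : set plane) (r : R) :
  closed A -> (forall z, A z -> sqn z < r) -> compact A.
Proof.
move=> cA Ar; pose s := 1 + `|r|.
apply: (@subclosed_compact _ _ (`[- s, s] `*` `[- s, s])) => //.
  by apply: compact_setX; exact: segment_compact.
have s1 : 1 <= s by rewrite lerDl.
have rs : r <= s ^+ 2.
  apply: (le_trans (ler_norm r)); rewrite expr2.
  have := normr_ge0 r; rewrite /s; nra.
have B (x y : R) : x ^+ 2 + y ^+ 2 < r -> x \in `[- s, s].
  move=> H; rewrite in_itv/= -ler_norml -(ler_pXn2r (_ : (0 < 2)%N))// ?nnegrE//; last first.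
    by rewrite (le_trans ler01).
  rewrite real_normK ?num_real//; apply: le_trans rs; apply: le_trans (ltW H).
  by rewrite lerDl sqr_ge0.
move=> [x y] /Ar; rewrite /sqn/= => H; split => /=; first exact: B H.
by apply: B; rewrite addrC; exact: H.
Qed.

(** If [f] took a value [m > 0], the set where [f] is at least [m / 2] would be compact in [D].
    Adding a small multiple of [|z|^2] makes the Laplacian strictly positive, which is impossible at
    an interior maximum. The conditions at the boundary and at infinity are one-sided limits, so [D]
    may be unbounded and [f] need not extend to its boundary. *)
Theorem maximum_principle D f : open D -> subharmonic D f ->
  (forall x, closure D x -> ~ D x ->
     forall e, 0 < e -> \forall z \near x, D z -> f z < e) ->
  (forall e, 0 < e -> exists r, forall z, D z -> r <= sqn z -> f z < e) ->
  forall z, D z -> f z <= 0.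
Proof.
move=> oD sf bf inf p Dp; rewrite leNgt; apply/negP => fp0.
set m := f p in fp0; have m2 : 0 < m / 2 by rewrite divr_gt0.
pose A := [set z | D z /\ m / 2 <= f z].
have [r rP] := inf _ m2.
have Ar z : A z -> sqn z < r.
  by move=> [Dz mz]; rewrite ltNge; apply/negP => /(rP _ Dz); rewrite ltNge mz.
have cA : compact A.
  apply: (@compact_bounded_closed _ r) => // x clx.
  have [Dx|nDx] := pselect (D x).
    split => //; rewrite leNgt; apply/negP => fx.
    have H : \forall z \near x, f z < m / 2.
      exact: near_ltr (subharmonic_cont sf Dx) fx.
    by have [z [[_ mz]]] := clx _ H; rewrite ltNge mz.
  have clDx : closure D x by apply: closure_subset clx => z [].
  have [z [[Dz mz]]] := clx _ (bf x clDx nDx _ m2).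
  by move=> /(_ Dz); rewrite ltNge mz.
have Ap : A p by split=> //; rewrite ler_pdivrMr// ler_pMr// ler1n.
have r0 : 0 < r by apply: le_lt_trans (Ar _ Ap); exact: sqn_ge0.
(* The perturbation is at most [m / 4] on [A], so at the maximum of [w] the value of [f] is at least
   [3 m / 4], above the threshold [m / 2]: the maximum is interior to [A]. *)
pose d := m / (4 * r).
have d0 : 0 < d by rewrite divr_gt0// mulr_gt0.
pose w := (fun z => f z + d * sqn (z - 0)).
have [g [h [j l]]] := sf.
have jw := jet2D j (jet2Z d (jet2_sqn D 0)).
have cw : {within A, continuous w}.
  apply: continuous_in_subspaceT => z; rewrite inE => -[Dz _]; exact: jet2_cont jw _ Dz.
have [q] := compact_EVT_max (ex_intro _ p Ap) cA cw.
rewrite inE => Aq wmax; have [Dq _] := Aq.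
have fq : m * 3 / 4 <= f q.
  have : m <= w q.
    apply: (@le_trans _ _ (w p)); last by apply: wmax; rewrite inE.
    by rewrite lerDl mulr_ge0 ?sqn_ge0// ltW.
  have : d * sqn (q - 0) <= m / 4.
    rewrite subr0 /d -mulrA ler_pM2l// -[4^-1]mulr1 invfM -mulrA ler_pM2l// ?invr_gt0//.
    by rewrite ler_pdivrMl// mulr1 ltW// Ar.
  rewrite {1}/w; lra.
have nA : \forall z \near q, A z.
  have H1 : \forall z \near q, m / 2 < f z.
    apply: (near_gtr (subharmonic_cont sf Dq)); lra.
  have H2 : \forall z \near q, D z by exact: open_nbhs_nbhs.
  by apply: filterS2 H1 H2 => z hz Dz; split => //; exact: ltW.
have nmax : \forall z \near q, w z <= w q.
  by apply: filterS nA => z Az; apply: wmax; rewrite inE.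
have nD : nbhs q D by apply: open_nbhs_nbhs.
have h0 := second_derivative_test nD (@jet2_fst _ _ _ _ _ jw false) (@jet2_snd _ _ _ _ _ jw false) nmax.
have h1 := second_derivative_test nD (@jet2_fst _ _ _ _ _ jw true) (@jet2_snd _ _ _ _ _ jw true) nmax.
have := l q Dq; move: h0 h1 => /=; lra.
Qed.

End MaximumPrinciple.

(** * Unique continuation *)

Section UniqueContinuation.
Variable R : realType.
Local Notation plane := (R * R)%type.
Implicit Types (p q v z : plane) (D E Omega : set plane) (f a b c d : plane -> R).

Lemma sqn_continuous p : continuous (fun z => sqn (z - p)).
Proof. by move=> z; apply: (jet2_cont (jet2_sqn setT p)). Qed.

Lemma closure_ler D f x (c : R) : {for x, continuous f} ->
  (forall z, D z -> f z <= c) -> closure D x -> f x <= c.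
Proof.
move=> cf fc cl; rewrite leNgt; apply/negP => cfx.
by have [z [Dz]] := cl _ (near_gtr cf cfx); rewrite ltNge fc.
Qed.

Lemma closure_ger D f x (c : R) : {for x, continuous f} ->
  (forall z, D z -> c <= f z) -> closure D x -> c <= f x.
Proof.
move=> cf fc cl; rewrite leNgt; apply/negP => cfx.
by have [z [Dz]] := cl _ (near_ltr cf cfx); rewrite ltNge fc.
Qed.

Lemma closure_ler_sqn D x p (r : R) :
  (forall z, D z -> sqn (z - p) <= r) -> closure D x -> sqn (x - p) <= r.
Proof. by apply: (@closure_ler D (fun z => sqn (z - p))); exact: sqn_continuous. Qed.

Lemma closure_ger_sqn D x p (r : R) :
  (forall z, D z -> r <= sqn (z - p)) -> closure D x -> r <= sqn (x - p).
Proof. by apply: (@closure_ger D (fun z => sqn (z - p))); exact: sqn_continuous. Qed.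

Lemma open_ltr f (c : R) : continuous f -> open [set z | f z < c].
Proof. by move=> cf; apply: (@open_comp _ _ f [set y | y < c]) => [z _|]; [exact: cf|exact: open_lt]. Qed.

Lemma open_gtr f (c : R) : continuous f -> open [set z | c < f z].
Proof. by move=> cf; apply: (@open_comp _ _ f [set y | c < y]) => [z _|]; [exact: cf|exact: open_gt]. Qed.

Lemma closed_ler f (c : R) : continuous f -> closed [set z | f z <= c].
Proof. by move=> cf x; apply: closure_ler; [exact: cf|move=> z]. Qed.

Lemma closed_disc_compact p (r : R) : compact [set z : plane | sqn (z - p) <= r].
Proof.
(* This uses [|z|^2 <= 2 |z - p|^2 + 2 |p|^2]. *)
apply: (@compact_bounded_closed _ _ (2 * (r + sqn p) + 1)).
  by apply: closed_ler; exact: sqn_continuous.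
move=> [x y]; rewrite /= /sqn/= => H.
have := sqr_ge0 (x - 2 * p.1); have := sqr_ge0 (y - 2 * p.2).
by move: H; rewrite !expr2; nra.
Qed.

Lemma disc_bound D f p (r : R) : 0 <= r -> (forall z, D z -> {for z, continuous f}) ->
  (forall z, sqn (z - p) <= r -> D z) -> exists C, forall z, sqn (z - p) <= r -> `|f z| <= C.
Proof.
move=> r0 cf rD; pose A := [set z : plane | sqn (z - p) <= r].
have [||m _ mA] := @compact_EVT_max _ R (fun z => `|f z|) A _ (@closed_disc_compact p r).
- by exists p; rewrite /A/= subrr sqn0.
- apply: continuous_in_subspaceT => z; rewrite inE => Az.
  by apply: (@continuous_comp _ _ _ f Num.norm); [exact/cf/rD|exact: norm_continuous].
by exists `|f m| => z zr; apply: mA; rewrite inE.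
Qed.

(* [hol D a b a' b']: the complex function [a + i b] is holomorphic on [D], with
   derivative [a' + i b'] there. *)
Record hol D a b a' b' : Prop := Hol {
  hol_re_cont : forall p, D p -> {for p, continuous a} ;
  hol_im_cont : forall p, D p -> {for p, continuous b} ;
  hol_re_x : pdif D false a a' ;
  hol_re_y : pdif D true a (fun p => - b' p) ;
  hol_im_x : pdif D false b b' ;
  hol_im_y : pdif D true b a' }.

Lemma hol_sub D E a b a' b' : E `<=` D -> hol D a b a' b' -> hol E a b a' b'.
Proof.
move=> ED [h1 h2 h3 h4 h5 h6]; split=> p /ED.
- exact: h1. - exact: h2. - exact: h3. - exact: h4. - exact: h5. - exact: h6.
Qed.

Lemma hol_jet2_re D a b a1 b1 a2 b2 : hol D a b a1 b1 -> hol D a1 b1 a2 b2 ->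
  jet2 D a (fun k p => if k then - b1 p else a1 p) (fun k p => if k then - a2 p else a2 p).
Proof.
move=> [h1 h2 h3 h4 h5 h6] [k1 k2 k3 k4 k5 k6]; split.
- exact: h1.
- by case=> p Dp /=; [exact: h4|exact: h3].
- case=> p Dp /=; last exact: k3.
  exact: (@is_deriveN _ _ _ _ _ _ _ (k6 p Dp)).
Qed.

Lemma hol_jet2_im D a b a1 b1 a2 b2 : hol D a b a1 b1 -> hol D a1 b1 a2 b2 ->
  jet2 D b (fun k p => if k then a1 p else b1 p) (fun k p => if k then - b2 p else b2 p).
Proof.
move=> [h1 h2 h3 h4 h5 h6] [k1 k2 k3 k4 k5 k6]; split.
- exact: h2.
- by case=> p Dp /=; [exact: h6|exact: h5].
- by case=> p Dp /=; [exact: k4|exact: k5].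
Qed.

(** For [e > 0] the logarithm stays smooth across the zeros of [a + i b] and its Laplacian is
    nonnegative. For [e = 0], where the function has no zero, it is harmonic. The second derivatives
    of [a] and [b] are obtained from the first ones of the complex derivative, hence the second
    [hol] hypothesis. *)
Lemma hol_ln_jet2 D a b a1 b1 a2 b2 (e : R) : hol D a b a1 b1 -> hol D a1 b1 a2 b2 ->
  (forall p, D p -> 0 < a p ^+ 2 + b p ^+ 2 + e) ->
  exists g h, jet2 D (fun p => ln (a p ^+ 2 + b p ^+ 2 + e)) g h /\
  (forall p, D p -> h false p + h true p =
     4 * e * (a1 p ^+ 2 + b1 p ^+ 2) / (a p ^+ 2 + b p ^+ 2 + e) ^+ 2) /\
  (forall p, D p -> g false p = 2 * (a p * a1 p + b p * b1 p) / (a p ^+ 2 + b p ^+ 2 + e)) /\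
  (forall p, D p -> g true p = 2 * (b p * a1 p - a p * b1 p) / (a p ^+ 2 + b p ^+ 2 + e)).
Proof.
move=> h k S0; have ja := hol_jet2_re h k; have jb := hol_jet2_im h k.
have j := jet2D (jet2D (jet2M ja ja) (jet2M jb jb)) (jet2_cst D e).
have {}j := jet2_ln j; do 2!eexists; split; first by apply: j => p /S0; rewrite !expr2.
by split; [|split] => p /S0 /=; rewrite !expr2 => P; field; rewrite gt_eqF.
Qed.

Lemma hol_ln_subharmonic D a b a1 b1 a2 b2 (e : R) : 0 < e ->
  hol D a b a1 b1 -> hol D a1 b1 a2 b2 ->
  subharmonic D (fun p => ln (a p ^+ 2 + b p ^+ 2 + e)).
Proof.
move=> e0 h k; have [|g [l [j [E _]]]] := hol_ln_jet2 (e := e) h k.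
  by move=> p _; rewrite ltr_wpDl// addr_ge0 ?sqr_ge0.
exists g, l; split => // p Dp; rewrite E// divr_ge0 ?sqr_ge0//.
by rewrite !mulr_ge0 ?addr_ge0 ?sqr_ge0// ltW.
Qed.

Lemma ln_mul_expr_div (A x y : R) n : 0 < A -> 0 < x -> 0 < y ->
  0 < A * (x / y) ^+ n /\ ln (A * (x / y) ^+ n) = ln A + n%:R * (ln x - ln y).
Proof.
move=> A0 x0 y0; have q0 : 0 < x / y by rewrite divr_gt0.
have qn : 0 < (x / y) ^+ n by rewrite exprn_gt0.
split; first by rewrite mulr_gt0.
rewrite lnM ?posrE// lnXn// lnM ?posrE ?invr_gt0// lnV ?posrE//.
by rewrite -[(_ + _) *+ n]mulr_natl.
Qed.

(* Hadamard's three circles theorem for [ln (|a + i b|^2 + e)], with inner radius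
   and [e] tending to 0. *)
Lemma flat_hol_eq0 D a b a1 b1 a2 b2 p (r : R) : 0 < r ->
  (forall z, sqn (z - p) <= r -> D z) ->
  hol D a b a1 b1 -> hol D a1 b1 a2 b2 ->
  (forall n (e : R), 0 < e ->
     \forall z \near p, a z ^+ 2 + b z ^+ 2 <= e * sqn (z - p) ^+ n) ->
  forall z, sqn (z - p) < r -> a z ^+ 2 + b z ^+ 2 = 0.
Proof.
move=> r0 rD h k flat z0 z0r.
have [->|z0p] := eqVneq z0 p.
  apply/eqP; rewrite eq_le addr_ge0 ?sqr_ge0// andbT.
  have := nbhs_singleton (flat 1%N 1 ltr01).
  by rewrite expr1 mul1r /sqn !subrr expr0n addr0.
set rho := sqn (z0 - p) in z0r.
have rho0 : 0 < rho by rewrite sqn_gt0 subr_eq0.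
pose S z := a z ^+ 2 + b z ^+ 2; rewrite -/(S z0).
have S0 z : 0 <= S z by rewrite addr_ge0 ?sqr_ge0.
have cS z : D z -> {for z, continuous S}.
  by move=> Dz; apply: cvgD; apply: cvgM; do ?[exact: hol_re_cont h _ Dz|exact: hol_im_cont h _ Dz].
have [M M0 SM] : exists2 M, 0 < M & forall z, sqn (z - p) <= r -> S z <= M.
  have [C CS] := disc_bound (ltW r0) cS rD.
  exists (`|C| + 1); first by rewrite ltr_wpDl.
  by move=> z /CS SC; have := ler_norm (S z); have := ler_norm C; move: SC; lra.
have key n : S z0 <= 2 * M * (rho / r) ^+ n.
  (* With this constant, [2 e = M (eta / r)^n] on the inner circle, which is what [V <= 0] requires
     there. *)
  have t0 : 0 < (M / 2) / r ^+ n by rewrite !divr_gt0// exprn_gt0.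
  have /nbhs_sqnP[s s0 sP] := flat n _ t0.
  pose eta := Num.min (s ^+ 2 / 2) (rho / 2).
  have eta0 : 0 < eta by rewrite lt_min !divr_gt0// exprn_gt0.
  have etas : eta < s ^+ 2.
    by rewrite gt_min ltr_pdivrMr// ltr_pMr ?exprn_gt0// ltr1n.
  have etarho : eta < rho.
    by rewrite gt_min orbC ltr_pdivrMr// ltr_pMr// ltr1n.
  pose e := M / 2 / r ^+ n * eta ^+ n.
  have e0 : 0 < e by rewrite mulr_gt0// exprn_gt0.
  have eM : e <= M / 2.
    rewrite /e -mulrA ger_pMr ?divr_gt0// ler_pdivrMl ?exprn_gt0// mulr1.
    by rewrite lerXn2r ?nnegrE ?ltW// (lt_trans etarho).
  (* [V <= 0] is the three circles inequality [S + e <= (M + e) (|z - p|^2 / r)^n]; note that [eta],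
     [rho] and [r] are squared radii. *)
  pose V z := ln (S z + e) + - n%:R * ln (sqn (z - p)) + (n%:R * ln r - ln (M + e)).
  pose D' := [set z | D z /\ z <> p].
  have sV : subharmonic D' V.
    apply: subharmonicD; last exact/harmonic_subharmonic/harmonic_cst.
    apply: subharmonicD.
      by apply: (subharmonic_sub _ (hol_ln_subharmonic e0 h k)) => z [].
    apply/harmonic_subharmonic/harmonicZ/harmonic_ln_sqn; by case.
  pose Ann := [set z | eta < sqn (z - p) /\ sqn (z - p) < r].
  have oAnn : open Ann.
    by apply: openI; [apply: open_gtr|apply: open_ltr]; exact: sqn_continuous.
  have clAnn x : closure Ann x -> eta <= sqn (x - p) <= r.
    move=> clx; apply/andP; split.
      by apply: closure_ger_sqn clx => z [/ltW].
    by apply: closure_ler_sqn clx => z [_ /ltW].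
  have AD' x : eta <= sqn (x - p) <= r -> D' x.
    move=> /andP[x1 x2]; split; first exact: rD.
    move=> xp; move: x1; rewrite xp subrr sqn0 leNgt.
    by rewrite eta0.
  have /(_ z0) : forall z, Ann z -> V z <= 0.
    apply: maximum_principle => //.
    - by apply: subharmonic_sub sV => z [z1 z2]; apply: AD'; rewrite !ltW.
    - move=> x /clAnn xA nAx d d0.
      have Vx : V x < d.
        apply: le_lt_trans d0; move: (xA) => /andP[x1]; rewrite le_eqVlt => /orP[/eqP xr|xr].
          rewrite /V xr mulNr addrA addrNK subr_le0 ler_ln ?posrE.
          + by rewrite lerD2r SM// xr.
          + by rewrite ltr_wpDl.
          + by rewrite addr_gt0.
        have xeta : sqn (x - p) = eta.
          apply/eqP; rewrite eq_le x1 andbT leNgt; apply/negP => hx.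
          by apply: nAx.
        rewrite /V xeta.
        have Sx : S x <= e by rewrite /e -xeta; apply: sP; rewrite xeta.
        have Se : S x + e <= (M + e) * (eta / r) ^+ n.
          apply: (@le_trans _ _ (M * (eta / r) ^+ n)).
            apply: (@le_trans _ _ (e + e)); first by rewrite lerD2r.
            have -> : M * (eta / r) ^+ n = e + e; last by rewrite lexx.
            by rewrite /e expr_div_n; field; rewrite gt_eqF// exprn_gt0.
          by rewrite ler_pM2r ?lerDl ?ltW// exprn_gt0// divr_gt0.
        have Se0 : 0 < S x + e by rewrite ltr_wpDl.
        have [P lnP] := ln_mul_expr_div n (addr_gt0 M0 e0) eta0 r0.
        move: Se; rewrite -ler_ln ?posrE// lnP; clear; lra.
      have := near_ltr (subharmonic_cont sV (AD' _ xA)) Vx.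
      by apply: filterS => z.
    - move=> d d0; exists (2 * (r + sqn p) + 1) => -[x y] [_].
      rewrite /sqn/= => H1 H2; exfalso.
      have := sqr_ge0 (x - 2 * p.1); have := sqr_ge0 (y - 2 * p.2).
      move: H1 H2; rewrite !expr2; nra.
  move=> /(_ (conj etarho z0r)); rewrite /V -/rho => H.
  have [P lnP] := ln_mul_expr_div n (addr_gt0 M0 e0) rho0 r0.
  have : ln (S z0 + e) <= ln ((M + e) * (rho / r) ^+ n).
    by rewrite lnP; move: H; clear; lra.
  rewrite ler_ln ?posrE ?ltr_wpDl// => H1.
  apply: (@le_trans _ _ (S z0 + e)); first by rewrite lerDl ltW.
  apply: (le_trans H1); rewrite ler_pM2r ?exprn_gt0 ?divr_gt0//.
  by move: eM M0; clear; lra.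
apply/eqP; rewrite eq_le S0 andbT.
have q0 : 0 <= rho / r by rewrite divr_ge0 ?ltW.
have q1 : `|rho / r| < 1 by rewrite ger0_norm// ltr_pdivrMr// mul1r.
have L : (fun n : nat => 2 * M * (rho / r) ^+ n) @ \oo --> (0 : R).
  exact: (cvg_geometric (2 * M) q1).
have := limr_ge (cvgP _ L) (nearW _ key); rewrite (cvg_lim _ L)//.
by apply.
Qed.

(** The interior of the zero set is relatively closed: a limit point [x] has an interior zero [q] at
    distance less than [r / 4], and the disc of radius [r / 2] about [q] lies in [Omega] and covers
    the disc of radius [r / 4] about [x]. The function vanishes to infinite order at [q], hence on
    that disc. *)
Lemma hol_unique_continuation Omega a b a1 b1 a2 b2 : open Omega -> connected Omega ->
  hol Omega a b a1 b1 -> hol Omega a1 b1 a2 b2 ->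
  (exists2 p, Omega p & \forall z \near p, a z ^+ 2 + b z ^+ 2 = 0) ->
  forall z, Omega z -> a z ^+ 2 + b z ^+ 2 = 0.
Proof.
move=> oO cO h k [p Op p0]; pose Z := [set z | a z ^+ 2 + b z ^+ 2 = 0].
suff E : Omega `&` Z° = Omega.
  move=> z Oz; have : (Omega `&` Z°) z by rewrite E.
  by case=> _ /interior_subset.
apply: cO; first by exists p.
  by exists Z°; [exact: open_interior|].
exists (closure (Omega `&` Z°)); first exact: closed_closure.
apply/seteqP; split=> x [Ox xZ]; split=> //; first exact: subset_closure.
have /nbhs_sqnP[r r0 rO] : nbhs x Omega by apply: open_nbhs_nbhs.
have : nbhs x [set z | sqn (z - x) < (r / 4) ^+ 2].
  by apply/nbhs_sqnP; exists (r / 4); rewrite ?divr_gt0.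
move=> /xZ[q [[Oq Zq] /= xq]].
have s0 : 0 < (r / 2) ^+ 2 by rewrite exprn_gt0// divr_gt0.
have N z : sqn (z - q) <= (r / 2) ^+ 2 -> Omega z.
  move=> zq; apply: rO; move: xq zq; rewrite /sqn/=.
  have -> : z.1 - x.1 = (z.1 - q.1) + (q.1 - x.1) by ring.
  have -> : z.2 - x.2 = (z.2 - q.2) + (q.2 - x.2) by ring.
  move: (z.1 - q.1) (z.2 - q.2) (q.1 - x.1) (q.2 - x.2) => s t u w h1 h2.
  have := sqr_ge0 (s - 2 * u); have := sqr_ge0 (t - 2 * w).
  have : 0 < r * r by rewrite mulr_gt0.
  move: h1 h2; rewrite !expr2; nra.
have H := flat_hol_eq0 s0 N h k.
have flat n (e : R) : 0 < e -> \forall z \near q, a z ^+ 2 + b z ^+ 2 <= e * sqn (z - q) ^+ n.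
  move=> e0; apply: filterS Zq => z ->.
  by rewrite mulr_ge0 ?exprn_ge0 ?sqn_ge0// ltW.
have {}H := H flat.
rewrite /interior/=; apply/nbhs_sqnP; exists (r / 4); first by rewrite divr_gt0.
move=> z zx; apply: H; move: xq zx; rewrite /sqn/=.
have -> : z.1 - q.1 = (z.1 - x.1) - (q.1 - x.1) by ring.
have -> : z.2 - q.2 = (z.2 - x.2) - (q.2 - x.2) by ring.
move: (z.1 - x.1) (z.2 - x.2) (q.1 - x.1) (q.2 - x.2) => s t u w h1 h2.
have := sqr_ge0 (s + u); have := sqr_ge0 (t + w).
move: h1 h2; rewrite !expr2; nra.
Qed.

End UniqueContinuation.

(** * Differentiation along the axes *)

Section PlaneCalculus.
Variable R : realType.
Local Notation plane := (R * R)%type.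
Implicit Types (p q v z : plane) (D E : set plane) (f : plane -> R).

Lemma is_deriveZdir f p v (c d : R) : is_derive p v f d -> is_derive p (c *: v) f (c * d).
Proof.
move=> H; apply: is_derive_lineV.
have -> : (fun t : R => f (p + t *: (c *: v))) = (fun s : R => f (p + s *: v)) \o (fun t => c * t).
  by apply/funext => t /=; rewrite scalerA mulrC.
rewrite mulrC; apply: is_derive1_comp.
  by rewrite mulr0; apply: is_derive_line; rewrite scale0r addr0.
apply: (is_derive_eq (@is_deriveZ _ _ _ (@id R) c 0 1 1 _)).
by rewrite /GRing.scale /= mulr1.
Qed.

Lemma line_MVT D f (g : plane -> R) p v : (forall q, D q -> is_derive q v f (g q)) ->
  (forall t : R, 0 <= t <= 1 -> D (p + t *: v)) ->
  exists2 t : R, 0 < t < 1 & f (p + v) - f p = g (p + t *: v).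
Proof.
move=> fg Dt; pose phi t := f (p + t *: v).
have dphi (t : R) : 0 <= t <= 1 -> is_derive t 1 phi (g (p + t *: v)).
  by move=> t01; apply/is_derive_line/fg/Dt.
have [||t] := @MVT R phi (fun t => g (p + t *: v)) 0 1 ltr01.
- by move=> x; rewrite in_itv/= => /andP[x0 x1]; apply: dphi; rewrite !ltW.
- apply: derivable_within_continuous => x; rewrite in_itv/= => x01.
  exact: is_derive_derivable (dphi x x01).
rewrite in_itv/= /phi scale0r scale1r subr0 mulr1 addr0 => t01 ->.
by exists t.
Qed.

Lemma pdif_MVT D b f (g : plane -> R) p (c : R) : pdif D b f g ->
  (forall t : R, 0 <= t <= 1 -> D (p + (t * c) *: axis R b)) ->
  exists2 t : R, 0 < t < 1 & f (p + c *: axis R b) - f p = c * g (p + (t * c) *: axis R b).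
Proof.
move=> fg Dt; have [q /fg/is_deriveZdir|t|t t01 ->] := @line_MVT D f (fun q => c * g q) p (c *: axis R b).
- exact.
- by rewrite scalerA; exact: Dt.
- by exists t => //; rewrite scalerA.
Qed.

Lemma addr_axisF p (s : R) : p + s *: axis R false = (p.1 + s, p.2).
Proof. by rewrite -[LHS]/(p.1 + s * 1, p.2 + s * 0) mulr0 mulr1 addr0. Qed.

Lemma addr_axisT p (s : R) : p + s *: axis R true = (p.1, p.2 + s).
Proof. by rewrite -[LHS]/(p.1 + s * 0, p.2 + s * 1) mulr0 mulr1 addr0. Qed.

Lemma nbhs_boxP p (A : set plane) :
  nbhs p A <-> exists2 r : R, 0 < r &
    forall s t : R, `|s| < r -> `|t| < r -> A (p.1 + s, p.2 + t).
Proof.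
split.
- move=> /nbhs_ballP[r /= r0 rA]; exists r => // s t sr tr; apply: rA.
  rewrite -ball_normE /ball_/= prod_normE/= gt_max !opprD !addrA !subrr !add0r.
  by rewrite !normrN sr.
- move=> [r r0 rA]; apply/nbhs_ballP; exists r => // -[x y].
  rewrite -ball_normE /ball_/= prod_normE/= gt_max => /andP[h1 h2].
  have := rA (x - p.1) (y - p.2); rewrite !subrKC distrC (distrC y).
  exact.
Qed.

Lemma normr_scale_lt (u x r : R) : 0 <= u <= 1 -> `|x| < r -> `|u * x| < r.
Proof.
move=> /andP[u0 u1]; rewrite normrM (ger0_norm u0); apply: le_lt_trans.
by rewrite ler_piMl.
Qed.

(** The increment is split along a horizontal and then a vertical segment, and the mean value
    theorem is applied to each. *)
Lemma differential_remainder D f (fx fy : plane -> R) p (e : R) : 0 < e -> nbhs p D ->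
  pdif D false f fx -> pdif D true f fy ->
  {for p, continuous fx} -> {for p, continuous fy} ->
  exists2 r : R, 0 < r & forall s t : R, `|s| < r -> `|t| < r ->
    `|f (p.1 + s, p.2 + t) - f p - (s * fx p + t * fy p)| <= e * (`|s| + `|t|).
Proof.
move=> e0 pD dx dy cx cy.
have Nx : \forall z \near p, `|fx p - fx z| < e by move/cvgrPdist_lt: cx; exact.
have Ny : \forall z \near p, `|fy p - fy z| < e by move/cvgrPdist_lt: cy; exact.
have /nbhs_boxP[r r0 rP] : nbhs p (D `&` ([set z | `|fx p - fx z| < e] `&`
    [set z | `|fy p - fy z| < e])) by do 2!apply: filterI => //.
exists r => // s t sr tr.
have [u u01|u u01 Eu] := pdif_MVT (p := p) (c := s) dx.
  rewrite addr_axisF; have [] := rP (u * s) 0 (normr_scale_lt u01 sr).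
    by rewrite normr0.
  by rewrite addr0.
have [w w01|w w01 Ew] := pdif_MVT (p := (p.1 + s, p.2)) (c := t) dy.
  by rewrite addr_axisT/=; have [] := rP s (w * t) sr (normr_scale_lt w01 tr).
rewrite addr_axisF in Eu; rewrite addr_axisT /= in Ew; rewrite !addr_axisF in Eu.
rewrite addr_axisT /= in Ew.
have -> : f (p.1 + s, p.2 + t) - f p - (s * fx p + t * fy p) =
  s * (fx (p.1 + u * s, p.2) - fx p) + t * (fy (p.1 + s, p.2 + w * t) - fy p).
  by rewrite !mulrBr -Eu -Ew; ring.
rewrite (le_trans (ler_normD _ _))// !normrM mulrDr.
have u01' : 0 <= u <= 1 by move: u01 => /andP[? ?]; rewrite !ltW.
have w01' : 0 <= w <= 1 by move: w01 => /andP[? ?]; rewrite !ltW.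
rewrite lerD// mulrC ler_wpM2r// distrC ltW//.
- have [|_ []] := rP (u * s) 0 (normr_scale_lt u01' sr); first by rewrite normr0.
  by rewrite addr0.
- by have [_ []] := rP s (w * t) sr (normr_scale_lt w01' tr).
Qed.

Lemma C1_is_derive D f (fx fy : plane -> R) p v : nbhs p D ->
  pdif D false f fx -> pdif D true f fy ->
  {for p, continuous fx} -> {for p, continuous fy} ->
  is_derive p v f (v.1 * fx p + v.2 * fy p).
Proof.
move=> pD dx dy cx cy.
suff L : (fun h : R => h^-1 *: (f (h *: v + p) - f p)) @ 0^' --> v.1 * fx p + v.2 * fy p.
  by split; [exact: cvgP L|exact: cvg_lim L].
apply/cvgrPdist_le => e e0; pose m := `|v.1| + `|v.2| + 1.
have m0 : 0 < m by rewrite ltr_wpDl// addr_ge0.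
have em : 0 < e / m by rewrite divr_gt0.
have [r r0 rP] := differential_remainder em pD dx dy cx cy.
have rm : 0 < r / m by rewrite divr_gt0.
near=> h.
have h0 : h != 0 by near: h; exact: nbhs_dnbhs_neq.
have hr : `|h| < r / m by near: h; exact: dnbhs0_lt.
have hv (x : R) : `|x| <= m -> `|h * x| < r.
  move=> xm; rewrite normrM; apply: (@le_lt_trans _ _ (`|h| * m)); first by rewrite ler_wpM2l.
  by rewrite -ltr_pdivlMr.
have := rP (h * v.1) (h * v.2).
have -> : (p.1 + h * v.1, p.2 + h * v.2) = h *: v + p.
  by rewrite [RHS]addrC.
move=> /(_ (hv _ _) (hv _ _)) H.
have {}H := H _ _.
rewrite -[_ *: _]/(_ * _).
have -> : v.1 * fx p + v.2 * fy p - h^-1 * (f (h *: v + p) - f p) =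
  - (h^-1 * (f (h *: v + p) - f p - (h * v.1 * fx p + h * v.2 * fy p))) by field.
rewrite normrN normrM normfV ler_pdivrMl ?normr_gt0//.
apply: le_trans (H _ _) _; rewrite /m.
- by rewrite -addrA lerDl addr_ge0.
- by rewrite (addrC `|v.1|) -addrA lerDl addr_ge0.
rewrite !normrM -mulrDr mulrCA ler_wpM2l// mulrAC ler_pdivrMr// ler_wpM2l// ?ltW//.
by rewrite /m ltrDl.
Unshelve. all: by end_near. Qed.

(** The second difference of [f] over a small square of side [h] is evaluated by the mean value
    theorem in both orders, which yields a value of [fxy] and a value of [fyx] that coincide near
    [p]. *)
Lemma mixed_partials D f (fx fy fxy fyx : plane -> R) p : nbhs p D ->
  pdif D false f fx -> pdif D true f fy -> pdif D true fx fxy -> pdif D false fy fyx ->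
  {for p, continuous fxy} -> {for p, continuous fyx} -> fxy p = fyx p.
Proof.
move=> pD dx dy dxy dyx cxy cyx; apply/eqP; rewrite -subr_eq0 -normr_le0.
apply/ler_addgt0Pr => e e0; rewrite add0r.
have e2 : 0 < e / 2 by rewrite divr_gt0.
have Nx : \forall z \near p, `|fxy p - fxy z| < e / 2 by move/cvgrPdist_lt: cxy; exact.
have Ny : \forall z \near p, `|fyx p - fyx z| < e / 2 by move/cvgrPdist_lt: cyx; exact.
have /nbhs_boxP[r r0 rP] : nbhs p (D `&` ([set z | `|fxy p - fxy z| < e / 2] `&`
    [set z | `|fyx p - fyx z| < e / 2])) by do 2!apply: filterI => //.
pose h := r / 2; have h0 : 0 < h by rewrite divr_gt0.
have hr : h < r by rewrite ltr_pdivrMr// ltr_pMr// ltr1n.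
have small (u : R) : 0 <= u <= 1 -> `|u * h| < r.
  move=> /andP[u0 u1]; rewrite ger0_norm ?mulr_ge0// ?ltW//.
  by apply: le_lt_trans hr; rewrite ler_piMl// ltW.
have Z : `|0 : R| < r by rewrite normr0.
have B (u w : R) : 0 <= u <= 1 -> 0 <= w <= 1 -> D (p.1 + u * h, p.2 + w * h).
  by move=> u01 w01; have [] := rP _ _ (small u u01) (small w w01).
pose D1 := [set z | D z /\ D (z + h *: axis R true)].
pose D2 := [set z | D z /\ D (z + h *: axis R false)].
have i0 : 0 <= (0:R) <= 1 by rewrite lexx ler01.
have i1 : 0 <= (1:R) <= 1 by rewrite lexx ler01.
have d1 : pdif D1 false (fun z => f (z + h *: axis R true) - f z)
   (fun z => fx (z + h *: axis R true) - fx z).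
  move=> z [z1 z2]; apply: is_deriveB (dx _ z1).
  apply: (is_derive_quotient _ (dx _ z2)) => k; congr f; rewrite addrA//.
have d2 : pdif D2 true (fun z => f (z + h *: axis R false) - f z)
   (fun z => fy (z + h *: axis R false) - fy z).
  move=> z [z1 z2]; apply: is_deriveB (dy _ z1).
  apply: (is_derive_quotient _ (dy _ z2)) => k; congr f; rewrite addrA//.
have [u u01|u u01 E1] := pdif_MVT (p := p) (c := h) d1.
  rewrite addr_axisF /D1/= addr_axisT/=; have := B u 0 u01 i0; have := B u 1 u01 i1.
  by rewrite mul0r mul1r addr0.
have [w w01|w w01 E2] := pdif_MVT (p := p) (c := h) d2.
  rewrite addr_axisT /D2/= addr_axisF/=; have := B 0 w i0 w01; have := B 1 w i1 w01.
  by rewrite mul0r mul1r addr0.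
have u01' : 0 <= u <= 1 by move: u01 => /andP[? ?]; rewrite !ltW.
have w01' : 0 <= w <= 1 by move: w01 => /andP[? ?]; rewrite !ltW.
rewrite !addr_axisF in E1 E2; rewrite !addr_axisT /= in E1 E2.
have [u' u1|u' u1 E3] := pdif_MVT (p := (p.1 + u * h, p.2)) (c := h) dxy.
  by rewrite addr_axisT/=; exact: B.
have [w' w1|w' w1 E4] := pdif_MVT (p := (p.1, p.2 + w * h)) (c := h) dyx.
  by rewrite addr_axisF/=; exact: B.
rewrite !addr_axisT /= in E3; rewrite !addr_axisF /= in E4.
rewrite E3 in E1; rewrite E4 in E2.
have E : fxy (p.1 + u * h, p.2 + u' * h) = fyx (p.1 + w' * h, p.2 + w * h).
  have hh : h * h != 0 by rewrite mulf_neq0// gt_eqF.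
  apply: (mulfI hh); move: E1 E2; rewrite !mulrA => <- <-; ring.
have u1' : 0 <= u' <= 1 by move: u1 => /andP[? ?]; rewrite !ltW.
have w1' : 0 <= w' <= 1 by move: w1 => /andP[? ?]; rewrite !ltW.
have [_ [H1 _]] := rP _ _ (small u u01') (small u' u1').
have [_ [_ H2]] := rP _ _ (small w' w1') (small w w01').
move: H1 H2 => /=; rewrite E; move: (fyx (_, _)) => X H1 H2.
have -> : fxy p - fyx p = (fxy p - X) - (fyx p - X) by ring.
rewrite (le_trans (ler_normB _ _))// [leRHS](_ : e = e / 2 + e / 2); last by field.
by rewrite lerD// ltW.
Qed.

Lemma open_closed_connected (T : topologicalType) (D B : set T) : connected D -> open D ->
  B `<=` D -> B !=set0 -> open B -> (forall x, D x -> closure B x -> B x) -> B = D.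
Proof.
move=> cD oD BD B0 oB cB; apply: cD => //.
  by exists B => //; rewrite setIidr.
exists (closure B); first exact: closed_closure.
apply/seteqP; split=> x; first by move=> Bx; split; [exact: BD|exact: subset_closure].
by move=> [Dx]; exact: cB.
Qed.

Lemma grad0_cst D f : open D -> connected D ->
  pdif D false f (fun=> 0) -> pdif D true f (fun=> 0) ->
  forall p q, D p -> D q -> f p = f q.
Proof.
move=> oD cD dx dy p q Dp Dq.
have loc x : D x -> \forall z \near x, D z /\ f z = f x.
  move=> Dx; have /nbhs_boxP[r r0 rP] : nbhs x D by exact: open_nbhs_nbhs.
  apply/nbhs_boxP; exists r => // s t sr tr; split; first exact: rP.
  have [u u01|u _] := pdif_MVT (p := x) (c := s) dx.
    rewrite addr_axisF; have := rP (u * s) 0 (normr_scale_lt u01 sr).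
    by rewrite normr0 addr0; exact.
  have [w w01|w _] := pdif_MVT (p := (x.1 + s, x.2)) (c := t) dy.
    by rewrite addr_axisT/=; have := rP s (w * t) sr (normr_scale_lt w01 tr).
  rewrite addr_axisT addr_axisF /= !mulr0 => /eqP; rewrite subr_eq0 => /eqP ->.
  by move=> /eqP; rewrite subr_eq0 => /eqP.
suff E : [set x | D x /\ f x = f p] = D by have : D q by []; rewrite -E => -[].
apply: open_closed_connected => //.
- by move=> x [].
- by exists p.
- rewrite openE => x [Dx fx]; have := loc x Dx; apply: filterS => z [Dz fz].
  by split; rewrite ?fz.
- move=> x Dx cx; split => //.
  by have [z [[_ <-] [_ ->]]] := cx _ (loc x Dx).
Qed.

End PlaneCalculus.

(** * Connectedness in the plane *)

Section PlaneTopology.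
Variable R : realType.
Local Notation plane := (R * R)%type.
Implicit Types (p q v z a : plane) (D E C O : set plane).

Lemma frontier_open D x : open D -> frontier D x <-> closure D x /\ ~ D x.
Proof. by move=> oD; rewrite /frontier ((interior_id D).1 oD). Qed.

Lemma connected_sub_open C O : connected C -> open O -> C `&` O !=set0 ->
  (forall x, C x -> ~ frontier O x) -> C `<=` O.
Proof.
move=> cC oO CO CF; suff <- : C `&` O = C by move=> x [].
apply: cC => //; first by exists O.
exists (closure O); first exact: closed_closure.
apply/seteqP; split=> x [Cx Ox]; split=> //; first exact: subset_closure.
have := CF x Cx; rewrite frontier_open//; have [//|nO] := pselect (O x).
by case.
Qed.

Lemma segment_plane_connected p v : connected [set p + t *: v | t in `[0, 1 : R]].
Proof.
apply: connected_continuous_connected; first exact: segment_connected.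
apply: continuous_subspaceT => t.
by apply: cvgD; [exact: cvg_cst|apply: cvgZr_tmp; exact: cvg_id].
Qed.

Lemma star_connected C p : C p ->
  (forall z (t : R), C z -> 0 <= t <= 1 -> C (p + t *: (z - p))) -> connected C.
Proof.
move=> Cp star.
have -> : C = \bigcup_(z in C) [set p + t *: (z - p) | t in `[0, 1 : R]].
  apply/seteqP; split=> [z Cz|_ [z Cz [t t01 <-]]].
    exists z => //; exists 1; first by rewrite /= in_itv/= ler01 lexx.
    by rewrite scale1r subrKC.
  by apply: star => //; move: t01; rewrite /= in_itv.
apply: bigcup_connected => [|z _]; last exact: segment_plane_connected.
exists p => z _; exists 0; first by rewrite /= in_itv/= ler01 lexx.
by rewrite scale0r addr0.
Qed.

Lemma polar (x y : R) : x ^+ 2 + y ^+ 2 = 1 -> exists t, x = cos t /\ y = sin t.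
Proof.
move=> xy; have x1 : -1 <= x <= 1.
  rewrite -ler_norml -(ler_pXn2r (_ : (0 < 2)%N))// ?nnegrE// real_normK ?num_real//.
  by rewrite expr1n -xy lerDl sqr_ge0.
have y2 : y ^+ 2 = 1 - x ^+ 2 by rewrite -xy addrC addKr.
have [y0|y0] := leP 0 y.
  exists (acos x); rewrite acosK// sin_acos//; split=> //.
  by rewrite -y2 sqrtr_sqr ger0_norm.
exists (- acos x); rewrite cosN sinN acosK// sin_acos//; split=> //.
by rewrite -y2 sqrtr_sqr ltr0_norm// opprK.
Qed.

Lemma polar_sqn z : exists t : R, z = Num.sqrt (sqn z) *: (cos t, sin t).
Proof.
have [->|z0] := eqVneq z 0.
  by exists 0; rewrite sqn0 sqrtr0 scale0r.
pose r := Num.sqrt (sqn z).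
have r0 : 0 < r by rewrite sqrtr_gt0 sqn_gt0.
have [|t [c s]] := @polar (z.1 / r) (z.2 / r).
  by rewrite !expr_div_n -mulrDl sqr_sqrtr ?sqn_ge0// divff// sqn_eq0.
exists t; rewrite -c -s -/r [LHS]surjective_pairing.
by rewrite -[RHS]/(r * (z.1 / r), r * (z.2 / r)) !(mulrC r) !divfK ?gt_eqF.
Qed.

Lemma polar_scale_continuous a (r : R) : continuous (fun t : R => a + r *: (cos t, sin t) : plane).
Proof.
move=> t.
have H : (cos x, sin x) @[x --> t] --> (cos t, sin t).
  exact: (cvg_pair (@continuous_cos R t) (@continuous_sin R t)).
by apply: cvgD; [exact: cvg_cst|exact: cvgZ (cvg_cst r) H].
Qed.

Lemma sqn_polar (r t : R) : sqn (r *: (cos t, sin t) : plane) = r ^+ 2.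
Proof.
rewrite /sqn -[(_ *: _).1]/(r * cos t) -[(_ *: _).2]/(r * sin t) !exprMn.
by rewrite -mulrDr cos2Dsin2 mulr1.
Qed.

Lemma setT_connected : connected [set: R].
Proof. by apply/connected_intervalP. Qed.

Lemma sqn_circleE a (r : R) : 0 <= r ->
  [set z | sqn (z - a) = r ^+ 2] = [set a + r *: (cos t, sin t) | t in [set: R]].
Proof.
move=> r0; apply/seteqP; split=> [z /= zr|_ [t _ <-]]; last first.
  by rewrite /= addrC addKr sqn_polar.
have [t zt] := polar_sqn (z - a).
by exists t => //; rewrite -[RHS](subrKC a) zt zr sqrtr_sqr ger0_norm.
Qed.

Lemma circle_connected a (r : R) : 0 <= r -> connected [set z | sqn (z - a) = r ^+ 2].
Proof.
move=> r0; rewrite sqn_circleE//.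
apply: connected_continuous_connected; first exact: setT_connected.
by apply: continuous_subspaceT; exact: polar_scale_continuous.
Qed.

Lemma disc_connected a (r : R) : 0 < r -> connected [set z | sqn (z - a) < r].
Proof.
move=> r0; apply: (@star_connected _ a) => [|z t]; rewrite /= ?subrr.
  by rewrite sqn0.
move=> zr /andP[t0 t1]; rewrite addrC addKr sqnZ.
by apply: le_lt_trans zr; rewrite ler_piMl ?sqn_ge0// expr_le1.
Qed.

(** Each circle about [a] in the exterior is joined to one common horizontal ray. *)
Lemma exterior_connected a (r : R) : 0 <= r -> connected [set z | r < sqn (z - a)].
Proof.
move=> r0; pose ray := [set a + (s, 0) | s in [set s : R | 0 < s /\ r < s ^+ 2]].
pose A z := [set w | sqn (w - a) = (Num.sqrt (sqn (z - a))) ^+ 2] `|` ray.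
have raysub : ray `<=` [set z | r < sqn (z - a)].
  by move=> _ [s [s0 rs] <-]; rewrite /= addrC addKr /sqn/= expr0n addr0.
have -> : [set z | r < sqn (z - a)] = \bigcup_(z in [set z | r < sqn (z - a)]) A z.
  apply/seteqP; split=> [z zr|w [z zr [|/raysub//]]].
    by exists z => //; left; rewrite /= sqr_sqrtr ?sqn_ge0.
  by rewrite /= sqr_sqrtr ?sqn_ge0// => ->.
apply: bigcup_connected => [|z zr].
  exists (a + (r + 1, 0)) => z _; right; exists (r + 1) => //; split.
    by rewrite ltr_wpDl.
  rewrite expr2; move: r0; clear; nra.
have z0 : 0 < sqn (z - a) by exact: le_lt_trans zr.
apply: connectedU.
- exists (a + (Num.sqrt (sqn (z - a)), 0)); split.
    by rewrite /= addrC addKr /sqn/= expr0n addr0.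
  by exists (Num.sqrt (sqn (z - a))) => //; rewrite /= sqrtr_gt0 sqr_sqrtr ?ltW.
- by apply: circle_connected; exact: sqrtr_ge0.
- apply: connected_continuous_connected; last first.
    apply: continuous_subspaceT => s; apply: cvgD; first exact: cvg_cst.
    have H1 : x @[x --> s] --> s by exact: cvg_id.
    have H2 : (0 : R) @[_ --> s] --> (0 : R) by exact: cvg_cst.
    exact: (cvg_pair H1 H2).
  apply/connected_intervalP => x y [x0 rx] [y0 ry] t /andP[xt ty].
  split; first exact: lt_le_trans xt.
  by apply: lt_le_trans rx _; rewrite lerXn2r ?nnegrE// ltW// (lt_le_trans x0).
Qed.

Lemma circleE a (r : R) : 0 < r -> circle a r = [set z | sqn (z - a) = r ^+ 2].
Proof.
move=> r0; apply/seteqP; split=> z /=; rewrite /circle/= enorm_sqn.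
  by move=> <-; rewrite sqr_sqrtr ?sqn_ge0.
by move=> ->; rewrite sqrtr_sqr gtr0_norm.
Qed.

(** The exterior of a disc is connected, contains no frontier point, and meets [D] because [D] is
    unbounded. *)
Lemma exterior_sub D a (r : R) : 0 <= r -> open D -> ~ bounded_set D ->
  (forall x, frontier D x -> sqn (x - a) <= r) -> [set z | r < sqn (z - a)] `<=` D.
Proof.
move=> r0 oD uD fD; apply: connected_sub_open => //.
- exact: exterior_connected.
- apply: contrapT => H; apply: uD.
  have B z : D z -> sqn (z - a) <= r.
    by move=> Dz; rewrite leNgt; apply/negP => zr; apply: H; exists z.
  exists (`|a| + (r + 1)); split; first exact: num_real.
  move=> x xr z Dz; apply/ltW; apply: le_lt_trans xr.
  rewrite -[z](subrKC a).
  rewrite (le_trans (ler_normD _ _))// lerD2l.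
  have := B z Dz; rewrite /sqn prod_normE ge_max => zr.
  have aux (s t : R) : s ^+ 2 + t ^+ 2 <= r -> `|s| <= r + 1.
    move=> st; have s2 : `|s| ^+ 2 <= r.
      by rewrite real_normK ?num_real// (le_trans _ st)// lerDl sqr_ge0.
    rewrite leNgt; apply/negP => rs; move: s2 rs r0; rewrite expr2; clear; nra.
  by rewrite (aux _ _ zr)// (aux _ _ (_ : (z - a).2 ^+ 2 + (z - a).1 ^+ 2 <= r))// addrC.
- by move=> z zr /fD; rewrite leNgt => /negP; apply.
Qed.

(** The exterior of the circle lies in [D]. The open disc contains no frontier point, so it lies in
    [D] or is disjoint from it, and the last hypothesis leaves the second case. Hence every point of
    the circle separates points of [D] from points outside [D] along its radius. *)
Lemma frontier_is_circle D a (r : R) : 0 < r -> open D -> ~ bounded_set D ->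
  (forall x, frontier D x -> sqn (x - a) = r ^+ 2) ->
  ~ [set z | sqn (z - a) < r ^+ 2] `<=` D ->
  frontier D = circle a r.
Proof.
move=> r0 oD uD fD nD; rewrite circleE//.
have r2 : 0 < r ^+ 2 by rewrite exprn_gt0.
have ext : [set z | r ^+ 2 < sqn (z - a)] `<=` D.
  by apply: exterior_sub => //; [exact: ltW|move=> x /fD ->].
have int z : sqn (z - a) < r ^+ 2 -> ~ D z.
  move=> zr Dz; apply: nD; apply: connected_sub_open => //.
  - exact: disc_connected.
  - by exists z.
  - by move=> x xr /fD xE; move: xr; rewrite /= xE ltxx.
apply/seteqP; split=> [x /fD//|x /= xr]; apply/(frontier_open x oD).
have nr (A : set plane) (s0 : R) : 0 < s0 -> nbhs x A ->
    exists s, [/\ 0 < s, s < s0 & A (x + s *: (x - a)) /\ A (x - s *: (x - a))].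
  move=> s00 xA; have H1 := near_line (x - a) xA.
  have : \forall s \near (0 : R)^'+, A (x + s *: (x - a)) /\ A (x + (- s) *: (x - a)).
    apply: filterI; first exact: cvg_within.
    apply: cvg_within; have : {for (0 : R), continuous (@GRing.opp R)} by exact: opp_continuous.
    by move=> /(_ [set s | A (x + s *: (x - a))]); rewrite oppr0; apply.
  move=> /near_right0P[s1 s10 H]; pose s := Num.min s0 s1 / 2.
  have sm : 0 < Num.min s0 s1 by rewrite lt_min s00.
  have ss : s < Num.min s0 s1 by rewrite ltr_pdivrMr// ltr_pMr// ltr1n.
  exists s; split; first by rewrite divr_gt0.
    by rewrite (lt_le_trans ss)// ge_min lexx.
  have [] := H s; first by rewrite divr_gt0.
    by rewrite (lt_le_trans ss)// ge_min lexx orbT.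
  by rewrite scaleNr.
have E (c : R) : sqn (x + c *: (x - a) - a) = (1 + c) ^+ 2 * r ^+ 2.
  rewrite -xr /sqn -[(x + _ - a).1]/(x.1 + c * (x.1 - a.1) - a.1).
  by rewrite -[(x + _ - a).2]/(x.2 + c * (x.2 - a.2) - a.2) /=; ring.
split.
  move=> A xA; have [s [s0 _ [As _]]] := nr A 1 ltr01 xA.
  exists (x + s *: (x - a)); split => //; apply: ext; rewrite /= E.
  by rewrite ltr_pMl//; move: s0; rewrite expr2; clear; nra.
move=> Dx; have [s [s0 s1 [_ As]]] := nr D 1 ltr01 (open_nbhs_nbhs (conj oD Dx)).
apply: int As; rewrite -scaleNr E gtr_pMl//.
by move: s0 s1; rewrite expr2; clear; nra.
Qed.

(** The list holds the vertices after [p], the last one being [q]. Polygonal paths make the winding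
    number a finite sum of angles. *)
Fixpoint polyline D p (s : seq plane) q : Prop :=
  if s is r :: s' then
    (forall t : R, 0 <= t <= 1 -> D (p + t *: (r - p))) /\ polyline D r s' q
  else p = q.

Lemma polyline_rcons D p s q r : polyline D p s q ->
  (forall t : R, 0 <= t <= 1 -> D (q + t *: (r - q))) -> polyline D p (rcons s r) r.
Proof.
elim: s p => [p <- h|w s IH p [h1 h2] h] /=; first by split.
by split => //; exact: IH.
Qed.

Lemma segment_near x (r : R) p q (t : R) : 0 <= t <= 1 ->
  sqn (p - x) < r -> sqn (q - x) < r -> sqn (p + t *: (q - p) - x) < r.
Proof.
rewrite /sqn -[(p + _ - x).1]/(p.1 + t * (q.1 - p.1) - x.1).
rewrite -[(p + _ - x).2]/(p.2 + t * (q.2 - p.2) - x.2) /=.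
have -> : p.1 + t * (q.1 - p.1) - x.1 = (1 - t) * (p.1 - x.1) + t * (q.1 - x.1) by ring.
have -> : p.2 + t * (q.2 - p.2) - x.2 = (1 - t) * (p.2 - x.2) + t * (q.2 - x.2) by ring.
move: (p.1 - x.1) (p.2 - x.2) (q.1 - x.1) (q.2 - x.2) => a b c d /andP[t0 t1] h1 h2.
have -> : ((1 - t) * a + t * c) ^+ 2 + ((1 - t) * b + t * d) ^+ 2 =
  (1 - t) * (a ^+ 2 + b ^+ 2) + t * (c ^+ 2 + d ^+ 2)
  - t * (1 - t) * ((a - c) ^+ 2 + (b - d) ^+ 2) by ring.
have : 0 <= t * (1 - t) * ((a - c) ^+ 2 + (b - d) ^+ 2).
  by apply: mulr_ge0; [rewrite mulr_ge0 ?subr_ge0|rewrite addr_ge0 ?sqr_ge0].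
move: h1 h2; move: (a ^+ 2 + b ^+ 2) (c ^+ 2 + d ^+ 2) (_ * _ * (_ + _)) => X Y Z.
have [XY|XY] := leP X Y; move: t0 t1 XY; clear => t0 t1 XY Xr Yr Z0.
  have : 0 <= (1 - t) * (Y - X) by rewrite mulr_ge0 ?subr_ge0.
  lra.
have : 0 <= t * (X - Y) by rewrite mulr_ge0 ?subr_ge0// ltW.
lra.
Qed.

Lemma open_connected_polyline D p q : open D -> connected D -> D p -> D q ->
  exists s, polyline D p s q.
Proof.
move=> oD cD Dp Dq; suff E : [set x | D x /\ exists s, polyline D p s x] = D.
  by have [] : [set x | D x /\ exists s, polyline D p s x] q by rewrite E.
have loc x : D x -> exists2 r : R, 0 < r & forall z w, sqn (z - x) < r ^+ 2 ->
    sqn (w - x) < r ^+ 2 -> forall t, 0 <= t <= 1 -> D (z + t *: (w - z)).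
  move=> Dx; have /nbhs_sqnP[r r0 rP] := open_nbhs_nbhs (conj oD Dx).
  by exists r => // z w zx wx t t01; apply: rP; exact: segment_near.
have self x (r : R) : 0 < r -> sqn (x - x) < r ^+ 2.
  by move=> r0; rewrite subrr sqn0 exprn_gt0.
apply: open_closed_connected => //.
- by move=> x [].
- by exists p; split => //; exists [::].
- rewrite openE => x [Dx [s ps]]; have [r r0 rP] := loc x Dx.
  apply/nbhs_sqnP; exists r => // z zx; split.
    have /(_ 1) := rP x z (self _ _ r0) zx.
    by rewrite scale1r subrKC; apply; rewrite ler01 lexx.
  by exists (rcons s z); apply: polyline_rcons ps _; apply: rP => //; exact: self.
- move=> x Dx cx; split => //; have [r r0 rP] := loc x Dx.
  have [z [[Dz [s ps]] zx]] : (([set y | D y /\ exists s, polyline D p s y]) `&`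
      [set y | sqn (y - x) < r ^+ 2]) !=set0.
    by apply: cx; apply/nbhs_sqnP; exists r.
  by exists (rcons s x); apply: polyline_rcons ps _; apply: rP => //; exact: self.
Qed.

End PlaneTopology.

(** * From classes C^k to holomorphic gradients; barriers; facts on Jordan curves *)

Section Bridge.
Variable R : realType.
Local Notation plane := (R * R)%type.
Implicit Types (p q v z a : plane) (D E Omega : set plane) (f U : plane -> R).

(** The maximum principle is applied to [f - d B], and then [d] tends to 0. Typically [B] is
    nonnegative and tends to infinity at a pole or at infinity, where [f] is only known to be
    bounded. *)
Lemma maximum_principle_barrier D f B : open D -> subharmonic D f -> harmonic D B ->
  (forall x, closure D x -> ~ D x -> forall d e, 0 < d -> 0 < e ->
     \forall z \near x, D z -> f z - d * B z < e) ->
  (forall d e, 0 < d -> 0 < e ->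
     exists r, forall z, D z -> r <= sqn z -> f z - d * B z < e) ->
  forall z, D z -> f z <= 0.
Proof.
move=> oD sf hB bd inf z Dz.
have H d : 0 < d -> f z - d * B z <= 0.
  move=> d0; apply: (@maximum_principle _ D (fun z => f z - d * B z)) => //.
  - have := subharmonicD sf (harmonic_subharmonic (harmonicZ (- d) hB)).
    by under [X in subharmonic _ X]eq_fun do rewrite mulNr.
  - by move=> x cx Dx e; exact: bd.
  - by move=> e; exact: inf.
apply/ler_addgt0Pr => e e0; rewrite add0r.
have m0 : 0 < `|B z| + 1 by rewrite ltr_wpDl.
have := H (e / (`|B z| + 1)); rewrite divr_gt0// => /(_ isT); rewrite subr_le0 => /le_trans; apply.
rewrite mulrAC ler_pdivrMr// ler_pM2l//.
by rewrite (le_trans (ler_norm _))// lerDl.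
Qed.

Lemma Ck_pdif k D f (s : seq bool) b : Ck k D f -> (size s < k)%N ->
  pdif D b (pderiv s f) (pderiv (b :: s) f).
Proof. by move=> ck sk p Dp; have [_ /(_ sk b)/derivableP] := ck s (ltnW sk) p Dp. Qed.

Lemma Ck_cont k D f (s : seq bool) p : Ck k D f -> (size s <= k)%N -> D p ->
  {for p, continuous (pderiv s f)}.
Proof. by move=> ck sk Dp; have [] := ck s sk p Dp. Qed.

Lemma harmonic_on_jet2 D f : harmonic_on D f ->
  jet2 D f (fun b => pderiv [:: b] f) (fun b => pderiv [:: b; b] f).
Proof.
move=> [ck _]; split=> [p Dp|b|b]; [|exact: (@Ck_pdif 2 D f [::] b ck)|exact: (@Ck_pdif 2 D f [:: b] b ck)].
exact: (@Ck_cont 2 D f [::] p ck).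
Qed.

Lemma harmonic_on_harmonic D f : harmonic_on D f -> harmonic D f.
Proof.
by move=> h; do 2!eexists; split; [exact: harmonic_on_jet2|move=> p; exact: h.2].
Qed.

Lemma pdif_near_eq D b f f' (g g' : plane -> R) p : open D -> D p ->
  (forall z, D z -> f z = f' z) -> pdif D b f g -> pdif D b f' g' -> g p = g' p.
Proof.
move=> oD Dp E /(_ p Dp)/is_derive_val <- /(_ p Dp)/is_derive_val <-.
apply: near_eq_derive; apply: filterS (open_nbhs_nbhs (conj oD Dp)).
by move=> z /E.
Qed.

Definition smooth_on D f := forall k, Ck k D f.

Lemma smooth_pdif D f (s : seq bool) b : smooth_on D f ->
  pdif D b (pderiv s f) (pderiv (b :: s) f).
Proof. by move=> /(_ (size s).+1)/Ck_pdif; exact. Qed.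

Lemma smooth_cont D f (s : seq bool) p : smooth_on D f -> D p ->
  {for p, continuous (pderiv s f)}.
Proof. by move=> /(_ (size s))/Ck_cont; exact. Qed.

Lemma smooth_swap D f (s : seq bool) p : open D -> smooth_on D f -> D p ->
  pderiv [:: true, false & s] f p = pderiv [:: false, true & s] f p.
Proof.
move=> oD sf Dp; apply: (@mixed_partials _ D (pderiv s f) (pderiv (false :: s) f)
  (pderiv (true :: s) f)); do ?exact: smooth_pdif; do ?exact: smooth_cont Dp.
exact: open_nbhs_nbhs.
Qed.

Lemma smooth_shift D f (s : seq bool) m p : open D -> smooth_on D f -> D p ->
  pderiv (true :: nseq m false ++ s) f p = pderiv (nseq m false ++ true :: s) f p.
Proof.
move=> oD sf; elim: m p => [//|m IH] p Dp.
rewrite [LHS](smooth_swap _ oD)//.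
exact: (pdif_near_eq oD Dp IH (smooth_pdif _ _ sf) (smooth_pdif _ _ sf)).
Qed.

Lemma smooth_laplacian D f m p : open D -> smooth_on D f ->
  (forall z, D z -> laplacian f z = 0) -> D p ->
  pderiv (nseq m false ++ [:: true; true]) f p = - pderiv (nseq m.+2 false) f p.
Proof.
move=> oD sf lf; elim: m p => [|m IH] p Dp.
  by apply/eqP; rewrite -addr_eq0 addrC; apply/eqP/lf.
have d : pdif D false (fun z => - pderiv (nseq m.+2 false) f z)
    (fun z => - pderiv (nseq m.+3 false) f z).
  by move=> z Dz; apply: is_deriveN; exact: smooth_pdif.
exact: (pdif_near_eq oD Dp IH (smooth_pdif _ _ sf) d).
Qed.

(* The holomorphic function [U_x - i U_y] and its complex derivatives. *)
Definition cgre U k := pderiv (nseq k.+1 false) U.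
Definition cgim U k p := - pderiv (nseq k false ++ [:: true]) U p.

(** The complex derivative of a holomorphic function is its derivative along the first axis, so each
    step adds one [false]. The Cauchy-Riemann equations are the symmetry of mixed partials and the
    Laplace equation, differentiated [k] times along that axis. *)
Lemma hol_cgrad D U k : open D -> smooth_on D U ->
  (forall z, D z -> laplacian U z = 0) ->
  hol D (cgre U k) (cgim U k) (cgre U k.+1) (cgim U k.+1).
Proof.
move=> oD sU lU; split.
- by move=> p; exact: smooth_cont.
- by move=> p Dp; apply: cvgN; exact: (@smooth_cont _ _ (nseq k false ++ [:: true]) _ sU Dp).
- exact: (@smooth_pdif D U (nseq k.+1 false) false sU).
- move=> p Dp; apply: (is_derive_eq (@smooth_pdif D U (nseq k.+1 false) true sU p Dp)).
  by have := @smooth_shift D U [::] k.+1 p oD sU Dp; rewrite cats0 /cgim opprK.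
- move=> p Dp.
  exact: (@is_deriveN _ _ _ _ _ _ _ (@smooth_pdif D U (nseq k false ++ [:: true]) false sU p Dp)).
- move=> p Dp; apply: (is_derive_eq
    (@is_deriveN _ _ _ _ _ _ _ (@smooth_pdif D U (nseq k false ++ [:: true]) true sU p Dp))).
  rewrite -[pderiv (true :: _)]/(pderiv (true :: nseq k false ++ [:: true])).
  by rewrite (@smooth_shift D)// (@smooth_laplacian D)// opprK.
Qed.

Lemma holD D (a b a1 b1 c d c1 d1 : plane -> R) : hol D a b a1 b1 -> hol D c d c1 d1 ->
  hol D (fun p => a p + c p) (fun p => b p + d p)
     (fun p => a1 p + c1 p) (fun p => b1 p + d1 p).
Proof.
move=> [h1 h2 h3 h4 h5 h6] [k1 k2 k3 k4 k5 k6]; split=> p Dp.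
- by apply: cvgD; [exact: h1|exact: k1].
- by apply: cvgD; [exact: h2|exact: k2].
- exact: is_deriveD (h3 p Dp) (k3 p Dp).
- by apply: (is_derive_eq (is_deriveD (h4 p Dp) (k4 p Dp))); rewrite opprD.
- exact: is_deriveD (h5 p Dp) (k5 p Dp).
- exact: is_deriveD (h6 p Dp) (k6 p Dp).
Qed.

Lemma holM D (a b a1 b1 c d c1 d1 : plane -> R) : hol D a b a1 b1 -> hol D c d c1 d1 ->
  hol D (fun p => a p * c p - b p * d p) (fun p => a p * d p + b p * c p)
     (fun p => (a1 p * c p - b1 p * d p) + (a p * c1 p - b p * d1 p))
     (fun p => (a1 p * d p + b1 p * c p) + (a p * d1 p + b p * c1 p)).
Proof.
move=> [h1 h2 h3 h4 h5 h6] [k1 k2 k3 k4 k5 k6]; split=> p Dp.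
- by apply: cvgB; apply: cvgM; [exact: h1|exact: k1|exact: h2|exact: k2].
- by apply: cvgD; apply: cvgM; [exact: h1|exact: k2|exact: h2|exact: k1].
- have := is_deriveB (is_deriveM (h3 p Dp) (k3 p Dp)) (is_deriveM (h5 p Dp) (k5 p Dp)).
  move=> /is_derive_eq; apply; rewrite /GRing.scale /=; ring.
- have := is_deriveB (is_deriveM (h4 p Dp) (k4 p Dp)) (is_deriveM (h6 p Dp) (k6 p Dp)).
  move=> /is_derive_eq; apply; rewrite /GRing.scale /=; ring.
- have := is_deriveD (is_deriveM (h3 p Dp) (k5 p Dp)) (is_deriveM (h5 p Dp) (k3 p Dp)).
  move=> /is_derive_eq; apply; rewrite /GRing.scale /=; ring.
- have := is_deriveD (is_deriveM (h4 p Dp) (k6 p Dp)) (is_deriveM (h6 p Dp) (k4 p Dp)).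
  move=> /is_derive_eq; apply; rewrite /GRing.scale /=; ring.
Qed.

Lemma hol_cst D (c d : R) : hol D (fun=> c) (fun=> d) (fun=> 0) (fun=> 0).
Proof.
split=> p Dp; do ?exact: cst_continuous; do ?exact: is_derive_cst.
by rewrite oppr0; exact: is_derive_cst.
Qed.

Lemma hol_id D a : hol D (fun p => p.1 - a.1) (fun p => p.2 - a.2) (fun=> 1) (fun=> 0).
Proof.
have j1 := jet2D (jet2_fst_coord D) (jet2_cst D (- a.1)).
have j2 := jet2D (jet2_snd_coord D) (jet2_cst D (- a.2)).
split=> p Dp; [exact: (jet2_cont j1)|exact: (jet2_cont j2)|..].
- apply: (is_derive_eq (@jet2_fst _ _ _ _ _ j1 false p Dp)).
  by rewrite /= addr0.
- apply: (is_derive_eq (@jet2_fst _ _ _ _ _ j1 true p Dp)).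
  by rewrite /= addr0 oppr0.
- apply: (is_derive_eq (@jet2_fst _ _ _ _ _ j2 false p Dp)).
  by rewrite /= addr0.
- apply: (is_derive_eq (@jet2_fst _ _ _ _ _ j2 true p Dp)).
  by rewrite /= addr0.
Qed.

Lemma within_cont_near D f x (e : R) : {within D, continuous f} -> D x -> 0 < e ->
  \forall z \near x, D z -> `|f z - f x| < e.
Proof.
move=> /subspace_continuousP/(_ x) H /H/cvgrPdist_lt/[apply].
by rewrite near_withinE; apply: filterS => z h /h; rewrite distrC.
Qed.

Lemma cgrad_near D U x (f : plane -> R) (e : R) : cgrad_exists D U x -> continuous f -> 0 < e ->
  \forall z \near x, D z -> `|f (cgrad D U x) - f (grad U z)| < e.
Proof.
move=> ex cf e0.
have L1 : pderiv [:: false] U z @[z --> within D (nbhs x)] --> (cgrad D U x).1 := ex false.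
have L2 : pderiv [:: true] U z @[z --> within D (nbhs x)] --> (cgrad D U x).2 := ex true.
have L : f (grad U z) @[z --> within D (nbhs x)] --> f (cgrad D U x).
  apply: (@cvg_comp _ _ _ (grad U) f _ _ _ _ (cf _)).
  exact: (cvg_pair L1 L2).
have : \forall z \near within D (nbhs x), `|f (cgrad D U x) - f (grad U z)| < e.
  by move: e e0; apply/cvgrPdist_lt.
by rewrite near_withinE.
Qed.

Lemma jordan_curve_facts (L : set plane) : smooth_jordan_curve L ->
  [/\ L !=set0, compact L & connected L].
Proof.
move=> [gam [[sm _ per _] <-]].
have cg : continuous gam.
  by move=> t; apply: differentiable_continuous; apply/derivable1_diffP; exact: (sm 0%N t).
have E : range gam = gam @` `[0, 1].
  apply/seteqP; split=> [_ [t _ <-]|_ [t _ <-]]; last by exists t.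
  have perN (n : nat) s : gam (s + n%:R) = gam s.
    elim: n s => [|n IH] s; first by rewrite addr0.
    by rewrite -natr1 addrA per IH.
  have perZ (n : int) s : gam (s + n%:~R) = gam s.
    case: n => n; first exact: perN.
    by rewrite NegzE mulrNz -(perN n.+1 (s - n.+1%:~R)) subrK.
  exists (t - (Num.floor t)%:~R); last by rewrite -mulrNz perZ.
  rewrite /= in_itv/= subr_ge0 ge_floor/= lerBlDr addrC.
  by have := ltW (lt_succ_floor t); rewrite intrD.
split; first by exists (gam 0); exists 0.
- rewrite E; apply: continuous_compact; last exact: segment_compact.
  exact: continuous_subspaceT.
- apply: connected_continuous_connected; last exact: continuous_subspaceT.
  exact: setT_connected.
Qed.

Lemma compact_sqn_bounded (L : set plane) a : compact L ->
  exists r, 0 <= r /\ forall x, L x -> sqn (x - a) <= r.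
Proof.
move=> cL; have [L0|nL] := pselect (L !=set0); last first.
  by exists 0; split=> // x Lx; exfalso; apply: nL; exists x.
have [|||x _ xm] := @compact_EVT_max _ R (fun x : plane => sqn (x - a)) L => //.
  by apply: continuous_subspaceT; exact: sqn_continuous.
by exists (sqn (x - a)); split=> [|y Ly]; [exact: sqn_ge0|apply: xm; rewrite inE].
Qed.

End Bridge.

(** * Level circles *)

Section ExteriorCircle.
Variable R : realType.
Local Notation plane := (R * R)%type.
Implicit Types (p q v z a : plane) (D E Omega : set plane) (f U : plane -> R).

Lemma ln_ge_ball a (A : R) : exists2 r : R, 0 < r & forall z, sqn (z - a) < r -> z <> a ->
  ln (sqn (z - a)) < A.
Proof.
exists (expR A); first exact: expR_gt0.
move=> z zr za; rewrite -[A]expRK ltr_ln ?posrE ?expR_gt0//.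
by rewrite sqn_gt0 subr_eq0; apply/eqP.
Qed.

(* The logarithmic potential with pole [a] determines [Omega]: [U_x - i U_y] times
   [z - a] is the constant [- kappa] on all of [Omega] by unique continuation, so
   [a] is not in [Omega] and [U] is radial about [a]. *)
Lemma log_potential_circle Omega U (kappa : R) a : unbounded_domain Omega ->
  frontier Omega !=set0 -> smooth_on Omega U -> (forall z, Omega z -> laplacian U z = 0) ->
  {within closure Omega, continuous U} ->
  (exists c, forall r, frontier Omega r -> U r = c) -> 0 < kappa ->
  (exists2 p, Omega p & \forall z \near p,
    pderiv [:: false] U z * (z.1 - a.1) + pderiv [:: true] U z * (z.2 - a.2) = - kappa /\
    pderiv [:: false] U z * (z.2 - a.2) - pderiv [:: true] U z * (z.1 - a.1) = 0) ->
  is_circle (frontier Omega).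
Proof.
move=> [oO cO uO] [x0 fx0] sU lU cU [c0 Uc0] k0 [p Op near_p].
have h0 := hol_cgrad 0 oO sU lU; have h1 := hol_cgrad 1 oO sU lU.
have i0 := hol_id Omega a; have i1 := hol_cst Omega 1 0.
have m0 := holD (holM h0 i0) (hol_cst Omega kappa 0).
have m1 := holD (holD (holM h1 i0) (holM h0 i1)) (hol_cst Omega 0 0).
have E := hol_unique_continuation oO cO m0 m1.
have [E1 E2] : (forall z, Omega z ->
    pderiv [:: false] U z * (z.1 - a.1) + pderiv [:: true] U z * (z.2 - a.2) = - kappa) /\
   (forall z, Omega z ->
    pderiv [:: false] U z * (z.2 - a.2) - pderiv [:: true] U z * (z.1 - a.1) = 0).
  have H : exists2 p, Omega p & \forall z \near p,
      (cgre U 0 z * (z.1 - a.1) - cgim U 0 z * (z.2 - a.2) + kappa) ^+ 2 +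
      (cgre U 0 z * (z.2 - a.2) + cgim U 0 z * (z.1 - a.1) + 0) ^+ 2 = 0.
    exists p => //; apply: filterS near_p => z [H1 H2]; rewrite /cgre /cgim /=.
    by rewrite !mulNr opprK H1 H2 addNr !addr0 expr0n/= addr0.
  suff S z : Omega z -> (cgre U 0 z * (z.1 - a.1) - cgim U 0 z * (z.2 - a.2) + kappa) ^+ 2 +
      (cgre U 0 z * (z.2 - a.2) + cgim U 0 z * (z.1 - a.1) + 0) ^+ 2 = 0.
    split=> z /S; rewrite /cgre /cgim /= !mulNr opprK => /eqP;
      rewrite paddr_eq0 ?sqr_ge0// !sqrf_eq0 => /andP[/eqP e1 /eqP e2].
      by apply/eqP; rewrite -subr_eq0 opprK e1.
    by rewrite -[RHS]e2 addr0.
  exact: E.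
have na : ~ Omega a.
  move=> /E1; rewrite !subrr !mulr0 addr0 => /eqP; rewrite eq_sym oppr_eq0.
  by rewrite gt_eqF.
have sa z : Omega z -> 0 < sqn (z - a).
  by move=> Oz; rewrite sqn_gt0 subr_eq0; apply/eqP => za; apply: na; rewrite -za.
pose V z := U z + kappa / 2 * ln (sqn (z - a)).
have jl := jet2Z (kappa / 2) (jet2_ln (jet2_sqn Omega a) sa).
have VC z w : Omega z -> Omega w -> V z = V w.
  apply: grad0_cst => // q Oq.
  - apply: (is_derive_eq (is_deriveD (@smooth_pdif _ _ _ [::] false sU q Oq)
      (@jet2_fst _ _ _ _ _ jl false q Oq))) => /=.
    have := E1 q Oq; have := E2 q Oq; have := sa q Oq; rewrite /sqn /=.
    move: (q.1 - a.1) (q.2 - a.2) ('D_(1, 0) U q) ('D_(0, 1) U q) => X Y ux uy S0 e2 e1.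
    have -> : kappa = - (ux * X + uy * Y) by rewrite e1 opprK.
    have -> : ux + - (ux * X + uy * Y) / 2 * (2 * X / (X ^+ 2 + Y ^+ 2)) =
      Y * (ux * Y - uy * X) / (X ^+ 2 + Y ^+ 2) by field; rewrite gt_eqF.
    by rewrite e2 mulr0 mul0r.
  - apply: (is_derive_eq (is_deriveD (@smooth_pdif _ _ _ [::] true sU q Oq)
      (@jet2_fst _ _ _ _ _ jl true q Oq))) => /=.
    have := E1 q Oq; have := E2 q Oq; have := sa q Oq; rewrite /sqn /=.
    move: (q.1 - a.1) (q.2 - a.2) ('D_(1, 0) U q) ('D_(0, 1) U q) => X Y ux uy S0 e2 e1.
    have -> : kappa = - (ux * X + uy * Y) by rewrite e1 opprK.
    have -> : uy + - (ux * X + uy * Y) / 2 * (2 * Y / (X ^+ 2 + Y ^+ 2)) =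
      - X * (ux * Y - uy * X) / (X ^+ 2 + Y ^+ 2) by field; rewrite gt_eqF.
    by rewrite e2 mulr0 mul0r.
have fcl x : frontier Omega x -> closure Omega x by move=> /(frontier_open x oO)[].
(* At [a] the logarithm tends to minus infinity, so the constancy of [V] would make [U] unbounded
   near a frontier point, where it tends to [c0]. The radius is chosen so that [U] exceeds
   [c0 + 1]. *)
have xna x : frontier Omega x -> x <> a.
  move=> fx xa.
  have N1 := within_cont_near cU (fcl x fx) (ltr01).
  have [r r0 rP] := ln_ge_ball a ((V p - c0 - 1) / (kappa / 2)).
  have N2 : \forall z \near x, sqn (z - a) < r.
    apply: (@near_ltr _ _ (fun z => sqn (z - a))); first exact: sqn_continuous.
    by rewrite xa subrr sqn0.
  have [z [Oz [/= z1 z2]]] := fcl x fx _ (filterI N1 N2).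
  have := z1 (subset_closure Oz); rewrite (Uc0 x fx) => {}z1.
  have za : z <> a by move=> za; apply: na; rewrite -za.
  have := rP z z2 za; rewrite ltr_pdivlMr ?divr_gt0//.
  have : V z = V p by exact: VC.
  rewrite /V; move: z1; rewrite ltr_norml => /andP[]; move: (ln _) (ln _) => l1 l2.
  by clear; lra.
(* At a frontier point the limit of [V] is [c0 + kappa / 2 * ln |x - a|^2], so [expR L] is the
   squared radius. *)
pose L := (V p - c0) / (kappa / 2).
have fL x : frontier Omega x -> sqn (x - a) = expR L.
  move=> fx; have sx : 0 < sqn (x - a) by rewrite sqn_gt0 subr_eq0; apply/eqP/xna.
  suff lnE : ln (sqn (x - a)) = L by rewrite -lnE lnK.
  apply/eqP; rewrite -subr_eq0 -normr_le0; apply/ler_addgt0Pr => e e0; rewrite add0r.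
  have e1 : 0 < e / 2 * (kappa / 2) by rewrite mulr_gt0 ?divr_gt0.
  have e2 : 0 < e / 2 by rewrite divr_gt0.
  have N1 := within_cont_near cU (fcl x fx) e1.
  have N2 : \forall z \near x, `|ln (sqn (x - a)) - ln (sqn (z - a))| < e / 2.
    have : {for x, continuous (fun z => ln (sqn (z - a)))}.
      apply: (@harmonic_cont _ [set z | z <> a]); last exact: xna.
      by apply: harmonic_ln_sqn; apply.
    by move=> /cvgrPdist_lt; apply.
  have [z [Oz [/= z1 z2]]] := fcl x fx _ (filterI N1 N2).
  have := z1 (subset_closure Oz); rewrite (Uc0 x fx) => {}z1.
  have EL : ln (sqn (x - a)) - L = (ln (sqn (x - a)) - ln (sqn (z - a))) - (U z - c0) / (kappa / 2).
    rewrite /L -(VC z p Oz Op) /V; move: (ln _) (ln _) => l1 l2.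
    by field; rewrite gt_eqF.
  rewrite EL (le_trans (ler_normB _ _))//.
  rewrite normrM normfV (gtr0_norm (divr_gt0 k0 (ltr0Sn _ 1))).
  have : `|U z - c0| / (kappa / 2) < e / 2 by rewrite ltr_pdivrMr ?divr_gt0.
  by move: z2; move: (`|_|) (`|_| / _) => A B; clear; lra.
exists a, (Num.sqrt (expR L)); split; first by rewrite sqrtr_gt0 expR_gt0.
apply: frontier_is_circle => //; first by rewrite sqrtr_gt0 expR_gt0.
  by move=> x /fL ->; rewrite sqr_sqrtr ?ltW// expR_gt0.
move=> /(_ a) H; apply: na; apply: H.
by rewrite /= subrr sqn0 sqr_sqrtr ?expR_gt0// ltW// expR_gt0.
Qed.

(** For [|z| >= 2 |a|] the ratio of [|z - a|] to [|z|] lies between 1/2 and 2, hence [ln 4] for the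
    squares. The added 1 keeps [z] away from 0. *)
Lemma sqn_center a : exists K : R, forall z, K <= sqn z ->
  0 < sqn z /\ 0 < sqn (z - a) /\ `|ln (sqn (z - a)) - ln (sqn z)| <= ln 4.
Proof.
exists (4 * sqn a + 1) => z zK.
have a0 := sqn_ge0 a.
have z0 : 0 < sqn z by apply: lt_le_trans zK; rewrite ltr_wpDl ?mulr_ge0.
have u : sqn (z - a) <= 4 * sqn z.
  move: zK a0; rewrite /sqn/= => zK a0.
  have := sqr_ge0 (z.1 + a.1); have := sqr_ge0 (z.2 + a.2).
  by move: zK a0; clear; rewrite !expr2; nra.
have l : sqn z <= 4 * sqn (z - a).
  move: zK a0; rewrite /sqn/= => zK a0.
  have := sqr_ge0 (z.1 - 2 * a.1); have := sqr_ge0 (z.2 - 2 * a.2).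
  by move: zK a0; clear; rewrite !expr2; nra.
have za : 0 < sqn (z - a) by move: z0 l; clear; lra.
split=> //; split=> //; rewrite ler_norml.
have four : 0 < 4 :> R by [].
have {}u : ln (sqn (z - a)) <= ln (4 * sqn z) by rewrite ler_ln ?posrE ?mulr_gt0.
have {}l : ln (sqn z) <= ln (4 * sqn (z - a)) by rewrite ler_ln ?posrE ?mulr_gt0.
move: u l; rewrite !lnM ?posrE// => u l; apply/andP; split; move: u l; clear; lra.
Qed.

End ExteriorCircle.

(** * Growth at infinity and circular equipotential curves of the exterior potential *)

Section ExteriorProblem.
Variable R : realType.
Local Notation plane := (R * R)%type.
Implicit Types (p q v z a : plane) (D E Omega : set plane) (f U : plane -> R).

Lemma enorm_lnE z : 0 < sqn z -> ln (enorm z) = ln (sqn z) / 2.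
Proof.
move=> z0; have s0 : 0 < Num.sqrt (sqn z) by rewrite sqrtr_gt0.
by rewrite enorm_sqn -[in RHS](sqr_sqrtr (ltW z0)) lnXn// -mulr_natl; field.
Qed.

Lemma exterior_growth Omega Phi U : exterior_dirichlet Omega Phi U ->
  exists M K, forall z, Omega z -> K <= sqn z -> `|U z + Phi / (2 * pi) / 2 * ln (sqn z)| <= M.
(* Squaring turns the threshold on the norm into one on [sqn]; the added 1 keeps the argument of the
   logarithm positive. *)
Proof.
move=> [_ _ _ _ _ _ [M [K H]]]; exists M, (K ^+ 2 + 1) => z Oz zK.
have z0 : 0 < sqn z by apply: lt_le_trans zK; rewrite ltr_wpDl ?sqr_ge0.
have -> : Phi / (2 * pi) / 2 * ln (sqn z) = Phi / (2 * pi) * ln (enorm z).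
  by rewrite enorm_lnE// -!mulrA; congr (_ * (_ * _)); rewrite mulrC.
apply: H => //; rewrite enorm_sqn.
have [K0|K0] := leP K 0; first by rewrite (le_trans K0) ?sqrtr_ge0.
rewrite -(ler_pXn2r (_ : (0 < 2)%N))// ?nnegrE ?sqrtr_ge0// ?(ltW K0)//.
by rewrite sqr_sqrtr ?sqn_ge0// (le_trans _ zK)// lerDl.
Qed.

Lemma ln_sqn_ge (A : R) : exists r, forall z : plane, r <= sqn z -> A <= ln (sqn z).
Proof.
exists (expR A) => z zr; rewrite -[A]expRK ler_ln// posrE ?expR_gt0//.
exact: lt_le_trans (expR_gt0 _) zr.
Qed.

Lemma log_growth_lt Omega U (k : R) : 0 < k ->
  (exists M K, forall z, Omega z -> K <= sqn z -> `|U z + k * ln (sqn z)| <= M) ->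
  forall c, exists r, forall z, Omega z -> r <= sqn z -> U z < c.
Proof.
move=> k0 [M [K H]] c; have [r rP] := ln_sqn_ge ((M - c + 1) / k).
exists (Num.max r K) => z Oz; rewrite ge_max => /andP[/rP zr zK].
have := H z Oz zK; rewrite ler_norml => /andP[_].
by move: zr; rewrite ler_pdivrMr// (mulrC _ k); clear; lra.
Qed.

Section Potential.
Variables (Omega : set plane) (U : plane -> R) (k c0 : R).
Hypotheses (hO : unbounded_domain Omega) (hF : smooth_jordan_curve (frontier Omega)).
Hypotheses (sU : smooth_on Omega U) (lU : forall z, Omega z -> laplacian U z = 0).
Hypotheses (cU : {within closure Omega, continuous U}).
Hypotheses (Uc0 : forall r, frontier Omega r -> U r = c0) (k0 : 0 < k).
Hypothesis (gU : exists M K, forall z, Omega z -> K <= sqn z -> `|U z + k * ln (sqn z)| <= M).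

Let oO : open Omega. Proof. by case: hO. Qed.

Lemma potential_harmonic : harmonic Omega U.
Proof. by apply: harmonic_on_harmonic; split; [exact: sU|exact: lU]. Qed.

Lemma closure_near D x (e : R) : D `<=` Omega -> closure D x -> 0 < e ->
  \forall z \near x, D z -> `|U z - U x| < e.
Proof.
move=> DO cx e0; have := within_cont_near cU (closure_subset DO cx) e0.
by apply: filterS => z h /DO/subset_closure.
Qed.

Lemma potential_le z : Omega z -> U z <= c0.
Proof.
move=> Oz; rewrite -subr_le0.
apply: (@maximum_principle _ Omega (fun z => U z - c0)) Oz => //.
- exact/harmonic_subharmonic/harmonicB/harmonic_cst/potential_harmonic.
- move=> x cx nx e e0; have fx : frontier Omega x by apply/(frontier_open x oO).
  apply: filterS (closure_near (@subset_refl _ Omega) cx e0) => w H /H.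
  by rewrite (Uc0 fx) => /ltr_normlW.
- move=> e e0; have [r rP] := log_growth_lt k0 gU (c0 + e).
  by exists r => w Ow /(rP w Ow); rewrite ltrBlDl.
Qed.

(** Otherwise the maximum principle, applied to [U - c] and [c - U] on the disc, would give
    [U a = c] and put the center on the level set, which is the circle alone. *)
Lemma disc_not_sub a (rho c : R) : 0 < rho ->
  [set r | closure Omega r /\ U r = c] = circle a rho ->
  ~ [set z | sqn (z - a) < rho ^+ 2] `<=` Omega.
Proof.
move=> r0; rewrite circleE// => EL DO.
have r2 : 0 < rho ^+ 2 by rewrite exprn_gt0.
pose D := [set z : plane | sqn (z - a) < rho ^+ 2].
have oD : open D by apply: open_ltr; exact: sqn_continuous.
have Da : D a by rewrite /D/= subrr sqn0.
have bd x : closure D x -> ~ D x -> U x = c.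
  move=> cx nx; have : [set r | closure Omega r /\ U r = c] x.
    rewrite EL /=; apply/eqP; rewrite eq_le; apply/andP; split.
      by apply: closure_ler_sqn cx => z /ltW.
    by rewrite leNgt; apply/negP.
  by case.
have bdd z : D z -> sqn z <= 2 * rho ^+ 2 + 2 * sqn a.
  rewrite /D/= /sqn/=; have := sqr_ge0 (z.1 - 2 * a.1); have := sqr_ge0 (z.2 - 2 * a.2).
  by rewrite !expr2; nra.
have far (f : plane -> R) (e : R) : exists r, forall z, D z -> r <= sqn z -> f z < e.
  exists (2 * rho ^+ 2 + 2 * sqn a + 1) => z /bdd; lra.
have hD := harmonic_sub DO potential_harmonic.
have le1 : U a - c <= 0.
  apply: (@maximum_principle _ D (fun z => U z - c)) Da => //.
  - exact/harmonic_subharmonic/harmonicB/harmonic_cst.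
  - move=> x cx nx e e0; apply: filterS (closure_near DO cx e0) => w H /H.
    by rewrite (bd x cx nx) => /ltr_normlW.
have le2 : c - U a <= 0.
  apply: (@maximum_principle _ D (fun z => c - U z)) Da => //.
  - exact/harmonic_subharmonic/harmonicB/hD/harmonic_cst.
  - move=> x cx nx e e0; apply: filterS (closure_near DO cx e0) => w H /H.
    by rewrite (bd x cx nx) distrC => /ltr_normlW.
have : [set r | closure Omega r /\ U r = c] a.
  split; first exact/subset_closure/DO.
  by apply/eqP; rewrite -subr_eq0 eq_le le1 -opprB oppr_ge0 le2.
by rewrite EL /= subrr sqn0 => E; move: r2; rewrite -E ltxx.
Qed.

Lemma log_growth_center a : exists N r, forall z, Omega z -> r <= sqn z ->
  `|U z + k * ln (sqn (z - a))| <= N.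
Proof.
have [M [K H]] := gU; have [r rP] := sqn_center a.
exists (M + k * ln 4), (Num.max K r) => z Oz; rewrite ge_max => /andP[zK zr].
have [_ [_ l]] := rP z zr.
have -> : U z + k * ln (sqn (z - a)) =
  (U z + k * ln (sqn z)) + k * (ln (sqn (z - a)) - ln (sqn z)) by ring.
rewrite (le_trans (ler_normD _ _))// lerD ?H// normrM gtr0_norm//.
by rewrite ler_pM2l.
Qed.

(** When the circle misses the frontier of [Omega] it lies in [Omega]. The frontier meets the open
    disc, since otherwise the disc would lie in [Omega]; being connected, the frontier then lies
    entirely inside. What remains is a comparison with a radial logarithm in the exterior of the
    circle. *)
Lemma level_circle c a (rho : R) : 0 < rho ->
  [set r | closure Omega r /\ U r = c] = circle a rho -> is_circle (frontier Omega).
Proof.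
move=> r0 EL; have nD := disc_not_sub r0 EL.
have [_ cO uO] := hO; have [[x0 fx0] cF conF] := jordan_curve_facts hF.
have r2 : 0 < rho ^+ 2 by rewrite exprn_gt0.
have ELs := EL; rewrite circleE// in ELs.
have fcl x : frontier Omega x -> closure Omega x by move=> /(frontier_open x oO)[].
have [[x [fx xr]]|noF] := pselect (exists x, frontier Omega x /\ sqn (x - a) = rho ^+ 2).
  have : [set r | closure Omega r /\ U r = c] x by rewrite ELs.
  move=> [_]; rewrite (Uc0 fx) => c0c.
  exists a, rho; split=> //; apply: frontier_is_circle => // y fy.
  have : [set r | closure Omega r /\ U r = c] y.
    by split; [exact: fcl|rewrite (Uc0 fy)].
  by rewrite ELs.
have CO z : sqn (z - a) = rho ^+ 2 -> Omega z.
  move=> zr; apply: contrapT => nz; apply: noF; exists z; split=> //.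
  apply/(frontier_open z oO); split=> //.
  have : [set r | closure Omega r /\ U r = c] z by rewrite ELs.
  by case.
pose B := frontier Omega `&` [set z | sqn (z - a) < rho ^+ 2].
have B0 : B !=set0.
  apply: contrapT => nB; apply: nD; apply: connected_sub_open => //.
  - exact: disc_connected.
  - have Oz : Omega (a + (rho, 0)).
      by apply: CO; rewrite addrC addKr /sqn/= expr0n addr0.
    (* A point slightly inside the circle shows that [Omega], open and containing the circle, meets
       the disc. *)
    have /near_right0P[s s0 sP] : \forall t \near (0 : R)^'+, Omega (a + (rho, 0) + t *: (- rho, 0)).
      apply: cvg_within; apply: near_line; exact: open_nbhs_nbhs.
    pose t := Num.min s 1 / 2.
    have m0 : 0 < Num.min s 1 by rewrite lt_min s0 ltr01.
    have tm : t < Num.min s 1 by rewrite ltr_pdivrMr// ltr_pMr// ltr1n.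
    have t0 : 0 < t by rewrite divr_gt0.
    exists (a + (rho, 0) + t *: (- rho, 0)); split.
      rewrite /= /sqn.
      rewrite -[(_ + _ - a).1]/(a.1 + rho + t * (- rho) - a.1).
      rewrite -[(_ + _ - a).2]/(a.2 + 0 + t * 0 - a.2).
      have -> : (a.1 + rho + t * - rho - a.1) ^+ 2 + (a.2 + 0 + t * 0 - a.2) ^+ 2
        = (1 - t) ^+ 2 * rho ^+ 2 by ring.
      have t1 : t < 1 by apply: lt_le_trans tm _; rewrite ge_min lexx orbT.
      by rewrite gtr_pMl//; move: t0 t1; rewrite expr2; nra.
    by apply: sP => //; apply: lt_le_trans tm _; rewrite ge_min lexx.
  - by move=> z zr fz; apply: nB; exists z.
have BE : B = frontier Omega.
  apply: conF => //.
    exists [set z | sqn (z - a) < rho ^+ 2] => //.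
    by apply: open_ltr; exact: sqn_continuous.
  exists [set z | sqn (z - a) <= rho ^+ 2].
    by apply: closed_ler; exact: sqn_continuous.
  apply/seteqP; split=> z [fz zr]; split=> //; first exact: ltW.
  rewrite /= lt_neqAle; apply/andP; split=> //.
  by apply/eqP => zE; apply: noF; exists z.
pose E := [set z : plane | rho ^+ 2 < sqn (z - a)].
have EO : E `<=` Omega.
  apply: exterior_sub => //; first exact: ltW.
  by move=> x; rewrite -BE => -[_ /ltW].
have oE : open E by apply: open_gtr; exact: sqn_continuous.
have hE := harmonic_sub EO potential_harmonic.
have hln : harmonic E (fun z => ln (sqn (z - a)) - ln (rho ^+ 2)).
  apply: harmonicB (harmonic_cst _ _); apply: harmonic_ln_sqn.
  by rewrite /E/= subrr sqn0 => /(lt_trans r2); rewrite ltxx.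
(* [U] behaves like [- k ln |z - a|^2] at infinity, so this sum is bounded there; it vanishes on the
   circle. Boundedness is turned into vanishing by the barrier [ln |z - a|^2 - ln rho^2]. *)
have hV : harmonic E (fun z => (U z - c) + k * (ln (sqn (z - a)) - ln (rho ^+ 2))).
  by apply: harmonicD; [apply: harmonicB hE (harmonic_cst _ _)|exact: harmonicZ].
have bdE x : closure E x -> ~ E x -> sqn (x - a) = rho ^+ 2.
  move=> cx nx; apply/eqP; rewrite eq_le; apply/andP; split.
    by rewrite leNgt; apply/negP.
  by apply: closure_ger_sqn cx => z /ltW.
have posE z : E z -> 0 <= ln (sqn (z - a)) - ln (rho ^+ 2).
  by move=> Ez; rewrite subr_ge0 ler_ln ?posrE ?(lt_trans r2 Ez)// ltW.
have V0 x : sqn (x - a) = rho ^+ 2 -> (U x - c) + k * (ln (sqn (x - a)) - ln (rho ^+ 2)) = 0.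
  move=> xr; rewrite xr subrr mulr0 addr0.
  have : [set r | closure Omega r /\ U r = c] x by rewrite ELs.
  by move=> [_ ->]; rewrite subrr.
have contV x : sqn (x - a) = rho ^+ 2 ->
    {for x, continuous (fun z => (U z - c) + k * (ln (sqn (z - a)) - ln (rho ^+ 2)))}.
  move=> xr; apply: (@harmonic_cont _ (Omega `&` [set z | z <> a])).
    apply: harmonicD.
      apply: harmonicB (harmonic_cst _ _).
      by apply: harmonic_sub potential_harmonic => z [].
    apply/harmonicZ/harmonicB/harmonic_cst/harmonic_ln_sqn => -[_]; exact.
  split; first exact: CO.
  by move=> xa; move: r2; rewrite -xr xa subrr sqn0 ltxx.
have [N [r rP]] := log_growth_center a.
have infV d e : 0 < d -> 0 < e -> exists s, forall z, E z -> s <= sqn z ->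
    `|(U z - c) + k * (ln (sqn (z - a)) - ln (rho ^+ 2))| -
      d * (ln (sqn (z - a)) - ln (rho ^+ 2)) < e.
  move=> d0 e0; have [K KP] := sqn_center a.
  pose T := N + `|c| + `|k * ln (rho ^+ 2)|.
  have [s sP] := ln_sqn_ge (T / d + ln 4 + ln (rho ^+ 2)).
  exists (Num.max r (Num.max K s)) => z Ez; rewrite !ge_max => /and3P[zr zK zs].
  have [_ [_]] := KP z zK; rewrite ler_norml => /andP[l _].
  have H1 := rP z (EO z Ez) zr.
  have H2 := sP z zs.
  have H3 : `|(U z - c) + k * (ln (sqn (z - a)) - ln (rho ^+ 2))| <= T.
    have -> : (U z - c) + k * (ln (sqn (z - a)) - ln (rho ^+ 2)) =
      (U z + k * ln (sqn (z - a))) - c - k * ln (rho ^+ 2) by ring.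
    by rewrite (le_trans (ler_normB _ _))// lerD2r (le_trans (ler_normB _ _))// lerD2r.
  have H4 : T <= d * (ln (sqn (z - a)) - ln (rho ^+ 2)).
    rewrite mulrC -ler_pdivrMr//; move: H2 l; lra.
  by move: e0 H3 H4; lra.
have VE z : E z -> (U z - c) + k * (ln (sqn (z - a)) - ln (rho ^+ 2)) = 0.
  move=> Ez; apply/eqP; rewrite eq_le; apply/andP; split.
    apply: (maximum_principle_barrier oE (harmonic_subharmonic hV) hln) Ez.
    - move=> x cx nx d e d0 e0; have xr := bdE x cx nx.
      have := @near_ltr _ _ _ _ e (contV x xr); rewrite V0// => /(_ e0).
      apply: filterS => w Hw Ew; apply: le_lt_trans Hw.
      by rewrite gerBl mulr_ge0 ?posE// ltW.
    - move=> d e d0 e0; have [s sP] := infV d e d0 e0; exists s => w Ew ws.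
      by apply: le_lt_trans (sP w Ew ws); rewrite lerD2r ler_norm.
  rewrite -oppr_le0.
  have hN : harmonic E (fun z => - ((U z - c) + k * (ln (sqn (z - a)) - ln (rho ^+ 2)))).
    have := harmonicZ (-1) hV.
    by under [X in harmonic _ X]eq_fun do rewrite mulN1r.
  apply: (maximum_principle_barrier oE (harmonic_subharmonic hN) hln) Ez.
  - move=> x cx nx d e d0 e0; have xr := bdE x cx nx.
    have e0' : - e < 0 by rewrite oppr_lt0.
    have := @near_gtr _ _ _ _ (- e) (contV x xr); rewrite V0// => /(_ e0').
    apply: filterS => w Hw Ew; rewrite ltrBlDr ltrNl.
    apply: le_lt_trans Hw; rewrite opprD gerBl mulr_ge0 ?posE// ltW//.
  - move=> d e d0 e0; have [s sP] := infV d e d0 e0; exists s => w Ew ws.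
    by apply: le_lt_trans (sP w Ew ws); rewrite lerD2r -normrN ler_norm.
pose p := a + (rho + 1, 0).
have Ep : E p.
  rewrite /E/= /p addrC addKr /sqn/= expr0n addr0 ltr_pXn2r ?nnegrE ?ltrDl ?ltr01 ?ltW//.
  by rewrite addr_gt0.
apply: (@log_potential_circle _ Omega U (2 * k) a) => //.
- by exists x0.
- by exists c0.
- by rewrite mulr_gt0.
exists p; first exact: EO.
apply: filterS (open_nbhs_nbhs (conj oE Ep)) => z Ez.
have sz : 0 < sqn (z - a) by exact: lt_trans Ez.
have nEa : forall w, E w -> 0 < sqn (w - a) by move=> w; exact: lt_trans.
have jl := jet2Z (- k) (jet2_ln (jet2_sqn E a) nEa).
have UE w : E w -> U w = - k * ln (sqn (w - a)) + (c + k * ln (rho ^+ 2)).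
  by move=> /VE H; apply/eqP; rewrite -subr_eq0 -H; apply/eqP; ring.
have jc := jet2D jl (jet2_cst E (c + k * ln (rho ^+ 2))).
have dU b := pdif_near_eq oE Ez UE
  (fun q Eq => @smooth_pdif _ _ _ [::] b sU q (EO q Eq)) (@jet2_fst _ _ _ _ _ jc b).
rewrite (dU false) (dU true) /=; move: sz; rewrite /sqn /=.
by move: (z.1 - a.1) (z.2 - a.2) => X Y XY; split; field; rewrite gt_eqF.
Qed.

End Potential.
End ExteriorProblem.

(** * Gradient at infinity *)

Section Reflections.
Variable R : realType.
Local Notation plane := (R * R)%type.
Implicit Types (p q v z w a : plane) (D E Omega : set plane) (f U : plane -> R).

Lemma jet2_inv D f (g h : bool -> plane -> R) : jet2 D f g h -> (forall p, D p -> f p != 0) ->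
  jet2 D (fun p => (f p)^-1) (fun b p => - g b p / f p ^+ 2)
    (fun b p => - h b p / f p ^+ 2 + 2 * g b p ^+ 2 / f p ^+ 3).
Proof.
move=> [c j k] f0; split=> [p Dp|b p Dp|b p Dp].
- by apply: cvgV; [exact: f0|exact: c].
- apply: (is_derive_eq (is_derive_inv (f0 _ Dp) (j b p Dp))).
  by field; rewrite f0.
- have f2 : f p ^+ 2 != 0 by rewrite expf_neq0// f0.
  have H1 := is_deriveM (j b p Dp) (j b p Dp).
  have H2 := is_deriveM (@is_deriveN _ _ _ _ _ _ _ (k b p Dp)).
  have f2' : (f * f) p != 0 by rewrite mulf_neq0// f0.
  have {}H2 := H2 _ _ (is_derive_inv f2' (is_deriveM (j b p Dp) (j b p Dp))).
  have E : (fun q => - g b q / f q ^+ 2) = (- g b) * (fun q => ((f * f) q)^-1).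
    by apply/funext => q; rewrite expr2.
  rewrite E; apply: (is_derive_eq H2).
  rewrite -[(f * f) p]/(f p * f p) -[(- g b) p]/(- g b p) /GRing.scale /=.
  by field; rewrite f0.
Qed.

(** The hypotheses say that the matrix with columns [e] and [n] has orthonormal rows. Derivatives
    along [e] and [n] involve the mixed partials of [f] and the chain rule, which is why
    [harmonic_on], with its class C^2, is assumed instead of [harmonic]. *)
Lemma harmonic_isometry D f (e n : plane) : open D -> harmonic_on D f ->
  e.1 ^+ 2 + n.1 ^+ 2 = 1 -> e.2 ^+ 2 + n.2 ^+ 2 = 1 -> e.1 * e.2 + n.1 * n.2 = 0 ->
  harmonic [set z : plane | D (z.1 *: e + z.2 *: n)] (fun z => f (z.1 *: e + z.2 *: n)).
Proof.
move=> oD [ck lap] n1 n2 n12; pose d (b : bool) := if b then n else e.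
pose L z := z.1 *: e + z.2 *: n.
have comp (g gx gy : plane -> R) b z : D (L z) -> pdif D false g gx -> pdif D true g gy ->
    {for L z, continuous gx} -> {for L z, continuous gy} ->
    is_derive z (axis R b) (fun z => g (L z)) ((d b).1 * gx (L z) + (d b).2 * gy (L z)).
  move=> Dz hx hy cx cy.
  have := C1_is_derive (d b) (open_nbhs_nbhs (conj oD Dz)) hx hy cx cy.
  apply: is_derive_quotient => t; congr g; rewrite /L /d.
  case: b; rewrite -[(_ + z).1]/(t * _ + z.1) -[(_ + z).2]/(t * _ + z.2).
    by rewrite mulr0 mulr1 add0r scalerDl addrCA.
  by rewrite mulr0 mulr1 add0r scalerDl addrA.
have pd (s : seq bool) b : (size s < 2)%N -> pdif D b (pderiv s f) (pderiv (b :: s) f).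
  by move=> s2; exact: Ck_pdif ck s2.
have pc (s : seq bool) z : (size s <= 2)%N -> D z -> {for z, continuous (pderiv s f)}.
  by move=> s2; exact: Ck_cont ck s2.
exists (fun b z => (d b).1 * pderiv [:: false] f (L z) + (d b).2 * pderiv [:: true] f (L z)).
exists (fun b z => (d b).1 * ((d b).1 * pderiv [:: false; false] f (L z) +
                              (d b).2 * pderiv [:: true; false] f (L z)) +
                   (d b).2 * ((d b).1 * pderiv [:: false; true] f (L z) +
                              (d b).2 * pderiv [:: true; true] f (L z))).
split; first split.
- move=> z Dz; apply: (@continuous_comp _ _ _ L f); last exact: (pc [::]).
  by apply: cvgD; (apply: cvgZ; last exact: cvg_cst); [exact: cvg_fst|exact: cvg_snd].
- move=> b z Dz; apply: comp => //; [exact: (pd [::])|exact: (pd [::])|exact: pc|exact: pc].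
- move=> b z Dz.
  have H1 := comp _ _ _ b z Dz (pd [:: false] false isT) (pd [:: false] true isT)
    (pc [:: false; false] _ isT Dz) (pc [:: true; false] _ isT Dz).
  have H2 := comp _ _ _ b z Dz (pd [:: true] false isT) (pd [:: true] true isT)
    (pc [:: false; true] _ isT Dz) (pc [:: true; true] _ isT Dz).
  exact: is_deriveD (@is_deriveZ _ _ _ _ (d b).1 _ _ _ H1) (@is_deriveZ _ _ _ _ (d b).2 _ _ _ H2).
- move=> z Dz; have := lap (L z) Dz; rewrite /laplacian /d.
  move: (pderiv [:: false; false] f _) (pderiv [:: true; false] f _)
        (pderiv [:: false; true] f _) (pderiv [:: true; true] f _) => xx yx xy yy l.
  have -> : e.1 * (e.1 * xx + e.2 * yx) + e.2 * (e.1 * xy + e.2 * yy) +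
    (n.1 * (n.1 * xx + n.2 * yx) + n.2 * (n.1 * xy + n.2 * yy)) =
    (e.1 ^+ 2 + n.1 ^+ 2) * xx + (e.2 ^+ 2 + n.2 ^+ 2) * yy +
    (e.1 * e.2 + n.1 * n.2) * (xy + yx) by ring.
  by rewrite n1 n2 n12 !mul1r mul0r addr0.
Qed.

(** The coordinates are not mixed, so the pure second derivatives recorded by [harmonic] suffice
    here. *)
Lemma harmonic_axis_reflection D f p (s t : R) : harmonic D f -> s ^+ 2 = 1 -> t ^+ 2 = 1 ->
  harmonic [set z : plane | D (p.1 + s * z.1, p.2 + t * z.2)]
    (fun z => f (p.1 + s * z.1, p.2 + t * z.2)).
Proof.
move=> [g [h [[c j k] l]]] s1 t1; pose L z := (p.1 + s * z.1, p.2 + t * z.2).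
pose c' (b : bool) := if b then t else s.
have comp (u u' : plane -> R) b z : pdif D b u u' -> D (L z) ->
    is_derive z (axis R b) (fun z => u (L z)) (c' b * u' (L z)).
  move=> hu Dz; have := is_deriveZdir (c' b) (hu _ Dz).
  apply: is_derive_quotient => r; congr u; rewrite /L /c'.
  case: b {hu}; rewrite -[LHS]/(r * (_ * _) + (p.1 + s * z.1), r * (_ * _) + (p.2 + t * z.2)).
    rewrite -[(_ + z).1]/(r * 0 + z.1) -[(_ + z).2]/(r * 1 + z.2); congr pair => /=; ring.
  rewrite -[(_ + z).1]/(r * 1 + z.1) -[(_ + z).2]/(r * 0 + z.2); congr pair => /=; ring.
exists (fun b z => c' b * g b (L z)), (fun b z => c' b * (c' b * h b (L z))).
split; first split.
- move=> z Dz; apply: (@continuous_comp _ _ _ L f); last exact: c.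
  have H1 : p.1 + s * w.1 @[w --> z] --> p.1 + s * z.1.
    by apply: cvgD; [exact: cvg_cst|apply: cvgM; [exact: cvg_cst|exact: cvg_fst]].
  have H2 : p.2 + t * w.2 @[w --> z] --> p.2 + t * z.2.
    by apply: cvgD; [exact: cvg_cst|apply: cvgM; [exact: cvg_cst|exact: cvg_snd]].
  exact: (cvg_pair H1 H2).
- by move=> b z Dz; apply: comp => //; exact: j.
- move=> b z Dz; apply: (@is_deriveZ _ _ _ _ (c' b)); apply: comp => //; exact: k.
- move=> z Dz; rewrite /c' !mulrA -!expr2 s1 t1 !mul1r; exact: l.
Qed.

Lemma harmonic_swap D f : harmonic D f ->
  harmonic [set z : plane | D (z.2, z.1)] (fun z => f (z.2, z.1)).
Proof.
move=> [g [h [[c j k] l]]].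
have comp (u u' : plane -> R) b z : pdif D b u u' -> D (z.2, z.1) ->
    is_derive z (axis R (~~ b)) (fun z => u (z.2, z.1)) (u' (z.2, z.1)).
  move=> hu Dz; have := hu _ Dz.
  by apply: is_derive_quotient => r; congr u; case: b {hu}.
exists (fun b z => g (~~ b) (z.2, z.1)), (fun b z => h (~~ b) (z.2, z.1)).
split; first split.
- move=> z Dz; apply: (@continuous_comp _ _ _ (fun z : plane => (z.2, z.1)) f); last exact: c.
  have H1 : w.2 @[w --> z] --> z.2 by exact: cvg_snd.
  have H2 : w.1 @[w --> z] --> z.1 by exact: cvg_fst.
  exact: (cvg_pair H1 H2).
- by move=> b z Dz; have := comp _ _ (~~ b) z (j _) Dz; rewrite negbK.
- by move=> b z Dz; have := comp _ _ (~~ b) z (k _) Dz; rewrite negbK.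
- by move=> z Dz /=; rewrite addrC; exact: l.
Qed.

(* Compare the odd part of [f] across the line [x = p.1] with the harmonic function
   [2 x - x^2 + y^2] on a half disc. *)
Lemma derive_le_osc D f p (r m d : R) : 0 < r -> harmonic D f ->
  (forall z, sqn (z - p) <= r ^+ 2 -> D z) ->
  (forall z w, sqn (z - p) <= r ^+ 2 -> sqn (w - p) <= r ^+ 2 -> f z - f w <= m) ->
  is_derive p (axis R false) f d -> d <= m / r.
Proof.
move=> r0 hf rD osc df.
have r2 : 0 < r ^+ 2 by rewrite exprn_gt0.
have m0 : 0 <= m.
  have := osc p p; rewrite !subrr sqn0; apply; exact: ltW.
pose Cl := [set z : plane | sqn z <= r ^+ 2].
have hp := harmonic_axis_reflection p hf (expr1n _ 2) (expr1n _ 2).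
have N1 : (-1 : R) ^+ 2 = 1 by rewrite sqrrN expr1n.
have hm := harmonic_axis_reflection p hf N1 (expr1n _ 2).
pose W z := f (p.1 + 1 * z.1, p.2 + 1 * z.2) - f (p.1 + -1 * z.1, p.2 + 1 * z.2).
have Lp z : sqn ((p.1 + 1 * z.1, p.2 + 1 * z.2) - p) = sqn z.
  by rewrite /sqn -[(_ - p).1]/(p.1 + 1 * z.1 - p.1) -[(_ - p).2]/(p.2 + 1 * z.2 - p.2); ring.
have Lm z : sqn ((p.1 + -1 * z.1, p.2 + 1 * z.2) - p) = sqn z.
  by rewrite /sqn -[(_ - p).1]/(p.1 + -1 * z.1 - p.1) -[(_ - p).2]/(p.2 + 1 * z.2 - p.2); ring.
have hW : harmonic Cl W.
  apply: harmonicB.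
    by apply: harmonic_sub hp => z Cz; apply: rD; rewrite Lp.
  by apply: harmonic_sub hm => z Cz; apply: rD; rewrite Lm.
(* In units of [r], [b] is [y^2 >= 0] on the diameter and [1 + 2 x (1 - x) >= 1] on the half circle.
   Its slope at the center is 2, against [2 d] for the odd part [W]. *)
pose b z := 2 * (z.1 / r) - (z.1 / r) ^+ 2 + (z.2 / r) ^+ 2.
have hb : harmonic Cl b.
  have j1 := jet2Z (r^-1) (jet2_fst_coord Cl); have j2 := jet2Z (r^-1) (jet2_snd_coord Cl).
  have j := jet2D (jet2D (jet2Z 2 j1) (jet2Z (-1) (jet2M j1 j1))) (jet2M j2 j2).
  have E : b = (fun p0 : plane => 2 * (r^-1 * p0.1) + -1 * (r^-1 * p0.1 * (r^-1 * p0.1)) +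
       r^-1 * p0.2 * (r^-1 * p0.2)).
    by apply/funext => z; rewrite /b; ring.
  by rewrite E; do 2!eexists; split; [exact: j|move=> z _; rewrite /axis /=; ring].
pose H := [set z : plane | 0 < z.1 /\ sqn (z - 0) < r ^+ 2].
have HC : H `<=` Cl by move=> z [_ /ltW]; rewrite subr0.
have oH : open H.
  apply: openI; [apply: open_gtr => z; exact: cvg_fst|apply: open_ltr; exact: sqn_continuous].
have hV : harmonic Cl (fun z => W z - m * b z) by apply: harmonicB hW (harmonicZ m hb).
have key : forall z, H z -> W z - m * b z <= 0.
  apply: (@maximum_principle _ H (fun z => W z - m * b z)) => //.
  - exact/harmonic_subharmonic/(harmonic_sub HC).
  - move=> x cx nx e e0.
    have x1 : 0 <= x.1.
      by apply: (@closure_ger _ H fst x) => [|z [/ltW]//|//]; exact: cvg_fst.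
    have xr : sqn (x - 0) <= r ^+ 2 by apply: closure_ler_sqn cx => z [_ /ltW].
    have Cx : Cl x by rewrite /Cl/= -[x]subr0.
    suff Vx : W x - m * b x < e.
      have := near_ltr (harmonic_cont hV Cx) Vx.
      by apply: filterS => z.
    apply: le_lt_trans e0; rewrite subr_le0.
    move: x1; rewrite le_eqVlt => /orP[/eqP x1|x1].
      rewrite /W /b -x1 !mulr0 subrr mul0r mulr0 expr0n/= subr0 add0r.
      by rewrite mulr_ge0 ?sqr_ge0.
    have {}xr : sqn x = r ^+ 2.
      apply/eqP; rewrite eq_le; move: xr; rewrite subr0 => ->/=.
      by rewrite leNgt; apply/negP => xr; apply: nx; rewrite /H/= subr0.
    apply: (@le_trans _ _ m); first by apply: osc; rewrite ?Lp ?Lm xr.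
    rewrite ler_peMr// /b.
    have x1r : x.1 / r <= 1.
      rewrite ler_pdivrMr// mul1r -(ler_pXn2r (_ : (0 < 2)%N))// ?nnegrE ?(ltW x1) ?(ltW r0)//.
      by rewrite -xr /sqn lerDl sqr_ge0.
    have -> : (x.2 / r) ^+ 2 = 1 - (x.1 / r) ^+ 2.
      apply/eqP; rewrite eq_sym subr_eq addrC !expr_div_n -mulrDl -[x.1 ^+ 2 + _]/(sqn x) xr.
      by rewrite divff// gt_eqF.
    have : 0 <= x.1 / r by rewrite divr_ge0 ?ltW.
    by move: x1r; move: (x.1 / r) => X; clear; nra.
  - move=> e e0; exists (r ^+ 2) => z [_]; rewrite subr0 => h1 h2.
    by move: (lt_le_trans h1 h2); rewrite ltxx.
have dW : is_derive (0 : R) 1 (fun t : R => W (t, 0)) (d + d).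
  have d1 : is_derive (0 : R) 1 (fun t : R => f (p + t *: axis R false)) d.
    by apply: is_derive_line; rewrite scale0r addr0.
  have d2 : is_derive (0 : R) 1 (fun t : R => f (p + t *: (-1 *: axis R false))) (-1 * d).
    by apply: is_derive_line; rewrite scale0r addr0; exact: is_deriveZdir.
  have := is_deriveB d1 d2; rewrite mulN1r opprK.
  congr is_derive; apply/funext => t; rewrite /W.
  by rewrite !fctE scalerA !addr_axisF /= !mul1r !addr0 mulN1r mulrN1.
rewrite leNgt; apply/negP => dm.
have dV : is_derive (0 : R) 1 (fun t : R => W (t, 0) - t * (2 * (m / r))) (d + d - 2 * (m / r)).
  apply: is_deriveB dW _.
  have := @is_deriveM _ _ id (cst (2 * (m / r))) (0 : R) 1 _ _ (is_derive_id _ _) (is_derive_cst _ _ _).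
  by move=> /is_derive_eq; apply; rewrite /GRing.scale /= mulr0 add0r mulr1.
have pos : 0 < d + d - 2 * (m / r) by move: dm; clear; lra.
have /near_right0P[s s0 sP] := pos_derive_right dV pos.
pose t := Num.min s r / 2.
have sr0 : 0 < Num.min s r by rewrite lt_min s0.
have t0 : 0 < t by rewrite divr_gt0.
have tm : t < Num.min s r by rewrite ltr_pdivrMr// ltr_pMr// ltr1n.
have ts : t < s by apply: lt_le_trans tm _; rewrite ge_min lexx.
have tr : t < r by apply: lt_le_trans tm _; rewrite ge_min lexx orbT.
have := sP t t0 ts; rewrite add0r mul0r subr0.
have -> : W (0, 0) = 0 by rewrite /W !mulr0 subrr.
have Ht : H (t, 0).
  split=> //; rewrite subr0 /sqn/= expr0n addr0 ltr_pXn2r ?nnegrE ?(ltW t0) ?(ltW r0)//.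
have := key _ Ht; rewrite /b /= mul0r expr0n/= addr0.
have : 0 <= m * (t / r) ^+ 2 by rewrite mulr_ge0// sqr_ge0.
by move: (W _) ((t / r) ^+ 2) => w X; rewrite -!mulrA; clear; lra.
Qed.

Lemma norm_derive_le_osc D f p (r m d : R) b : 0 < r -> harmonic D f ->
  (forall z, sqn (z - p) <= r ^+ 2 -> D z) ->
  (forall z w, sqn (z - p) <= r ^+ 2 -> sqn (w - p) <= r ^+ 2 -> f z - f w <= m) ->
  is_derive p (axis R b) f d -> `|d| <= m / r.
Proof.
move=> r0 hf rD osc.
have aux (D' : set plane) f' p' d' : harmonic D' f' ->
  (forall z, sqn (z - p') <= r ^+ 2 -> D' z) ->
  (forall z w, sqn (z - p') <= r ^+ 2 -> sqn (w - p') <= r ^+ 2 -> f' z - f' w <= m) ->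
  is_derive p' (axis R false) f' d' -> `|d'| <= m / r.
  move=> hf' rD' osc' df; rewrite ler_norml; apply/andP; split; last exact: (@derive_le_osc D' f' p').
  rewrite lerNl; apply: (@derive_le_osc D' (fun z => -1 * f' z) p') => //.
  - exact: harmonicZ.
  - by move=> z w zp wp; rewrite !mulN1r opprK addrC; exact: osc'.
  - have := @is_deriveZ _ _ _ _ (-1) _ _ _ df.
    by rewrite -[_ *: d']/(_ * d') mulN1r.
case: b => df; last exact: (aux D f p).
have E z : sqn ((z.2, z.1) - p) = sqn (z - (p.2, p.1)).
  by rewrite /sqn addrC.
apply: (aux _ _ (p.2, p.1) d (harmonic_swap hf)).
- by move=> z; rewrite -E => /rD.
- by move=> z w; rewrite -!E; exact: osc.
- move: df; apply: is_derive_quotient => t; congr f.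
Qed.

End Reflections.

(** * Oscillation and gradient of a logarithmic potential near infinity *)

Section AtInfinity.
Variable R : realType.
Local Notation plane := (R * R)%type.
Implicit Types (p q v z w a : plane) (D E Omega : set plane) (f U : plane -> R).

Lemma sqn_rotation (n z : plane) : sqn n = 1 ->
  sqn (z.1 *: (n.2, - n.1) + z.2 *: n) = sqn z.
Proof.
move=> n1; rewrite -[RHS]mulr1 -n1 /sqn.
rewrite -[(_ *: _ + _).1]/(z.1 * n.2 + z.2 * n.1) -[(_ *: _ + _).2]/(z.1 * - n.1 + z.2 * n.2).
ring.
Qed.

(* The barrier is the imaginary part of [- 1 / (z + i r)]. *)
Lemma harmonic_dipole D (r : R) : 0 < r -> (forall z, D z -> 0 <= z.2) ->
  harmonic D (fun z => (z.2 + r) / sqn (z - (0, - r))).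
Proof.
move=> r0 D0.
have P z : D z -> sqn (z - (0, - r)) != 0.
  move=> /D0 z2; rewrite gt_eqF// sqn_gt0; apply/eqP => /(congr1 snd).
  rewrite -[(_ - _).2]/(z.2 - - r) opprK /= => /eqP.
  by rewrite gt_eqF// ltr_wpDl.
have j := jet2M (jet2D (jet2_snd_coord D) (jet2_cst D r)) (jet2_inv (jet2_sqn D (0, - r)) P).
do 2!eexists; split; first exact: j.
move=> z Dz; have := P z Dz; rewrite /= /sqn /axis /= opprK subr0.
by move=> Pz; field.
Qed.

Lemma growth_infinity (r d e N : R) (f : plane -> R) : 0 < d -> 0 < e ->
  (forall z, r < sqn z -> f z <= N) ->
  exists s, forall z, s <= sqn z -> f z - d * (ln (sqn z) - ln r) < e.
Proof.
move=> d0 e0 fN; have [s sP] := ln_sqn_ge (N / d + ln r).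
exists (Num.max s (r + 1)) => z; rewrite ge_max => /andP[/sP zs zr].
have fz : f z <= N by apply: fN; apply: lt_le_trans zr; rewrite ltrDl.
have : N <= d * (ln (sqn z) - ln r) by rewrite mulrC -ler_pdivrMr// lerBrDr.
by move: fz e0; clear; lra.
Qed.

Section Bounded.
Variables (U : plane -> R) (k M r : R).
Hypotheses (r0 : 0 < r) (k0 : 0 < k).
(** The factor 1/2 leaves room: the closed region [|z| >= r] lies in this open set. *)
Let E0 := [set z : plane | (r / 2) ^+ 2 < sqn z].
Hypotheses (hU : harmonic_on E0 U).
Hypotheses (bU : forall z, E0 z -> `|U z + k * ln (sqn z)| <= M).

Let oE0 : open E0.
Proof.
have -> : E0 = [set z : plane | (r / 2) ^+ 2 < sqn (z - 0)].
  by apply/seteqP; split=> z; rewrite /E0/= subr0.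
by apply: open_gtr; exact: sqn_continuous.
Qed.

Let rE0 z : r ^+ 2 <= sqn z -> E0 z.
Proof.
move=> zr; apply: lt_le_trans zr.
by rewrite ltr_pXn2r ?nnegrE ?(ltW r0) ?divr_ge0 ?(ltW r0)// ltr_pdivrMr// ltr_pMr// ltr1n.
Qed.

Let pos z : E0 z -> 0 < sqn z.
Proof. by apply: le_lt_trans; exact: sqr_ge0. Qed.

(** An isometry makes [z] and [w] mirror images in the first axis. The difference [W] of [U] and its
    mirror image vanishes on the axis and is at most [2 M], because the logarithms cancel. In the
    upper half plane outside the disc of radius [r] it is dominated by [4 M r b], where the dipole
    barrier [b] equals [1 / (2 r)] on the circle of radius [r] and is at most [1 / rho] at distance
    [rho]. *)
Lemma osc_circle z w (rho : R) : r < rho -> sqn z = rho ^+ 2 -> sqn w = rho ^+ 2 ->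
  U z - U w <= 4 * M * r / rho.
Proof.
move=> rr zr wr; have rho0 : 0 < rho by exact: lt_trans rr.
have M0 : 0 <= M.
  apply: (le_trans (normr_ge0 _)); apply: (bU (rE0 (_ : r ^+ 2 <= sqn z))); rewrite zr.
  by rewrite lerXn2r ?nnegrE ?ltW.
have [->|zw] := eqVneq z w; first by rewrite subrr !mulr_ge0// ?invr_ge0 ltW.
pose l := Num.sqrt (sqn (z - w)).
have szw : 0 < sqn (z - w) by rewrite sqn_gt0 subr_eq0.
have l0 : 0 < l by rewrite sqrtr_gt0.
have l2 : l ^+ 2 = sqn (z - w) by rewrite sqr_sqrtr// ltW.
(* [n] is the direction of the chord from [w] to [z], [e] is orthogonal to it, and [y] is half the
   length of the chord. *)
pose n : plane := ((z.1 - w.1) / l, (z.2 - w.2) / l).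
have n1 : sqn n = 1.
  rewrite /sqn /n/= !expr_div_n -mulrDl -[_ + _]/(sqn (z - w)) l2 divff// gt_eqF//.
pose e : plane := (n.2, - n.1).
pose x := z.1 * e.1 + z.2 * e.2.
pose y := l / 2.
have wz : sqn w = sqn z by rewrite zr wr.
have zE : z = x *: e + y *: n.
  have y' : y = z.1 * n.1 + z.2 * n.2.
    have -> : y = l ^+ 2 / (2 * l) by rewrite /y; field; rewrite gt_eqF.
    rewrite l2; have -> : sqn (z - w) = 2 * (z.1 * (z.1 - w.1) + z.2 * (z.2 - w.2)).
      have -> : sqn (z - w) = sqn (z - w) + (sqn z - sqn w) by rewrite wz subrr addr0.
      rewrite /sqn -[(z - w).1]/(z.1 - w.1) -[(z - w).2]/(z.2 - w.2); ring.
    by rewrite /n /=; field; rewrite gt_eqF.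
  rewrite [LHS]surjective_pairing.
  rewrite -[RHS]/(x * e.1 + y * n.1, x * e.2 + y * n.2).
  rewrite y' /x -[e.1]/(n.2) -[e.2]/(- n.1); have := n1; rewrite /sqn.
  move: (n.1) (n.2) => c s cs.
  congr pair.
    rewrite -[LHS]mulr1 -cs; ring.
  rewrite -[LHS]mulr1 -cs; ring.
have wE : w = x *: e + y *: (- n).
  have -> : w = z - (z - w) by rewrite opprB addrC subrK.
  rewrite {1}zE; have -> : z - w = (2 * y) *: n.
    rewrite [LHS]surjective_pairing -[RHS]/(2 * y * n.1, 2 * y * n.2) /y /n /=.
    by congr pair; field; rewrite gt_eqF.
  by rewrite -addrA -scaleNr -scalerDl scalerN -scaleNr; congr (_ + _ *: _); ring.
have n1' : e.1 ^+ 2 + n.1 ^+ 2 = 1 by rewrite addrC.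
have n2' : e.2 ^+ 2 + n.2 ^+ 2 = 1 by rewrite /e/= sqrrN.
have n12' : e.1 * e.2 + n.1 * n.2 = 0 by rewrite /e/=; ring.
have h1 := harmonic_isometry oE0 hU n1' n2' n12'.
have n1'' : e.1 ^+ 2 + (- n).1 ^+ 2 = 1 by rewrite -[(- n).1]/(- n.1) [(- n.1) ^+ 2]sqrrN.
have n2'' : e.2 ^+ 2 + (- n).2 ^+ 2 = 1 by rewrite -[(- n).2]/(- n.2) [(- n.2) ^+ 2]sqrrN.
have n12'' : e.1 * e.2 + (- n).1 * (- n).2 = 0.
  by rewrite -[(- n).1]/(- n.1) -[(- n).2]/(- n.2) mulrNN.
have h2 := harmonic_isometry oE0 hU n1'' n2'' n12''.
have L1 q : sqn (q.1 *: e + q.2 *: n) = sqn q by exact: sqn_rotation.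
have L2 q : sqn (q.1 *: e + q.2 *: (- n)) = sqn q.
  rewrite -[RHS]mulr1 -n1 /sqn.
  rewrite -[(_ *: _ + _).1]/(q.1 * n.2 + q.2 * - n.1) -[(_ *: _ + _).2]/(q.1 * - n.1 + q.2 * - n.2).
  by move: (n.1) (n.2) => c s; ring.
pose W q := U (q.1 *: e + q.2 *: n) - U (q.1 *: e + q.2 *: (- n)).
pose Cl := [set q : plane | 0 <= q.2 /\ r ^+ 2 <= sqn q].
have hW : harmonic Cl W.
  apply: harmonicB.
    by apply: harmonic_sub h1 => q [_ qr]; apply: rE0; rewrite L1.
  by apply: harmonic_sub h2 => q [_ qr]; apply: rE0; rewrite L2.
have W2M q : Cl q -> W q <= 2 * M.
  move=> [_ qr]; have b1 := bU (rE0 (_ : r ^+ 2 <= sqn (q.1 *: e + q.2 *: n))).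
  have b2 := bU (rE0 (_ : r ^+ 2 <= sqn (q.1 *: e + q.2 *: (- n)))).
  rewrite L1 in b1; rewrite L2 in b2.
  move: (b1 qr) (b2 qr); rewrite !ler_norml /W => /andP[_ u1] /andP[u2 _].
  by move: u1 u2; move: (U _) (U _) (k * _) => A B C; lra.
pose b q := (q.2 + r) / sqn (q - (0, - r)).
have hb : harmonic Cl b by apply: harmonic_dipole => // q [].
pose H := [set q : plane | 0 < q.2 /\ r ^+ 2 < sqn (q - 0)].
have HC : H `<=` Cl by move=> q [/ltW q1 /ltW]; rewrite subr0.
have oH : open H.
  apply: openI; [apply: open_gtr => q; exact: cvg_snd|apply: open_gtr; exact: sqn_continuous].
have hV : harmonic Cl (fun q => W q - 4 * M * r * b q).
  by apply: harmonicB hW (harmonicZ _ hb).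
have b0 q : Cl q -> 0 <= b q.
  by move=> [q2 _]; rewrite divr_ge0 ?sqn_ge0// addr_ge0// ltW.
have Mr0 : 0 <= 4 * M * r by rewrite !mulr_ge0// ltW.
have hB : harmonic H (fun q => ln (sqn (q - 0)) - ln (r ^+ 2)).
  apply: harmonicB (harmonic_cst _ _); apply: harmonic_ln_sqn.
  by move=> [_]; rewrite subr0 /sqn expr0n addr0 ltNge sqr_ge0.
have B0 q : Cl q -> 0 <= ln (sqn (q - 0)) - ln (r ^+ 2).
  have r20 : 0 < r ^+ 2 by rewrite exprn_gt0.
  by move=> [_ qr]; rewrite subr0 subr_ge0 ler_ln// posrE// (lt_le_trans r20).
have key : forall q, H q -> W q - 4 * M * r * b q <= 0.
  apply: (@maximum_principle_barrier _ H (fun q => W q - 4 * M * r * b q)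
     (fun q => ln (sqn (q - 0)) - ln (r ^+ 2))) => //.
  - exact/harmonic_subharmonic/(harmonic_sub HC).
  - move=> q cq nq d d' d0 d'0.
    have q2 : 0 <= q.2.
      by apply: (@closure_ger _ H snd q) => [|c [/ltW]//|//]; exact: cvg_snd.
    have qr : r ^+ 2 <= sqn (q - 0) by apply: closure_ger_sqn cq => c [_ /ltW].
    have Cq : Cl q by split; rewrite // -[q]subr0.
    have Vq : W q - 4 * M * r * b q < d'.
      apply: le_lt_trans d'0; rewrite subr_le0.
      move: q2; rewrite le_eqVlt => /orP[/eqP q2|q2].
        rewrite /W -q2 !scale0r subrr mulr_ge0// b0//.
      have {}qr : sqn q = r ^+ 2.
        apply/eqP; rewrite eq_le -{2}[q]subr0 qr andbT.
        by rewrite leNgt; apply/negP => qr'; apply: nq; rewrite /H/= subr0.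
      apply: (le_trans (W2M _ Cq)).
      rewrite [leRHS](_ : _ = 2 * M)// /b.
      have -> : sqn (q - (0, - r)) = 2 * r * (q.2 + r).
        rewrite /sqn -[(q - _).1]/(q.1 - 0) -[(q - _).2]/(q.2 - - r) subr0 opprK.
        have -> : q.1 ^+ 2 = r ^+ 2 - q.2 ^+ 2 by rewrite -qr /sqn addrK.
        ring.
      by field; rewrite !gt_eqF// addr_gt0.
    have := near_ltr (harmonic_cont hV Cq) Vq.
    apply: filterS => c Hc Hc'; apply: le_lt_trans Hc.
    by rewrite gerBl mulr_ge0 ?(ltW d0)//; exact/B0/HC.
  - move=> d d' d0 d'0.
    (* [growth_infinity] expects a bound on a whole exterior, hence the extension by 0 off [H]. *)
    pose f' q := if pselect (H q) then W q - 4 * M * r * b q else 0.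
    have fN q : r ^+ 2 < sqn q -> f' q <= 2 * M.
      rewrite /f' => _; case: pselect => Hq; last by rewrite mulr_ge0.
      by rewrite (le_trans _ (W2M _ (HC _ Hq)))// gerBl mulr_ge0//; exact/b0/HC.
    have [s sP] := growth_infinity d0 d'0 fN.
    by exists s => q Hq /sP; rewrite subr0 /f'; case: pselect.
have Hxy : H (x, y).
  split; first by rewrite divr_gt0.
  rewrite subr0 -(L1 (x, y)) /= -zE zr.
  by rewrite ltr_pXn2r ?nnegrE ?(ltW r0) ?(ltW rho0).
have := key _ Hxy; rewrite subr_le0 {1}/W /= -zE -wE => /le_trans; apply.
rewrite ler_wpM2l// /b -[rho^-1]div1r ler_pdivrMr; last first.
  rewrite sqn_gt0; apply/eqP => /(congr1 snd).
  rewrite -[(_ - _).2]/(y - - r) opprK /= => /eqP.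
  by rewrite gt_eqF// addr_gt0// divr_gt0.
have rxy : x ^+ 2 + y ^+ 2 = rho ^+ 2 by rewrite -zr zE (L1 (x, y)).
rewrite mul1r mulrC ler_pdivlMr// /sqn /= subr0 opprK.
have y0 : 0 < y by rewrite divr_gt0.
have : (y + r) * rho <= ((y + r) ^+ 2 + rho ^+ 2) / 2.
  rewrite -subr_ge0; set A := y + r.
  have -> : (A ^+ 2 + rho ^+ 2) / 2 - A * rho = (A - rho) ^+ 2 / 2 by field.
  by rewrite divr_ge0 ?sqr_ge0.
rewrite -rxy.
have yr : y ^+ 2 <= (y + r) ^+ 2 by rewrite lerXn2r ?nnegrE ?addr_ge0 ?(ltW y0) ?(ltW r0)// lerDl ltW.
have := sqr_ge0 x; move: yr; move: (x ^+ 2) (y ^+ 2) ((y + r) ^+ 2) ((y + r) * rho) => A B C D.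
by lra.
Qed.

Let v z := U z + k * ln (sqn z).

Let hv : harmonic E0 v.
Proof.
apply: harmonicD (harmonic_on_harmonic hU) (harmonicZ k _).
have -> : (fun p => ln (sqn p)) = (fun p : plane => ln (sqn (p - 0))).
  by apply/funext => p; rewrite subr0.
by apply: harmonic_ln_sqn; rewrite /E0/= /sqn expr0n addr0 ltNge sqr_ge0.
Qed.

(** On one circle [v] and [U] differ by a constant, so [osc_circle] bounds [v - v q] and its
    opposite there. Since [v] is bounded, the maximum principle with the logarithmic barrier carries
    both bounds outwards. Comparing [z] and [w] each with [q] doubles the constant. *)
Lemma osc_exterior z w (rho : R) : r < rho -> rho ^+ 2 <= sqn z -> rho ^+ 2 <= sqn w ->
  v z - v w <= 8 * M * r / rho.
Proof.
move=> rr; have rho0 : 0 < rho by exact: lt_trans rr.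
have rho2 : 0 < rho ^+ 2 by rewrite exprn_gt0.
pose C := 4 * M * r / rho.
pose D := [set z : plane | rho ^+ 2 < sqn (z - 0)].
have oD : open D by apply: open_gtr; exact: sqn_continuous.
have rE z' : rho ^+ 2 <= sqn z' -> E0 z'.
  by move=> h; apply: rE0; apply: le_trans h; rewrite lerXn2r ?nnegrE ?ltW.
have DE : D `<=` E0 by move=> z' /ltW; rewrite subr0; exact: rE.
pose q : plane := (rho, 0).
have q2 : sqn q = rho ^+ 2 by rewrite /sqn/= expr0n addr0.
have hB : harmonic D (fun q => ln (sqn (q - 0)) - ln (rho ^+ 2)).
  apply: harmonicB (harmonic_cst _ _); apply: harmonic_ln_sqn.
  by rewrite /D/= subr0 /sqn expr0n addr0 ltNge sqr_ge0.
have B0 z' : D z' -> 0 <= ln (sqn (z' - 0)) - ln (rho ^+ 2).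
  by move=> Dz; rewrite subr_ge0 ler_ln// ?posrE ?(lt_trans rho2)// ltW.
have main (s : R) : s = 1 \/ s = -1 -> forall z', rho ^+ 2 <= sqn z' -> s * (v z' - v q) - C <= 0.
  move=> s1.
  have circ z' : sqn z' = rho ^+ 2 -> s * (v z' - v q) - C <= 0.
    move=> z'2; have -> : v z' - v q = U z' - U q by rewrite /v z'2 q2 opprD addrACA subrr addr0.
    rewrite subr_le0; case: s1 => ->; first by rewrite mul1r; exact: osc_circle.
    by rewrite mulN1r opprB; exact: osc_circle.
  have hV : harmonic E0 (fun z => s * (v z - v q) - C).
    by apply: harmonicB (harmonicZ s (harmonicB hv (harmonic_cst _ _))) (harmonic_cst _ _).
  have key : forall z', D z' -> s * (v z' - v q) - C <= 0.
    apply: (@maximum_principle_barrier _ D (fun z => s * (v z - v q) - C)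
     (fun q => ln (sqn (q - 0)) - ln (rho ^+ 2))) => //.
    - exact/harmonic_subharmonic/(harmonic_sub DE).
    - move=> x cx nx d e d0 e0.
      have xr : sqn x = rho ^+ 2.
        apply/eqP; rewrite eq_le -{2}[x]subr0; apply/andP; split.
          by rewrite leNgt; apply/negP => h; apply: nx; rewrite /D/= subr0.
        by apply: closure_ger_sqn cx => c /ltW.
      have Ex : E0 x by apply: rE; rewrite xr.
      have Vx : s * (v x - v q) - C < e by apply: le_lt_trans e0; exact: circ.
      have := near_ltr (harmonic_cont hV Ex) Vx.
      apply: filterS => c Hc Dc; apply: le_lt_trans Hc.
      by rewrite gerBl mulr_ge0 ?(ltW d0)//; exact: B0.
    - move=> d e d0 e0.
      have fN c : rho ^+ 2 < sqn c -> s * (v c - v q) - C <= M + M + `|C|.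
        move=> /ltW/rE Ec; apply: le_trans (ler_norm _) _.
        have sN : `|s| = 1 by case: s1 => ->; rewrite ?normrN normr1.
        rewrite (le_trans (ler_normB _ _))// lerD2r normrM sN mul1r.
        by rewrite (le_trans (ler_normB _ _))// lerD// bU//; apply: rE; rewrite q2.
      have [S SP] := growth_infinity d0 e0 fN.
      by exists S => c _ /SP; rewrite subr0.
  move=> z'; rewrite le_eqVlt => /orP[/eqP/esym/circ//|z'r].
  by apply: key; rewrite /D/= subr0.
move=> zr wr; have H1 := main 1 (or_introl erefl) z zr.
have H2 := main (-1) (or_intror erefl) w wr.
have -> : 8 * M * r / rho = C + C by rewrite /C; ring.
by move: H1 H2; rewrite mul1r mulN1r; clear main; move: (v z) (v w) (v q) C => A B Q C'; lra.
Qed.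

Lemma derive_v p b : E0 p -> is_derive p (axis R b) v
  (pderiv [:: b] U p + k * ((if b then 2 * p.2 else 2 * p.1) / sqn p)).
Proof.
move=> Ep; have P z : E0 z -> 0 < sqn (z - 0) by rewrite subr0; exact: pos.
have jl := jet2Z k (jet2_ln (jet2_sqn E0 0) P).
have := is_deriveD (@jet2_fst _ _ _ _ _ (harmonic_on_jet2 hU) b p Ep)
  (@jet2_fst _ _ _ _ _ jl b p Ep).
have -> : (U + (fun p0 => k * ln (sqn (p0 - 0)))) = v.
  by apply/funext => z; rewrite /v !fctE subr0.
by rewrite !subr0.
Qed.

(* At infinity [grad U] is [- 2 k z / |z|^2], up to terms of order [1 / |z|^2]. *)
Lemma grad_at_infinity : exists s, forall z, s <= sqn z -> E0 z /\
  2 * k ^+ 2 <= (pderiv [:: false] U z ^+ 2 + pderiv [:: true] U z ^+ 2) * sqn z <= 7 * k ^+ 2.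
Proof.
pose C := 16 * M * r.
(* The first threshold keeps the disc of radius [l / 2] about [p] in the region [|z| >= l / 2 > r],
   where the oscillation of [v] is at most [C / l]. The second makes the resulting bound
   [(2 C)^2 / l^2] on each squared derivative of [v] times [l^2] at most [k^2 / 8]. *)
exists (Num.max ((4 * r) ^+ 2) (8 * (2 * C) ^+ 2 / k ^+ 2)) => p; rewrite ge_max => /andP[p1 p2].
pose l := Num.sqrt (sqn p).
have p0 : 0 < sqn p by apply: lt_le_trans p1; rewrite exprn_gt0// mulr_gt0.
have l0 : 0 < l by rewrite sqrtr_gt0.
have l2 : l ^+ 2 = sqn p by rewrite sqr_sqrtr// ltW.
have lr : 4 * r <= l.
  rewrite -(ler_pXn2r (_ : (0 < 2)%N))// ?nnegrE ?(ltW l0)//; first by rewrite l2.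
  by rewrite mulr_ge0// ltW.
have far z : sqn (z - p) <= (l / 2) ^+ 2 -> (l / 2) ^+ 2 <= sqn z.
  move=> zp; have : sqn p <= 2 * sqn z + 2 * sqn (z - p).
    rewrite /sqn -[(z - p).1]/(z.1 - p.1) -[(z - p).2]/(z.2 - p.2) -subr_ge0.
    rewrite [leRHS](_ : _ = (2 * z.1 - p.1) ^+ 2 + (2 * z.2 - p.2) ^+ 2); last by ring.
    by rewrite addr_ge0 ?sqr_ge0.
  by move: zp; rewrite -l2 expr_div_n; move: (l ^+ 2) (sqn z) (sqn _) => A B D; lra.
have l20 : 0 < l / 2 by rewrite divr_gt0.
have rl : r < l / 2 by move: lr r0; lra.
have Ep : E0 p by apply: rE0; apply: le_trans p1; rewrite lerXn2r ?nnegrE ?mulr_ge0 ?(ltW r0)// ler_peMl ?(ltW r0)// ler1n.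
split=> //.
have EB z : sqn (z - p) <= (l / 2) ^+ 2 -> E0 z.
  by move=> /far zl; apply: rE0; apply: le_trans zl; rewrite lerXn2r ?nnegrE ?(ltW r0)// ltW.
have osc z w : sqn (z - p) <= (l / 2) ^+ 2 -> sqn (w - p) <= (l / 2) ^+ 2 ->
    v z - v w <= C / l.
  move=> /far zl /far wl; have -> : C / l = 8 * M * r / (l / 2).
    by rewrite /C; field; rewrite gt_eqF.
  exact: osc_exterior.
have D b := norm_derive_le_osc l20 hv EB osc (derive_v b Ep).
move: (D false) (D true) => /=; set d1 := _ + k * _; set d2 := _ + k * _ => D1 D2.
have -> : 'D_(1, 0) U p = d1 - 2 * k * p.1 / l ^+ 2.
  by rewrite /d1 l2; field; rewrite gt_eqF.
have -> : 'D_(0, 1) U p = d2 - 2 * k * p.2 / l ^+ 2.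
  by rewrite /d2 l2; field; rewrite gt_eqF.
have sq (d : R) : `|d| <= C / l / (l / 2) -> d ^+ 2 * l ^+ 2 <= (2 * C) ^+ 2 / l ^+ 2.
  move=> h; have -> : (2 * C) ^+ 2 / l ^+ 2 = (C / l / (l / 2)) ^+ 2 * l ^+ 2.
    by field; rewrite gt_eqF.
  rewrite ler_pM2r ?exprn_gt0// -(real_normK (num_real d)) lerXn2r ?nnegrE//.
  exact: le_trans h.
have small : (2 * C) ^+ 2 / l ^+ 2 <= k ^+ 2 / 8.
  rewrite l2 ler_pdivrMr// mulrAC ler_pdivlMr//.
  by move: p2; rewrite ler_pdivrMr ?exprn_gt0// (mulrC (sqn p)) (mulrC 8).
have T : (d1 ^+ 2 + d2 ^+ 2) * l ^+ 2 <= k ^+ 2 / 4.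
  rewrite mulrDl; move: (sq _ D1) (sq _ D2) small.
  by move: (d1 ^+ 2 * _) (d2 ^+ 2 * _) (_ / l ^+ 2) => A B Q; lra.
have dp : `|d1 * p.1 + d2 * p.2| <= k / 2.
  rewrite -(ler_pXn2r (_ : (0 < 2)%N))// ?nnegrE ?divr_ge0 ?(ltW k0)//.
  rewrite real_normK ?num_real// expr_div_n (_ : 2 ^+ 2 = 4); last by rewrite expr2; ring.
  apply: le_trans T; rewrite l2 /sqn -subr_ge0.
  rewrite [leRHS](_ : _ = (d1 * p.2 - d2 * p.1) ^+ 2); last by ring.
  exact: sqr_ge0.
(* With [grad U = d - 2 k p / l^2], the quantity is [|d|^2 l^2 - 4 k (d . p) + 4 k^2], whose first
   term lies between 0 and [k^2 / 4] and whose second is at most [2 k^2] in absolute value; whence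
   the factors 2 and 7. *)
rewrite -l2 [X in _ <= X <= _](_ : _ =
   (d1 ^+ 2 + d2 ^+ 2) * l ^+ 2 - 4 * k * (d1 * p.1 + d2 * p.2) + 4 * k ^+ 2); last first.
  have -> : 4 * k ^+ 2 = 4 * k ^+ 2 * (p.1 ^+ 2 + p.2 ^+ 2) / l ^+ 2.
    by rewrite l2 -/(sqn p) mulfK// gt_eqF.
  by field; rewrite gt_eqF.
have T0 : 0 <= (d1 ^+ 2 + d2 ^+ 2) * l ^+ 2 by rewrite mulr_ge0 ?addr_ge0 ?sqr_ge0.
have : `|4 * k * (d1 * p.1 + d2 * p.2)| <= 2 * k ^+ 2.
  rewrite normrM gtr0_norm ?mulr_gt0// (_ : 2 * k ^+ 2 = 4 * k * (k / 2)); last by field.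
  by rewrite ler_pM2l ?mulr_gt0.
rewrite ler_norml; have := sqr_ge0 k; move: T T0.
move: (_ * l ^+ 2) (4 * k * _) (k ^+ 2) => A B K AK A0 K0 /andP[B1 B2].
by apply/andP; split; lra.
Qed.

End Bounded.
End AtInfinity.

(** * Winding numbers *)

Section Winding.
Variable R : realType.
Local Notation plane := (R * R)%type.
Implicit Types (p q v z w a : plane) (A B D E Omega : set plane).

Definition crossp v w : R := v.2 * w.1 - v.1 * w.2.

(* The angle in ]- pi, pi[ from [w] to [v], for vectors that are not opposite. *)
Definition ang v w : R := 2 * atan (crossp v w / (enorm v * enorm w + dotp v w)).

(** This is strictness in the Cauchy-Schwarz inequality on the negative side; it also excludes zero
    vectors. *)
Definition not_opposite v w := 0 < enorm v * enorm w + dotp v w.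

Lemma dot_cross v w : dotp v w ^+ 2 + crossp v w ^+ 2 = (enorm v * enorm w) ^+ 2.
Proof. by rewrite exprMn !sqr_enorm /dotp /crossp /sqn; ring. Qed.

Lemma dotp_le v w : `|dotp v w| <= enorm v * enorm w.
Proof.
rewrite -(ler_pXn2r (_ : (0 < 2)%N))// ?nnegrE ?mulr_ge0 ?enorm_ge0//.
by rewrite real_normK ?num_real// -dot_cross lerDl sqr_ge0.
Qed.

Lemma enormD v w : enorm (v + w) <= enorm v + enorm w.
Proof.
rewrite -(ler_pXn2r (_ : (0 < 2)%N))// ?nnegrE ?addr_ge0 ?enorm_ge0//.
rewrite sqrrD !sqr_enorm; have := le_trans (ler_norm _) (dotp_le v w).
rewrite /sqn /dotp -[(v + w).1]/(v.1 + w.1) -[(v + w).2]/(v.2 + w.2).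
by move: (enorm v * enorm w) => N; rewrite !expr2; lra.
Qed.

(** The tangent of half an angle is its sine divided by 1 plus its cosine; with [N] the product of
    the norms, the quotient in [ang] is this tangent, and the duplication formulas give back the
    cosine [dotp / N] and the sine [crossp / N]. *)
Lemma ang_cos_sin v w : not_opposite v w ->
  cos (ang v w) * (enorm v * enorm w) = dotp v w /\
  sin (ang v w) * (enorm v * enorm w) = crossp v w.
Proof.
rewrite /not_opposite /ang => N0; have := dot_cross v w.
move: (dotp v w) (crossp v w) (enorm v * enorm w) N0 => d c N N0 dc.
set t := c / (N + d).
have c2 : cos (atan t) ^+ 2 = (1 + t ^+ 2)^-1.
  by rewrite cos_atan exprVn sqr_sqrtr// addr_ge0 ?sqr_ge0.
have cn0 : cos (atan t) != 0.
  apply/eqP => c0; move: c2; rewrite c0 expr0n/= => /esym/eqP; rewrite invr_eq0.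
  by rewrite gt_eqF// ltr_wpDr ?sqr_ge0.
have s1 : sin (atan t) = t * cos (atan t).
  by have tt := atanK t; rewrite -[X in _ = X * _]tt /tan divfK.
have tE : 1 + t ^+ 2 = 2 * N / (N + d).
  have -> : 1 + t ^+ 2 = ((N + d) ^+ 2 + c ^+ 2) / (N + d) ^+ 2.
    by rewrite /t; field; rewrite gt_eqF.
  have -> : c ^+ 2 = N ^+ 2 - d ^+ 2 by rewrite -dc addrC addKr.
  by field; rewrite gt_eqF.
have N1 : N != 0.
  apply/eqP => NE; move: dc; rewrite NE expr0n/= => /eqP.
  rewrite paddr_eq0 ?sqr_ge0// !sqrf_eq0 => /andP[/eqP dE _].
  by move: N0; rewrite NE dE addr0 ltxx.
have cc : cos (atan t) ^+ 2 = (N + d) / (2 * N) by rewrite c2 tE invf_div.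
have Nd : N + d != 0 by rewrite gt_eqF.
rewrite (mulr_natl (atan t) 2) cos_mulr2n sin_mulr2n; split.
  by rewrite cc; field.
rewrite s1 (_ : _ *+ 2 = 2 * t * cos (atan t) ^+ 2); last by ring.
by rewrite cc /t; field; rewrite Nd N1.
Qed.

(** [t] is an argument of [v], determined up to multiples of 2 pi; every [t] is one of the zero
    vector. *)
Definition has_dir v (t : R) := v = enorm v *: ((cos t, sin t) : plane).

Lemma has_dirP v t : has_dir v t <-> v.1 = enorm v * cos t /\ v.2 = enorm v * sin t.
Proof.
split=> [vE|[e1 e2]]; first by split; rewrite [in LHS]vE.
by rewrite /has_dir [LHS]surjective_pairing e1 e2.
Qed.

Lemma ang_dir v w t : v != 0 -> not_opposite v w -> has_dir v t -> has_dir w (t - ang v w).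
Proof.
move=> v0 /ang_cos_sin[c s] /has_dirP[v1 v2].
have l0 : enorm v != 0 by rewrite gt_eqF// enorm_gt0.
move: c s; rewrite /dotp /crossp v1 v2 => c s.
have {}c : cos (ang v w) * enorm w = cos t * w.1 + sin t * w.2.
  by apply: (mulfI l0); rewrite mulrCA c; ring.
have {}s : sin (ang v w) * enorm w = sin t * w.1 - cos t * w.2.
  by apply: (mulfI l0); rewrite mulrCA s; ring.
apply/has_dirP; rewrite cosB sinB; have cs := cos2Dsin2 t; split.
  have -> : enorm w * (cos t * cos (ang v w) + sin t * sin (ang v w)) =
    cos t * (cos (ang v w) * enorm w) + sin t * (sin (ang v w) * enorm w) by ring.
  by rewrite c s -[LHS]mulr1 -cs; ring.
have -> : enorm w * (sin t * cos (ang v w) - cos t * sin (ang v w)) =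
  sin t * (cos (ang v w) * enorm w) - cos t * (sin (ang v w) * enorm w) by ring.
by rewrite c s -[LHS]mulr1 -cs; ring.
Qed.

Lemma has_dir_scale (r t : R) : 0 <= r -> has_dir (r *: ((cos t, sin t) : plane)) t.
Proof. by move=> r0; rewrite /has_dir enorm_sqn sqn_polar sqrtr_sqr ger0_norm. Qed.

Lemma has_dir_exists v : exists t, has_dir v t.
Proof. by have [t vt] := polar_sqn v; exists t; rewrite /has_dir enorm_sqn. Qed.

Lemma ang_polar v w (s t : R) : v != 0 -> w != 0 -> has_dir v s -> has_dir w t ->
  - pi < s - t < pi -> not_opposite v w /\ ang v w = s - t.
Proof.
move=> v0 w0 /has_dirP[v1 v2] /has_dirP[w1 w2] st.
have N0 : 0 < enorm v * enorm w by rewrite mulr_gt0 ?enorm_gt0.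
have dE : dotp v w = enorm v * enorm w * cos (s - t).
  by rewrite /dotp v1 v2 w1 w2 cosB; ring.
have cE : crossp v w = enorm v * enorm w * sin (s - t).
  by rewrite /crossp v1 v2 w1 w2 sinB; ring.
pose h := (s - t) / 2.
have hE : s - t = h *+ 2 by rewrite /h -mulr_natr divfK.
have hp : - (pi / 2) < h < pi / 2.
  by move: st => /andP[s1 s2]; rewrite /h; apply/andP; split; lra.
have ch : 0 < cos h by exact: cos_gt0_pihalf.
have E : enorm v * enorm w + dotp v w = enorm v * enorm w * 2 * cos h ^+ 2.
  by rewrite dE hE cos_mulr2n; ring.
split.
  by rewrite /not_opposite E; apply: mulr_gt0; [rewrite mulr_gt0|rewrite exprn_gt0].
rewrite /ang E cE hE sin_mulr2n.
have -> : enorm v * enorm w * (cos h * sin h *+ 2) / (enorm v * enorm w * 2 * cos h ^+ 2) = tan h.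
  by rewrite /tan -mulr_natr; field; rewrite !gt_eqF// enorm_gt0.
by rewrite tanK ?in_itv// (mulr_natl h 2).
Qed.

(** If [v = z - p] and [w = z - q] were opposite, the equality case of Cauchy-Schwarz would give
    [|w| v + |v| w = 0], so that [z] would divide the segment from [p] to [q] in the ratio of [|v|]
    to [|w|]. *)
Lemma not_opposite_segment z p q : (forall t : R, 0 <= t <= 1 -> z <> p + t *: (q - p)) ->
  not_opposite (z - p) (z - q).
Proof.
move=> zpq; rewrite /not_opposite ltNge; apply/negP => N0.
set v := z - p in N0; set w := z - q in N0.
have v0 : v != 0.
  apply/eqP => v0; apply: (zpq 0); rewrite ?lexx ?ler01//.
  by rewrite scale0r addr0; apply/eqP; rewrite -subr_eq0; apply/eqP.
have lv := enorm_gt0 v0; have lw := enorm_ge0 w.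
have s0 : 0 < enorm v + enorm w by rewrite ltr_wpDr.
have key : enorm w *: v + enorm v *: w = 0.
  apply/eqP; rewrite -sqn_eq0 eq_le sqn_ge0 andbT.
  have -> : sqn (enorm w *: v + enorm v *: w) =
    enorm w ^+ 2 * sqn v + enorm v ^+ 2 * sqn w + 2 * (enorm v * enorm w) * dotp v w.
    rewrite /sqn /dotp -[(_ + _).1]/(enorm w * v.1 + enorm v * w.1).
    by rewrite -[(_ + _).2]/(enorm w * v.2 + enorm v * w.2); ring.
  rewrite -!sqr_enorm.
  have -> : enorm w ^+ 2 * enorm v ^+ 2 + enorm v ^+ 2 * enorm w ^+ 2 + 2 * (enorm v * enorm w) * dotp v w
    = 2 * (enorm v * enorm w) * (enorm v * enorm w + dotp v w) by ring.
  by rewrite mulr_ge0_le0// !mulr_ge0// ltW.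
apply: (zpq (enorm v / (enorm v + enorm w))).
  by rewrite divr_ge0 ?(ltW lv) ?(ltW s0)//= ler_pdivrMr// mul1r lerDl.
have k1 : enorm w * (z.1 - p.1) + enorm v * (z.1 - q.1) = 0 by have := congr1 fst key.
have k2 : enorm w * (z.2 - p.2) + enorm v * (z.2 - q.2) = 0 by have := congr1 snd key.
have solve (x y y' : R) : enorm w * (x - y) + enorm v * (x - y') = 0 ->
    x = y + enorm v / (enorm v + enorm w) * (y' - y).
  move=> h; apply/eqP; rewrite -subr_eq0.
  have -> : x - (y + enorm v / (enorm v + enorm w) * (y' - y)) =
    (enorm w * (x - y) + enorm v * (x - y')) / (enorm v + enorm w) by field; rewrite gt_eqF.
  by rewrite h mul0r.
by rewrite [LHS]surjective_pairing (solve _ _ _ k1) (solve _ _ _ k2).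
Qed.

Lemma ang_continuous (T : topologicalType) (V W : T -> plane) x :
  {for x, continuous V} -> {for x, continuous W} -> not_opposite (V x) (W x) ->
  {for x, continuous (fun y => ang (V y) (W y))}.
Proof.
move=> cV cW N0.
have c1 (f : T -> plane) : {for x, continuous f} -> {for x, continuous (fun y => (f y).1)}.
  by move=> cf; apply: (@continuous_comp _ _ _ f fst); [exact: cf|exact: cvg_fst].
have c2 (f : T -> plane) : {for x, continuous f} -> {for x, continuous (fun y => (f y).2)}.
  by move=> cf; apply: (@continuous_comp _ _ _ f snd); [exact: cf|exact: cvg_snd].
have cl (f : T -> plane) : {for x, continuous f} -> {for x, continuous (fun y => enorm (f y))}.
  move=> cf; apply: (@continuous_comp _ _ _ (fun y => sqn (f y)) Num.sqrt); last exact: sqrt_continuous.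
  by apply: cvgD; apply: cvgM; [exact: c1|exact: c1|exact: c2|exact: c2].
apply: cvgM; first exact: cvg_cst.
apply: (@continuous_comp _ _ _ (fun y => crossp (V y) (W y) /
  (enorm (V y) * enorm (W y) + dotp (V y) (W y))) atan); last exact: continuous_atan.
apply: cvgM.
  by apply: cvgB; apply: cvgM; [exact: c2|exact: c1|exact: c1|exact: c2].
apply: cvgV; first by rewrite gt_eqF.
apply: cvgD; first by apply: cvgM; exact: cl.
by apply: cvgD; apply: cvgM; [exact: c1|exact: c1|exact: c2|exact: c2].
Qed.

Lemma not_opposite_cont p q z : not_opposite (z - p) (z - q) ->
  {for z, continuous (fun z => ang (z - p) (z - q))}.
Proof.
move=> N0; apply: (@ang_continuous _ (fun z => z - p) (fun z => z - q)); last exact: N0.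
  by apply: cvgB; [exact: cvg_id|exact: cvg_cst].
by apply: cvgB; [exact: cvg_id|exact: cvg_cst].
Qed.

Lemma continuous_right_cst (F : R -> R) (c sigma : R) : {for 0, continuous F} -> 0 < sigma ->
  (forall s, 0 < s -> s <= sigma -> F s = c) -> F 0 = c.
Proof.
move=> cF sg0 Fc; apply/eqP; rewrite -subr_eq0 -normr_le0 leNgt; apply/negP => d0.
have N : \forall s \near (0 : R), `|F 0 - F s| < `|F 0 - c| by move/cvgrPdist_lt: cF; exact.
have /near_right0P[r r0 rP] : \forall s \near (0 : R)^'+, `|F 0 - F s| < `|F 0 - c|.
  exact: cvg_within.
pose s := Num.min r sigma / 2.
have m0 : 0 < Num.min r sigma by rewrite lt_min r0.
have s0 : 0 < s by rewrite divr_gt0.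
have sm : s < Num.min r sigma by rewrite ltr_pdivrMr// ltr_pMr// ltr1n.
have sr : s < r by apply: lt_le_trans sm _; rewrite ge_min lexx.
have ss : s <= sigma by apply/ltW/(lt_le_trans sm); rewrite ge_min lexx orbT.
by have := rP s s0 sr; rewrite (Fc s)// ltxx.
Qed.

(** Up to sign, the variation in radians of the argument of [z] minus the running point along the
    path; [ang] measures from its second argument to its first, hence the minus sign in
    [winding_dir]. *)
Fixpoint winding z p (s : seq plane) : R :=
  if s is r :: s' then ang (z - p) (z - r) + winding z r s' else 0.

Lemma winding_dir A z p s q t : polyline A p s q -> ~ A z -> A p ->
  has_dir (z - p) t -> has_dir (z - q) (t - winding z p s).
Proof.
move=> + Az; elim: s p t => [p t <- _|r s IH p t [h1 h2] Ap ht] /=; first by rewrite subr0.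
have n0 : not_opposite (z - p) (z - r).
  by apply: not_opposite_segment => u u01 zE; apply: Az; rewrite zE; exact: h1.
have Ar : A r by have := h1 1; rewrite scale1r subrKC; apply; rewrite ler01 lexx.
rewrite opprD addrA; apply: IH => //; apply: ang_dir => //.
by rewrite subr_eq0; apply/eqP => zp; apply: Az; rewrite zp.
Qed.

Lemma winding_cont A z p s q : polyline A p s q -> ~ A z ->
  {for z, continuous (fun z => winding z p s)}.
Proof.
move=> + Az; elim: s p => [p _|r s IH p [h1 h2]] /=; first exact: cst_continuous.
apply: cvgD; last exact: IH.
apply: not_opposite_cont; apply: not_opposite_segment => u u01 zE.
by apply: Az; rewrite zE; exact: h1.
Qed.

(** The image is an interval on which the cosine is 1. If it were not a point, it would contain
    [f w + d] with [0 < d < pi] and the cosine of [d] would be 1. *)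
Lemma connected_cos1_cst B (f : plane -> R) : connected B ->
  (forall z, B z -> {for z, continuous f}) -> (forall z, B z -> cos (f z) = 1) ->
  forall z w, B z -> B w -> f z = f w.
Proof.
move=> cB cf f1.
have itv : is_interval (f @` B).
  apply/connected_intervalP/connected_continuous_connected => //.
  by apply: continuous_in_subspaceT => z; rewrite inE; exact: cf.
suff le z w : B z -> B w -> f z <= f w.
  by move=> z w Bz Bw; apply/eqP; rewrite eq_le !le.
move=> Bz Bw; rewrite leNgt; apply/negP => fwz.
pose d := Num.min (f z - f w) pi / 2.
have m0 : 0 < Num.min (f z - f w) pi by rewrite lt_min subr_gt0 fwz pi_gt0.
have d0 : 0 < d by rewrite divr_gt0.
have dm : d < Num.min (f z - f w) pi by rewrite ltr_pdivrMr// ltr_pMr// ltr1n.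
have dz : d < f z - f w by apply: lt_le_trans dm _; rewrite ge_min lexx.
have dpi : d < pi by apply: lt_le_trans dm _; rewrite ge_min lexx orbT.
have [x Bx fx] : (f @` B) (f w + d).
  apply: (itv (f w) (f z)); [by exists w|by exists z|].
  by apply/andP; split; move: d0 dz; clear; lra.
have sw : sin (f w) = 0.
  apply/eqP; rewrite -sqrf_eq0; apply/eqP; have := cos2Dsin2 (f w).
  by rewrite f1// expr1n; move: (_ ^+ 2) => X; clear; lra.
have := f1 x Bx; rewrite fx cosD f1// sw mul1r mul0r subr0 -cos0 => /eqP.
rewrite eq_le => /andP[_]; rewrite leNgt ltr_cos ?d0// in_itv/= ?lexx ?pi_ge0//.
by rewrite !ltW.
Qed.

(* The loop made of a polygonal path in [A] from [p + sigma e(t)] to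
   [p + sigma e(t + 2 h)] and of the two segments back to [p] has a constant winding
   number on [B], but the two sides of the corner at [p] both meet [B]. *)
Lemma no_crossing A B p (t h sigma : R) : open A -> connected A -> connected B ->
  (forall z, A z -> ~ B z) -> ~ A p -> ~ B p -> 0 < h -> h <= pi / 2 -> 0 < sigma ->
  (forall s, 0 < s -> s <= sigma ->
    [/\ A (p + s *: (cos t, sin t)), A (p + s *: (cos (t + 2 * h), sin (t + 2 * h))),
        B (p + s *: (cos (t + h), sin (t + h))) & B (p + s *: (cos (t - h), sin (t - h)))]) ->
  False.
Proof.
move=> oA cA cB AB pA pB h0 hpi sg0 sec.
pose e u : plane := (cos u, sin u).
pose a1 := p + sigma *: e t; pose a2 := p + sigma *: e (t + 2 * h).
have Aa u s : u = t \/ u = t + 2 * h -> 0 < s -> s <= sigma -> A (p + s *: e u).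
  by move=> [->|->] s0 ss; have [] := sec s s0 ss.
have Bb u s : u = t + h \/ u = t - h -> 0 < s -> s <= sigma -> B (p + s *: e u).
  by move=> [->|->] s0 ss; have [] := sec s s0 ss.
have Aa1 : A a1 by apply: Aa => //; left.
have Aa2 : A a2 by apply: Aa => //; right.
have [S pS] := open_connected_polyline oA cA Aa1 Aa2.
have BA z : B z -> ~ A z by move=> Bz Az; exact: AB Az Bz.
have Bp z : B z -> z != p by move=> Bz; apply/eqP => zp; apply: pB; rewrite -zp.
pose N z := ang (z - p) (z - a1) + winding z a1 S + ang (z - a2) (z - p).
have n1 z : B z -> not_opposite (z - p) (z - a1).
  move=> Bz; apply: not_opposite_segment => u /andP[u0 u1] zE.
  move: u0; rewrite le_eqVlt => /orP[/eqP u0|u0].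
    by apply: pB; move: zE; rewrite -u0 scale0r addr0 => <-.
  apply: BA Bz _; rewrite zE /a1 (_ : p + sigma *: e t - p = sigma *: e t); last by rewrite addrC addKr.
  rewrite scalerA; apply: Aa; first by left.
    by rewrite mulr_gt0.
  by rewrite ler_piMl// ltW.
have n2 z : B z -> not_opposite (z - a2) (z - p).
  move=> Bz; apply: not_opposite_segment => u /andP[u0 u1] zE.
  have {}zE : z = p + ((1 - u) * sigma) *: e (t + 2 * h).
    by rewrite zE /a2 opprD addrA subrr add0r scalerN scalerA -addrA -scalerBl mulrBl mul1r.
  move: u1; rewrite le_eqVlt => /orP[/eqP u1|u1].
    by apply: pB; move: zE; rewrite u1 subrr mul0r scale0r addr0 => <-.
  apply: BA Bz _; rewrite zE; apply: Aa; first by right.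
    by rewrite mulr_gt0// subr_gt0.
  by rewrite ler_piMl ?(ltW sg0)// gerBl.
have cN z : B z -> {for z, continuous N}.
  move=> Bz; apply: cvgD; [apply: cvgD|]; [exact/not_opposite_cont/n1| |exact/not_opposite_cont/n2].
  by apply: (winding_cont pS); exact: BA.
have N1 z : B z -> cos (N z) = 1.
  move=> Bz; have zp : z - p != 0 by rewrite subr_eq0 Bp.
  have [u d0] := has_dir_exists (z - p).
  have d1 := ang_dir zp (n1 z Bz) d0.
  have d2 := winding_dir pS (BA z Bz) Aa1 d1.
  have za2 : z - a2 != 0 by rewrite subr_eq0; apply/eqP => za; apply: (BA z Bz); rewrite za.
  have := ang_dir za2 (n2 z Bz) d2; rewrite -!addrA -!opprD addrA -/(N z).
  move: d0 => /has_dirP[x1 y1] /has_dirP[x2 y2].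
  have l0 : enorm (z - p) != 0 by rewrite gt_eqF// enorm_gt0.
  have c : cos (u - N z) = cos u by apply: (mulfI l0); rewrite -x1 -x2.
  have s : sin (u - N z) = sin u by apply: (mulfI l0); rewrite -y1 -y2.
  by rewrite -[N z](subKr u) cosB c s -!expr2 cos2Dsin2.
have Ncst := connected_cos1_cst cB cN N1.
(* [N] has no value at [p], where [z - p] vanishes. Angles do not change under scaling, so on the
   ray of direction [u] the vector [z - p] may be replaced by [e u], which gives an expression
   continuous down to [s = 0]. *)
pose F u s := ang (e u) (s *: e u + (p - a1)) + winding (p + s *: e u) a1 S +
  ang (s *: e u + (p - a2)) (e u).
have e0 u : e u != 0.
  rewrite -sqn_eq0; have := sqn_polar 1 u; rewrite scale1r expr1n /e => ->.
  by rewrite oner_eq0.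
have angZl v w s : 0 < s -> ang (s *: v) w = ang v w.
  move=> s0; rewrite /ang; congr (2 * atan _).
  have -> : crossp (s *: v) w = s * crossp v w.
    by rewrite /crossp -[(s *: v).1]/(s * v.1) -[(s *: v).2]/(s * v.2); ring.
  have -> : dotp (s *: v) w = s * dotp v w.
    by rewrite /dotp -[(s *: v).1]/(s * v.1) -[(s *: v).2]/(s * v.2); ring.
  rewrite enormZ ?ltW//.
  by rewrite -(mulrA s (enorm v)) -mulrDr invfM mulrACA divff ?mul1r// gt_eqF.
have angZr v w s : 0 < s -> ang v (s *: w) = ang v w.
  move=> s0; have sw : forall v w, ang v w = - ang w v.
    move=> v' w'; rewrite /ang; have -> : crossp v' w' = - crossp w' v' by rewrite /crossp; ring.
    have -> : enorm v' * enorm w' + dotp v' w' = enorm w' * enorm v' + dotp w' v'.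
      by rewrite /dotp; ring.
    by rewrite mulNr atanN mulrN.
  by rewrite sw angZl// -sw.
have FN u s : 0 < s -> F u s = N (p + s *: e u).
  move=> s0; rewrite /F /N.
  have -> : p + s *: e u - p = s *: e u by rewrite addrC addKr.
  have E a : p + s *: e u - a = s *: e u + (p - a) by rewrite addrCA addrA.
  by rewrite !E angZl// angZr.
have limF u : u = t + h \/ u = t - h -> not_opposite (e u) (p - a1) ->
    not_opposite (p - a2) (e u) -> forall w, B w ->
    ang (e u) (p - a1) + winding p a1 S + ang (p - a2) (e u) = N w.
  move=> ub o1 o2 w Bw.
  have cs c : {for (0 : R), continuous (fun s : R => s *: e u + c)}.
    by apply: cvgD; [apply: cvgZr_tmp; exact: cvg_id|exact: cvg_cst].
  have F0 : F u 0 = ang (e u) (p - a1) + winding p a1 S + ang (p - a2) (e u).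
    by rewrite /F !scale0r !add0r addr0.
  rewrite -F0; apply: (@continuous_right_cst _ _ sigma) => //; last first.
    by move=> s s0 ss; rewrite FN//; apply: Ncst => //; exact: Bb.
  apply: cvgD; first apply: cvgD.
  - apply: (@ang_continuous _ (fun=> e u) (fun s : R => s *: e u + (p - a1))).
    + exact: cvg_cst.
    + exact: cs.
    + by rewrite scale0r add0r.
  - apply: (@continuous_comp _ _ _ (fun s : R => p + s *: e u) (fun z => winding z a1 S)).
      by apply: cvgD; [exact: cvg_cst|apply: cvgZr_tmp; exact: cvg_id].
    by rewrite scale0r addr0; exact: winding_cont pS pA.
  - apply: (@ang_continuous _ (fun s : R => s *: e u + (p - a2)) (fun=> e u)).
    + exact: cs.
    + exact: cvg_cst.
    + by rewrite scale0r add0r.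
have eN u : has_dir (p - (p + sigma *: e u)) (u + pi) /\ has_dir (p - (p + sigma *: e u)) (u - pi).
  have -> : p - (p + sigma *: e u) = sigma *: ((- cos u, - sin u) : plane).
    by rewrite opprD addrA subrr add0r -scalerN.
  split.
    by rewrite -cosDpi -sinDpi; exact/has_dir_scale/ltW.
  have -> : - cos u = cos (u - pi) by rewrite cosB cospi sinpi mulr0 addr0 mulrN1.
  have -> : - sin u = sin (u - pi) by rewrite sinB cospi sinpi mulr0 subr0 mulrN1.
  exact/has_dir_scale/ltW.
have dire u : has_dir (e u) u by have := has_dir_scale u ler01; rewrite scale1r.
have pa10 : p - a1 != 0 by rewrite subr_eq0; apply/eqP => pa; apply: pA; rewrite pa.
have pa20 : p - a2 != 0 by rewrite subr_eq0; apply/eqP => pa; apply: pA; rewrite pa.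
have pi0 : 0 < pi :> R by exact: pi_gt0.
(* The two corner angles add up to [2 h - 2 pi] in the direction [t + h] and to [2 h] in the
   direction [t - h], a difference of 2 pi, whereas the path contributes the same in both limits.
   The bound on [h] keeps [3 h - pi] in the range of [ang]. *)
have [|o1 A1] := ang_polar (e0 (t + h)) pa10 (dire _) (eN t).1.
  by apply/andP; split; move: h0 hpi pi0; clear; lra.
have [|o2 A2] := ang_polar pa20 (e0 (t + h)) (eN (t + 2 * h)).2 (dire _).
  by apply/andP; split; move: h0 hpi pi0; clear; lra.
have [|o3 A3] := ang_polar (e0 (t - h)) pa10 (dire _) (eN t).2.
  by apply/andP; split; move: h0 hpi pi0; clear; lra.
have [|o4 A4] := ang_polar pa20 (e0 (t - h)) (eN (t + 2 * h)).2 (dire _).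
  by apply/andP; split; move: h0 hpi pi0; clear; lra.
have Bw : B (p + sigma *: e (t + h)) by apply: Bb => //; left.
have := limF _ (or_introl erefl) o1 o2 _ Bw.
rewrite -(limF _ (or_intror erefl) o3 o4 _ Bw) A1 A2 A3 A4.
by move: (winding _ _ _) pi0 => W; clear; lra.
Qed.

End Winding.

(** * Critical points *)

Section CriticalPoints.
Variable R : realType.
Local Notation plane := (R * R)%type.
Implicit Types (p q v z w : plane) (D E Omega V : set plane) (f U : plane -> R).

Section Taylor.
Variables (D : set plane) (a b : nat -> plane -> R).
Hypothesis ab : forall k, hol D (a k) (b k) (a k.+1) (b k.+1).

Lemma hol_is_derive_re k p v : nbhs p D ->
  is_derive p v (a k) (v.1 * a k.+1 p - v.2 * b k.+1 p).
Proof.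
move=> pD; have Dp := nbhs_singleton pD; have h := ab k; have h1 := ab k.+1.
have cN : {for p, continuous (fun z => - b k.+1 z)} by apply: cvgN; exact: hol_im_cont h1 p Dp.
have := C1_is_derive v pD (hol_re_x h) (hol_re_y h) (hol_re_cont h1 Dp) cN.
by rewrite mulrN.
Qed.

Lemma hol_is_derive_im k p v : nbhs p D ->
  is_derive p v (b k) (v.1 * b k.+1 p + v.2 * a k.+1 p).
Proof.
move=> pD; have Dp := nbhs_singleton pD; have h := ab k; have h1 := ab k.+1.
exact: C1_is_derive v pD (hol_im_x h) (hol_im_y h) (hol_im_cont h1 Dp) (hol_re_cont h1 Dp).
Qed.

(** Induction on [n], for all derivatives at once: integrating the bound for the next derivative
    along the segment from [p], in the form of the mean value theorem, gains one power of the
    distance. *)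
Lemma taylor_bound p (r : R) : 0 < r -> open D -> (forall z, sqn (z - p) <= r -> D z) ->
  (forall k, a k p = 0) -> (forall k, b k p = 0) ->
  forall n k, exists2 C, 0 <= C & forall z, sqn (z - p) <= r ->
    `|a k z| <= C * enorm (z - p) ^+ n /\ `|b k z| <= C * enorm (z - p) ^+ n.
Proof.
move=> r0 oD rD a0 b0; elim=> [|n IH] k.
  have [C1 H1] := disc_bound (ltW r0) (hol_re_cont (ab k)) rD.
  have [C2 H2] := disc_bound (ltW r0) (hol_im_cont (ab k)) rD.
  exists (`|C1| + `|C2|); first by rewrite addr_ge0.
  move=> z zr; rewrite expr0 mulr1; split.
    by rewrite (le_trans (H1 z zr))// (le_trans (ler_norm _))// lerDl.
  by rewrite (le_trans (H2 z zr))// (le_trans (ler_norm _))// lerDr.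
have [C C0 H] := IH k.+1; exists (2 * C); first by rewrite mulr_ge0.
move=> z zr; pose v := z - p.
have sub (t : R) : 0 <= t <= 1 -> sqn (p + t *: v - p) <= r /\ enorm (p + t *: v - p) <= enorm v.
  move=> /andP[t0 t1].
  have E : sqn (p + t *: v - p) = t ^+ 2 * sqn v by rewrite addrC addKr sqnZ.
  have le : sqn (p + t *: v - p) <= sqn v by rewrite E ler_piMl ?sqn_ge0// expr_le1.
  by split; [exact: le_trans zr|rewrite !enorm_sqn ler_sqrt// sqn_ge0].
have zE : z = p + v by rewrite /v subrKC.
have v1 : `|v.1| <= enorm v.
  by rewrite -sqrtr_sqr enorm_sqn ler_sqrt ?sqn_ge0// /sqn lerDl sqr_ge0.
have v2 : `|v.2| <= enorm v.
  by rewrite -sqrtr_sqr enorm_sqn ler_sqrt ?sqn_ge0// /sqn lerDr sqr_ge0.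
have bd (x y : R) q : sqn (q - p) <= r -> enorm (q - p) <= enorm v ->
    `|x| <= C * enorm (q - p) ^+ n -> `|y| <= C * enorm (q - p) ^+ n ->
    `|v.1| * `|x| + `|v.2| * `|y| <= 2 * C * enorm v ^+ n.+1.
  move=> qr qv xC yC.
  have en : C * enorm (q - p) ^+ n <= C * enorm v ^+ n.
    by rewrite ler_wpM2l// lerXn2r// nnegrE enorm_ge0.
  have -> : 2 * C * enorm v ^+ n.+1 = enorm v * (C * enorm v ^+ n) + enorm v * (C * enorm v ^+ n).
    by rewrite exprS; ring.
  by rewrite lerD// ler_pM// (le_trans _ en).
have nD q : sqn (q - p) <= r -> nbhs q D by move=> qr; apply: open_nbhs_nbhs; split=> //; exact: rD.
split.
  have [q Dq|t t01|t /andP[t0 t1]] := @line_MVT R [set q | sqn (q - p) <= r] (a k)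
      (fun q => v.1 * a k.+1 q - v.2 * b k.+1 q) p v.
  - exact/hol_is_derive_re/nD.
  - exact: (sub t t01).1.
  rewrite -zE a0 subr0 => ->.
  have [s1 s2] : sqn (p + t *: v - p) <= r /\ enorm (p + t *: v - p) <= enorm v.
    by apply: sub; rewrite !ltW.
  have [h1 h2] := H _ s1.
  by rewrite (le_trans (ler_normB _ _))// !normrM; exact: bd h1 h2.
have [q Dq|t t01|t /andP[t0 t1]] := @line_MVT R [set q | sqn (q - p) <= r] (b k)
      (fun q => v.1 * b k.+1 q + v.2 * a k.+1 q) p v.
- exact/hol_is_derive_im/nD.
- exact: (sub t t01).1.
rewrite -zE b0 subr0 => ->.
have [s1 s2] : sqn (p + t *: v - p) <= r /\ enorm (p + t *: v - p) <= enorm v.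
  by apply: sub; rewrite !ltW.
have [h1 h2] := H _ s1.
by rewrite (le_trans (ler_normD _ _))// !normrM; exact: bd h2 h1.
Qed.

Lemma all_derivatives_eq0 p : open D -> D p ->
  (forall k, a k p = 0) -> (forall k, b k p = 0) ->
  \forall z \near p, a 0%N z ^+ 2 + b 0%N z ^+ 2 = 0.
Proof.
move=> oD Dp a0 b0; have /nbhs_sqnP[r r0 rD] := open_nbhs_nbhs (conj oD Dp).
have r2 : 0 < r ^+ 2 / 2 by rewrite divr_gt0// exprn_gt0.
have rD' z : sqn (z - p) <= r ^+ 2 / 2 -> D z.
  by move=> zr; apply: rD; apply: le_lt_trans zr _; move: r2; lra.
have flat n (e : R) : 0 < e ->
    \forall z \near p, a 0%N z ^+ 2 + b 0%N z ^+ 2 <= e * sqn (z - p) ^+ n.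
  (* One order more than required, so that the constant [2 C^2] is absorbed by the extra factor
     [|z - p|^2], which is small near [p]. *)
  move=> e0; have [C C0 H] := taylor_bound r2 oD rD' a0 b0 n.+1 0%N.
  have m0 : 0 < 2 * C ^+ 2 + 1 by rewrite ltr_wpDl// mulr_ge0// sqr_ge0.
  have near1 (c : R) : 0 < c -> \forall z \near p, sqn (z - p) < c.
    move=> c0; apply: (@near_ltr _ _ (fun z => sqn (z - p))); first exact: sqn_continuous.
    by rewrite subrr sqn0.
  apply: filterS2 (near1 _ r2) (near1 _ (divr_gt0 e0 m0)) => z z1 z2.
  have [h1 h2] := H z (ltW z1).
  have sq (x : R) : `|x| <= C * enorm (z - p) ^+ n.+1 -> x ^+ 2 <= C ^+ 2 * sqn (z - p) ^+ n.+1.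
    move=> hx; rewrite -sqr_enorm -exprM mulnC exprM -exprMn -(real_normK (num_real x)).
    by rewrite lerXn2r// nnegrE// mulr_ge0// exprn_ge0// enorm_ge0.
  apply: le_trans (lerD (sq _ h1) (sq _ h2)) _.
  have -> : C ^+ 2 * sqn (z - p) ^+ n.+1 + C ^+ 2 * sqn (z - p) ^+ n.+1 =
    2 * C ^+ 2 * sqn (z - p) * sqn (z - p) ^+ n by rewrite [sqn _ ^+ n.+1]exprS; ring.
  rewrite ler_wpM2r ?exprn_ge0 ?sqn_ge0//.
  move: z2; rewrite ltr_pdivlMr// => /ltW; apply: le_trans.
  by rewrite mulrC ler_wpM2l ?sqn_ge0// lerDl.
have H := flat_hol_eq0 r2 rD' (ab 0%N) (ab 1%N) flat.
apply/nbhs_sqnP; exists (r / 2); first by rewrite divr_gt0.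
move=> z zr; apply: H; apply: lt_le_trans zr _; rewrite expr_div_n (_ : 2 ^+ 2 = 4); last by rewrite expr2; ring.
by move: r2; move: (r ^+ 2) => X; lra.
Qed.

End Taylor.

(** The sign of the first nonvanishing derivative passes down to the function through repeated use
    of the mean value theorem. *)
Lemma taylor_sign (phi : nat -> R -> R) N (d : R) : 0 < d ->
  (forall j s, (j < N)%N -> 0 <= s < d -> is_derive s 1 (phi j) (phi j.+1 s)) ->
  (forall j, (j < N)%N -> phi j 0 = 0) -> 0 < phi N 0 -> {for 0, continuous (phi N)} ->
  exists2 e : R, 0 < e & forall s, 0 < s -> s < e -> 0 < phi 0%N s.
Proof.
move=> d0; elim: N phi => [|N IH] phi dphi z0 pos cN.
  have /near_right0P[e e0 H] : \forall s \near (0 : R)^'+, 0 < phi 0%N s.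
    by apply: cvg_within; exact: near_gtr cN pos.
  by exists e.
have [j s jN|j jN|//|//|e e0 H] := IH (fun j => phi j.+1).
- exact: dphi.
- exact: z0.
exists (Num.min e d); first by rewrite lt_min e0.
move=> s s0; rewrite lt_min => /andP[se sd].
have cphi : {within `[0, s], continuous (phi 0%N)}.
  apply: derivable_within_continuous => x; rewrite in_itv/= => /andP[x0 xs].
  by apply: (is_derive_derivable (dphi 0%N x isT _)); rewrite x0 (le_lt_trans xs).
have [x|x] := @MVT R (phi 0%N) (phi 1%N) 0 s s0 _ cphi.
  rewrite in_itv/= => /andP[x0 xs]; apply: dphi => //.
  by rewrite (ltW x0) (lt_trans xs).
rewrite in_itv/= => /andP[x0 xs]; rewrite z0// !subr0 => ->.
by rewrite mulr_gt0// H// (lt_trans xs).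
Qed.

(** The connected set [F] lies in one of the two pieces of a separation of [X]; the other piece
    misses [F], hence is empty. *)
Lemma connected_core (X F : set plane) : open X -> connected F -> F `<=` X -> F !=set0 ->
  (forall V, open V -> V `<=` X -> open (X `\` V) -> (forall z, V z -> ~ F z) -> V = set0) ->
  connected X.
Proof.
move=> oX cF FX F0 H B [v Bv] [C oC BE] [C' cC BE'].
have oB : open B by rewrite BE; exact: openI.
have oXB : open (X `\` B).
  have -> : X `\` B = X `&` ~` C'.
    apply/seteqP; split=> z [Xz nz]; split=> //; move=> h; apply: nz.
      by rewrite BE'.
    by move: h; rewrite BE' => -[].
  by apply: openI => //; exact: closed_openC.
have BX : B `<=` X by rewrite BE => z [].
have [[z [Fz Bz]]|nF] := pselect (exists z, F z /\ B z); last first.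
  have E : B = set0 by apply: H => // z Bz Fz; apply: nF; exists z.
  by move: Bv; rewrite E.
have FB : F `&` B = F.
  apply: cF; first by exists z.
    by exists B.
  exists C' => //; apply/seteqP; split=> w [Fw]; first by rewrite BE' => -[].
  by move=> Cw; split=> //; rewrite BE'; split=> //; exact: FX.
have E : X `\` B = set0.
  apply: H; [exact: oXB|by move=> w []|by rewrite setDD; exact: openI|].
  by move=> w [_ nB] Fw; apply: nB; move: Fw; rewrite -FB => -[].
apply/seteqP; split=> // w Xw; apply: contrapT => nB.
by have : (X `\` B) w by []; rewrite E.
Qed.

End CriticalPoints.

(** * Connectedness of sub- and superlevel sets; absence of critical points *)

Section LevelGradient.
Variable R : realType.
Local Notation plane := (R * R)%type.
Implicit Types (p q v z w : plane) (D E V : set plane).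
Variables (Omega : set plane) (U : plane -> R) (k c0 : R).
Hypotheses (hO : unbounded_domain Omega) (hF : smooth_jordan_curve (frontier Omega)).
Hypotheses (sU : smooth_on Omega U) (lU : forall z, Omega z -> laplacian U z = 0).
Hypotheses (cU : {within closure Omega, continuous U}).
Hypotheses (Uc0 : forall r, frontier Omega r -> U r = c0) (k0 : 0 < k).
Hypothesis (gU : exists M K, forall z, Omega z -> K <= sqn z -> `|U z + k * ln (sqn z)| <= M).
Hypothesis (ncU : ~ exists c, forall r, Omega r -> U r = c).

Let oO : open Omega. Proof. by case: hO. Qed.
Let hU : harmonic Omega U. Proof. exact: potential_harmonic. Qed.
Let frO x : frontier Omega x <-> closure Omega x /\ ~ Omega x.
Proof. exact: frontier_open. Qed.

Lemma far_in_domain : exists r, 0 < r /\ forall z, r < sqn z -> Omega z.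
Proof.
have [_ cF _] := jordan_curve_facts hF; have [r [r0 rP]] := compact_sqn_bounded 0 cF.
exists (r + 1); split; first by rewrite ltr_wpDl.
move=> z zr; apply: (@exterior_sub _ Omega 0 r) => //; first by case: hO.
by rewrite /= subr0; apply: lt_trans zr; rewrite ltrDl.
Qed.

(** Counting the complement of [Omega] as above makes this set open across the frontier when
    [t < c0], since [U] tends to [c0] there. *)
Let above t := [set z | ~ Omega z \/ t < U z].
Let below t := [set z | Omega z /\ U z < t].

Lemma open_below t : open (below t).
Proof.
rewrite openE => z [Oz zt]; apply: filterI; first exact: open_nbhs_nbhs.
exact: near_ltr (harmonic_cont hU Oz) zt.
Qed.

Lemma open_above t : t < c0 -> open (above t).
Proof.
move=> tc; rewrite openE => z [nz|zt]; last first.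
  have [Oz|nz] := pselect (Omega z).
    by apply: filterS (near_gtr (harmonic_cont hU Oz) zt) => w wt; right.
  have [cz|ncz] := pselect (closure Omega z).
    have fz : frontier Omega z by apply/frO.
    have d0 : 0 < U z - t by rewrite subr_gt0.
    apply: filterS (closure_near cU (@subset_refl _ Omega) cz d0) => w H.
    have [/H|] := pselect (Omega w); last by left.
    by rewrite ltr_norml => /andP[h _]; right; move: h; lra.
  have : nbhs z (~` closure Omega) by apply: open_nbhs_nbhs; split=> //; exact/closed_openC/closed_closure.
  by apply: filterS => w nw; left => Ow; apply/nw/subset_closure.
have [cz|ncz] := pselect (closure Omega z).
  have fz : frontier Omega z by apply/frO.
  have d0 : 0 < c0 - t by rewrite subr_gt0.
  apply: filterS (closure_near cU (@subset_refl _ Omega) cz d0) => w H.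
  have [/H|] := pselect (Omega w); last by left.
  by rewrite (Uc0 fz) ltr_norml => /andP[h _]; right; move: h; lra.
have : nbhs z (~` closure Omega) by apply: open_nbhs_nbhs; split=> //; exact/closed_openC/closed_closure.
by apply: filterS => w nw; left => Ow; apply/nw/subset_closure.
Qed.

(* Every component of the superlevel set reaches the frontier. *)
Lemma connected_above t : t < c0 -> connected (above t).
Proof.
move=> tc; have [F0 _ conF] := jordan_curve_facts hF.
have oA := open_above tc.
apply: (connected_core oA conF _ F0) => [z /frO[_ nz]|V oV VA oAV VF]; first by left.
have bdV x : closure V x -> ~ V x -> Omega x /\ U x <= t.
  move=> cx nx; suff nA : ~ above t x.
    split; first by apply: contrapT => nO; apply: nA; left.
    by rewrite leNgt; apply/negP => xt; apply: nA; right.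
  move=> Ax; have N : nbhs x (above t `\` V) by apply: open_nbhs_nbhs.
  by have [z [Vz [_ ]]] := cx _ N; exact.
(* On the boundary of the part of [V] in [Omega] one has [U <= t], and [U] tends to minus infinity
   at infinity, so [U <= t] inside as well, against [V] lying in [above t]. *)
have VO z : V z -> ~ Omega z.
  move=> Vz Oz; pose W := V `&` Omega.
  have oW : open W by exact: openI.
  have WO : W `<=` Omega by move=> w [].
  have : U z - t <= 0.
    apply: (@maximum_principle _ W (fun z => U z - t)) => //.
    - exact/harmonic_subharmonic/harmonicB/harmonic_cst/(harmonic_sub WO).
    - move=> x cx nx e e0.
      have cO : closure Omega x by exact: closure_subset cx.
      have nV : ~ V x.
        move=> Vx; apply: (VF x Vx); apply/frO; split=> // Ox; exact: nx.
      have [Ox xt] : Omega x /\ U x <= t.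
        by apply: bdV => //; apply: closure_subset cx => w [].
      have xe : U x < t + e by apply: le_lt_trans xt _; rewrite ltrDl.
      apply: filterS (near_ltr (harmonic_cont hU Ox) xe) => w h _.
      by rewrite ltrBlDl.
    - move=> e e0; have [r rP] := log_growth_lt k0 gU (t + e).
      by exists r => w [_ Ow] /(rP w Ow); rewrite ltrBlDl.
  rewrite subr_le0 leNgt => /negP; apply.
  by have [/(_ Oz)|] := VA z Vz.
(* [V] avoids the open set [Omega], while its boundary points would lie in [Omega]: it is open and
   closed in the plane. *)
apply/seteqP; split=> // v Vv; have cV : V = [set: plane].
  have cT : connected [set: plane] by apply: (@star_connected _ _ 0).
  apply: open_closed_connected => //; [exact: openT|by exists v|].
  move=> x _ cx; apply: contrapT => nx; have [Ox _] := bdV x cx nx.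
  have [w [Vw Ow]] := cx _ (open_nbhs_nbhs (conj oO Ox)).
  exact: VO Vw Ow.
have [r [r0 rP]] := far_in_domain.
have Oq : Omega (r + 1, 0) by apply: rP; rewrite /sqn/= expr0n addr0 expr2; move: r0; nra.
by apply: (VO (r + 1, 0)) => //; rewrite cV.
Qed.

(** Every component reaches infinity: a piece disjoint from the exterior of a large disc would be
    bounded with [U >= t] on its boundary, and the maximum principle for [t - U] would contradict
    [U < t]. *)
Lemma connected_below t : t <= c0 -> connected (below t).
Proof.
move=> tc; have [r1 [r10 r1P]] := far_in_domain.
have [r2 r2P] := log_growth_lt k0 gU t.
pose r := Num.max r1 r2; pose F := [set z : plane | r < sqn (z - 0)].
have r0 : 0 <= r by rewrite le_max (ltW r10).
have FX : F `<=` below t.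
  move=> z; rewrite /F/= subr0 /r gt_max => /andP[z1 z2]; have Oz := r1P z z1.
  by split=> //; apply: r2P => //; exact: ltW.
apply: (@connected_core _ (below t) F _ _ FX).
- exact: open_below.
- exact: exterior_connected.
- exists (r + 1, 0); rewrite /F/= subr0 /sqn/= expr0n addr0 expr2; move: r0; nra.
move=> V oV VB oBV VF; apply/seteqP; split=> // v Vv; exfalso.
have VO : V `<=` Omega by move=> z /VB[].
have : t - U v <= 0.
  apply: (@maximum_principle _ V (fun z => t - U z)) => //.
  - exact/harmonic_subharmonic/harmonicB/(harmonic_sub VO)/hU/harmonic_cst.
  - move=> x cx nx e e0.
    have cO : closure Omega x by exact: closure_subset cx.
    have nB : ~ below t x.
      move=> Bx; have N : nbhs x (below t `\` V) by apply: open_nbhs_nbhs.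
      by have [z [Vz [_ ]]] := cx _ N; exact.
    have tx : t <= U x.
      rewrite leNgt; apply/negP => xt; apply: nB; split=> //.
      apply: contrapT => nx'; have fx : frontier Omega x by apply/frO.
      by move: xt; rewrite (Uc0 fx) ltNge tc.
    apply: filterS (closure_near cU VO cx e0) => w h /h.
    by rewrite ltr_norml => /andP[h1 _]; move: h1 tx; lra.
  - move=> e e0; exists (r + 1) => w Vw wr; exfalso; apply: (VF w Vw).
    by rewrite /F/= subr0; apply: lt_le_trans wr; rewrite ltrDl.
by rewrite subr_le0 leNgt; have [_ ->] := VB v Vv.
Qed.

Let a := cgre U.
Let b := cgim U.

Let ab n : hol Omega (a n) (b n) (a n.+1) (b n.+1).
Proof. exact: hol_cgrad. Qed.

Let UxE z : pderiv [:: false] U z = a 0 z. Proof. by []. Qed.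
Let UyE z : pderiv [:: true] U z = - b 0 z. Proof. by rewrite /b /cgim /= opprK. Qed.

(** With [f = U_x - i U_y], the derivative of order [j > 0] of [U] along the ray of direction [t] is
    the real part of [exp (i j t)] times the derivative of order [j - 1] of [f]. The factor [sg]
    treats both signs at once. *)
Let phi (sg : R) p t (j : nat) (s : R) :=
  let q := p + s *: ((cos t, sin t) : plane) in
  sg * (if j is j'.+1 then cos (j%:R * t) * a j' q - sin (j%:R * t) * b j' q else U q - U p).

Lemma ray_derive sg p t j s : Omega (p + s *: ((cos t, sin t) : plane)) ->
  is_derive s 1 (phi sg p t j) (phi sg p t j.+1 s).
Proof.
set e : plane := (cos t, sin t) => Oq; have nq := open_nbhs_nbhs (conj oO Oq).
apply: (@is_deriveZ _ _ _ _ sg).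
case: j => [|j].
  have h0 := ab 0.
  have cN : {for p + s *: e, continuous (fun z => - b 0 z)}.
    by apply: cvgN; exact: hol_im_cont h0 _ Oq.
  have dx : pdif Omega false U (a 0) by exact: (@smooth_pdif _ _ _ [::] false sU).
  have dy : pdif Omega true U (fun z => - b 0 z).
    by move=> z Oz; apply: (is_derive_eq (@smooth_pdif _ _ _ [::] true sU z Oz)); rewrite -UyE.
  have H := is_derive_line (C1_is_derive e nq dx dy (hol_re_cont h0 Oq) cN).
  have := is_deriveB H (is_derive_cst (U p) s 1).
  by move=> /is_derive_eq; apply; rewrite subr0 mul1r mulrN.
have H1 := is_derive_line (hol_is_derive_re ab j e nq).
have H2 := is_derive_line (hol_is_derive_im ab j e nq).
have := is_deriveB (@is_deriveZ _ _ _ _ (cos (j.+1%:R * t)) _ _ _ H1)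
  (@is_deriveZ _ _ _ _ (sin (j.+1%:R * t)) _ _ _ H2).
have -> : j.+2%:R * t = j.+1%:R * t + t by rewrite -natr1 mulrDl mul1r.
move=> /is_derive_eq; apply; rewrite cosD sinD /GRing.scale /=; ring.
Qed.

Lemma ray_sign sg p t n : Omega p ->
  (forall j, (j < n)%N -> a j p = 0 /\ b j p = 0) ->
  0 < sg * (cos (n.+1%:R * t) * a n p - sin (n.+1%:R * t) * b n p) ->
  exists2 e : R, 0 < e & forall s, 0 < s -> s < e ->
    0 < sg * (U (p + s *: ((cos t, sin t) : plane)) - U p).
Proof.
move=> Op z0 pos.
have [r /= r0 rP] : exists2 r : R, 0 < r & forall s : R, `|s| < r ->
    Omega (p + s *: ((cos t, sin t) : plane)).
  have := near_line ((cos t, sin t) : plane) (open_nbhs_nbhs (conj oO Op)).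
  move=> /nbhs_ballP[r /= r0 rP]; exists r => // s sr.
  by apply: rP; rewrite -ball_normE /ball_/= sub0r normrN.
have p0 : p + 0 *: ((cos t, sin t) : plane) = p by rewrite scale0r addr0.
apply: (@taylor_sign _ (phi sg p t) n.+1 r r0).
- by move=> j s _ /andP[s0 sr]; apply/ray_derive/rP; rewrite ger0_norm.
- move=> [|j] jn; rewrite /phi p0; first by rewrite subrr mulr0.
  by have [-> ->] := z0 j jn; rewrite !mulr0 subrr mulr0.
- by rewrite /phi p0.
- apply: differentiable_continuous; apply/derivable1_diffP.
  by apply: (is_derive_derivable (ray_derive _ _ _)); rewrite p0.
Qed.

(** If all derivatives vanished at [p], [U_x - i U_y] would vanish near [p], then on [Omega] by
    unique continuation, and [U] would be constant. *)
Lemma derivative_order p : Omega p -> exists n, (a n p, b n p) <> (0, 0) /\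
  forall j, (j < n)%N -> a j p = 0 /\ b j p = 0.
Proof.
move=> Op; have [n0 H0] : exists n, (a n p, b n p) != (0, 0).
  apply: contrapT => H; apply: ncU.
  have z0 n : a n p = 0 /\ b n p = 0.
    have : (a n p, b n p) == (0, 0).
      by apply: contrapT => /negP h; apply: H; exists n.
    by move=> /eqP[-> ->].
  have near0 := all_derivatives_eq0 ab oO Op (fun n => (z0 n).1) (fun n => (z0 n).2).
  have cO : connected Omega by case: hO.
  have all0 := hol_unique_continuation oO cO (ab 0) (ab 1) (ex_intro2 _ _ p Op near0).
  have ab0 z : Omega z -> a 0 z = 0 /\ b 0 z = 0.
    move=> /all0/eqP; rewrite paddr_eq0 ?sqr_ge0// !sqrf_eq0 => /andP[/eqP-> /eqP->].
    by [].
  exists (U p) => r Or; apply: (grad0_cst oO cO) => // z Oz.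
    apply: (is_derive_eq (@smooth_pdif _ _ _ [::] false sU z Oz)).
    by rewrite UxE; case: (ab0 z Oz).
  apply: (is_derive_eq (@smooth_pdif _ _ _ [::] true sU z Oz)).
  by rewrite UyE; have [_ ->] := ab0 z Oz; rewrite oppr0.
have ex : exists n, (a n p, b n p) != (0, 0) by exists n0.
exists (ex_minn ex); case: ex_minnP => n /eqP nz min; split=> // j jn.
have : (a j p, b j p) == (0, 0).
  by apply: contrapT => /negP /min; rewrite leqNgt jn.
by move=> /eqP[-> ->].
Qed.

(* At a critical point of order [n], the sign of [U - U p] alternates in [2 n + 2] sectors,
   while the super- and the sublevel set are both connected. *)
Lemma no_critical_point p : Omega p -> U p < c0 -> a 0 p ^+ 2 + b 0 p ^+ 2 != 0.
Proof.
move=> Op pc; apply/eqP => S0; have [n [nz z0]] := derivative_order Op.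
have n0 : (0 < n)%N.
  rewrite lt0n; apply/eqP => nE; apply: nz; move: S0 => /eqP; rewrite nE.
  by rewrite paddr_eq0 ?sqr_ge0// !sqrf_eq0 => /andP[/eqP -> /eqP ->].
have [om omE] := polar_sqn (a n p, b n p).
set rho := Num.sqrt _ in omE.
have rho0 : 0 < rho.
  by rewrite sqrtr_gt0 sqn_gt0; apply/eqP.
have [aE bE] : a n p = rho * cos om /\ b n p = rho * sin om.
  by split; [have := congr1 fst omE|have := congr1 snd omE].
pose N : R := n.+1%:R; have N0 : 0 < N by rewrite ltr0Sn.
have N2 : 2 <= N by rewrite /N ler_nat.
(* The leading term in the direction [u] is [rho cos (N u + om)]: it is largest for [u = t] and
   [u = t + 2 h], and smallest for [u = t + h] and [u = t - h]. As the point is critical, [N >= 2],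
   so that [h <= pi / 2]. *)
pose t := - om / N; pose h := pi / N.
have val u : cos (N * u) * a n p - sin (N * u) * b n p = rho * cos (N * u + om).
  by rewrite aE bE cosD; ring.
have Nt : N * t = - om by rewrite /t mulrC divfK// gt_eqF.
have Nh : N * h = pi by rewrite /h mulrC divfK// gt_eqF.
have [e1 e10 H1] : exists2 e : R, 0 < e & forall s, 0 < s -> s < e ->
    0 < 1 * (U (p + s *: ((cos t, sin t) : plane)) - U p).
  apply: (ray_sign Op z0); rewrite val Nt addNr cos0 mulr1 mul1r//.
have [e2 e20 H2] : exists2 e : R, 0 < e & forall s, 0 < s -> s < e ->
    0 < 1 * (U (p + s *: ((cos (t + 2 * h), sin (t + 2 * h)) : plane)) - U p).
  apply: (ray_sign Op z0); rewrite val.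
  have -> : N * (t + 2 * h) + om = N * t + om + 2 * (N * h) by ring.
  by rewrite Nt Nh addNr add0r (mulr_natl pi 2) cos2pi mulr1 mul1r.
have [e3 e30 H3] : exists2 e : R, 0 < e & forall s, 0 < s -> s < e ->
    0 < -1 * (U (p + s *: ((cos (t + h), sin (t + h)) : plane)) - U p).
  apply: (ray_sign Op z0); rewrite val.
  rewrite mulrDr Nt Nh addrAC addNr add0r.
  by rewrite cospi mulrN1 mulrNN mul1r.
have [e4 e40 H4] : exists2 e : R, 0 < e & forall s, 0 < s -> s < e ->
    0 < -1 * (U (p + s *: ((cos (t - h), sin (t - h)) : plane)) - U p).
  apply: (ray_sign Op z0); rewrite val.
  rewrite mulrBr Nt Nh addrAC addNr add0r.
  by rewrite cosN cospi mulrN1 mulrNN mul1r.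
have /nbhs_sqnP[r r0 rP] := open_nbhs_nbhs (conj oO Op).
pose m := Num.min r (Num.min (Num.min e1 e2) (Num.min e3 e4)).
have m0 : 0 < m by rewrite !lt_min r0 e10 e20 e30 e40.
pose sg := m / 2.
have sgm : sg < m by rewrite ltr_pdivrMr// ltr_pMr// ltr1n.
have OU u s : 0 < s -> s <= sg -> Omega (p + s *: ((cos u, sin u) : plane)).
  move=> s0 ss; apply: rP.
  have -> : p + s *: ((cos u, sin u) : plane) - p = s *: ((cos u, sin u) : plane).
    by rewrite addrC addKr.
  rewrite sqn_polar ltr_pXn2r ?nnegrE ?(ltW s0) ?(ltW r0)//.
  by apply: le_lt_trans ss (lt_le_trans sgm _); rewrite /m ge_min lexx.
apply: (@no_crossing _ (above (U p)) (below (U p)) p t h sg).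
- exact: open_above.
- exact: connected_above.
- exact: connected_below (ltW pc).
- by move=> z [nz'|zt] [Oz zt']; [exact: nz'|move: (lt_trans zt zt'); rewrite ltxx].
- by move=> [|]; [exact|rewrite ltxx].
- by move=> [_]; rewrite ltxx.
- by rewrite divr_gt0// pi_gt0.
- by rewrite /h ler_pM2l ?pi_gt0// lef_pV2// posrE.
- by rewrite divr_gt0.
move=> s s0 ss; have sm := le_lt_trans ss sgm.
have [s1 [s2 [s3 s4]]] : s < e1 /\ s < e2 /\ s < e3 /\ s < e4.
  by move: sm; rewrite /m !lt_min => /andP[_ /andP[/andP[-> ->] /andP[-> ->]]].
split.
- by right; have := H1 s s0 s1; rewrite mul1r subr_gt0.
- by right; have := H2 s s0 s2; rewrite mul1r subr_gt0.
- by split; [exact: OU|have := H3 s s0 s3; rewrite mulN1r oppr_gt0 subr_lt0].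
- by split; [exact: OU|have := H4 s s0 s4; rewrite mulN1r oppr_gt0 subr_lt0].
Qed.

End LevelGradient.

(** * Constant gradient on a level curve *)

Section ConstantGradient.
Variable R : realType.
Local Notation plane := (R * R)%type.
Implicit Types (p q v z w : plane) (D E V : set plane).
Variables (Omega : set plane) (U : plane -> R) (k c0 : R).
Hypotheses (hO : unbounded_domain Omega) (hF : smooth_jordan_curve (frontier Omega)).
Hypotheses (sU : smooth_on Omega U) (lU : forall z, Omega z -> laplacian U z = 0).
Hypotheses (cU : {within closure Omega, continuous U}).
Hypotheses (Uc0 : forall r, frontier Omega r -> U r = c0) (k0 : 0 < k).
Hypothesis (gU : exists M K, forall z, Omega z -> K <= sqn z -> `|U z + k * ln (sqn z)| <= M).
Hypothesis (ncU : ~ exists c, forall r, Omega r -> U r = c).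

Let oO : open Omega. Proof. by case: hO. Qed.
Let hU : harmonic Omega U. Proof. exact: potential_harmonic. Qed.

Let a := cgre U.
Let b := cgim U.
Let S z := a 0 z ^+ 2 + b 0 z ^+ 2.
(* For [U = - k ln |z|^2] this is constant. *)
Let P z := ln (S z + 0) - k^-1 * U z.

Let ab n : hol Omega (a n) (b n) (a n.+1) (b n.+1).
Proof. exact: hol_cgrad. Qed.

Let UxE z : pderiv [:: false] U z = a 0 z. Proof. by []. Qed.
Let UyE z : pderiv [:: true] U z = - b 0 z. Proof. by rewrite /b /cgim /= opprK. Qed.

(** [P] is [ln (S |z|^2)] minus [(U + k ln |z|^2) / k]. The first term is controlled by the gradient
    estimate at infinity, the second by the growth hypothesis. *)
Lemma P_bounded : exists N r, forall z, Omega z -> r <= sqn z -> `|P z| <= N.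
Proof.
have [r1 [r10 r1P]] := far_in_domain hO hF.
have [M [K H]] := gU.
(* Since [r / 2 >= 1], its square is at least [r / 2], which exceeds [r1] and [K]; so [E0] lies in
   [Omega] and in the range of the growth estimate. *)
pose r := 2 * (r1 + `|K| + 1).
have r0 : 0 < r by rewrite mulr_gt0// addr_gt0// ltr_wpDr.
pose E0 := [set z : plane | (r / 2) ^+ 2 < sqn z].
have big z : E0 z -> Omega z /\ K <= sqn z.
  have x1 : 1 <= r / 2 by rewrite /r mulrC mulKf// lerDr addr_ge0// ltW.
  have x2 : r / 2 <= (r / 2) ^+ 2 by rewrite expr2 ler_peMl// (le_trans ler01).
  have rE : r / 2 = r1 + `|K| + 1 by rewrite /r mulrC mulKf.
  move=> /(le_lt_trans x2); rewrite rE => zr.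
  have := normr_ge0 K; have := ler_norm K => K1 K2; split.
    by apply: r1P; move: zr K2; lra.
  by move: zr K1 r10; lra.
have hE : harmonic_on E0 U.
  split; last by move=> z /big[Oz _]; exact: lU.
  by move=> s s2 z /big[Oz _]; exact: sU.
have bE z : E0 z -> `|U z + k * ln (sqn z)| <= M by move=> /big[]; exact: H.
have [s sP] := grad_at_infinity r0 k0 hE bE.
pose N1 := `|ln (2 * k ^+ 2)| + `|ln (7 * k ^+ 2)|.
exists (N1 + k^-1 * M), (Num.max s 1) => z Oz; rewrite ge_max => /andP[/sP[Ez zb] z1].
have z0 : 0 < sqn z by exact: lt_le_trans z1.
have k2 : 0 < k ^+ 2 by rewrite exprn_gt0.
have SE : pderiv [:: false] U z ^+ 2 + pderiv [:: true] U z ^+ 2 = S z.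
  by rewrite UxE UyE sqrrN.
rewrite SE in zb; move: zb => /andP[lo hi].
have S0 : 0 < S z.
  by rewrite -(pmulr_lgt0 _ z0); apply: lt_le_trans lo; rewrite mulr_gt0.
have -> : P z = ln (S z * sqn z) - k^-1 * (U z + k * ln (sqn z)).
  by rewrite /P addr0 lnM ?posrE//; field; rewrite gt_eqF.
rewrite (le_trans (ler_normB _ _))// lerD//; last first.
  by rewrite normrM gtr0_norm ?invr_gt0// ler_pM2l ?invr_gt0// bE.
have {}lo : ln (2 * k ^+ 2) <= ln (S z * sqn z) by rewrite ler_ln ?posrE ?mulr_gt0.
have {}hi : ln (S z * sqn z) <= ln (7 * k ^+ 2) by rewrite ler_ln ?posrE ?mulr_gt0.
have := ler_norm (ln (7 * k ^+ 2)); have := ler_norm (- ln (2 * k ^+ 2)).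
have := normr_ge0 (ln (7 * k ^+ 2)); have := normr_ge0 (ln (2 * k ^+ 2)).
rewrite normrN ler_norml /N1 => A B C D.
by apply/andP; split; move: A B C D lo hi; lra.
Qed.

Variables (c G : R).
Hypothesis (L0 : exists r, closure Omega r /\ U r = c).
Hypothesis (LG : forall r, closure Omega r -> U r = c ->
  cgrad_exists Omega U r /\ enorm (cgrad Omega U r) = G).

Let D := [set z | Omega z /\ U z < c].

Let cc0 : c <= c0.
Proof.
have [r [cr <-]] := L0; have [Or|nr] := pselect (Omega r).
  exact: (@potential_le _ Omega U k c0).
by rewrite (Uc0 (r := r))//; apply/(frontier_open r oO).
Qed.

Let oD : open D. Proof. exact: open_below. Qed.
Let DO : D `<=` Omega. Proof. by move=> z []. Qed.

Let S_gt0 z : D z -> 0 < S z.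
Proof.
move=> [Oz zc]; rewrite lt0r addr_ge0 ?sqr_ge0// andbT.
by apply: (@no_critical_point _ Omega U k c0) => //; exact: lt_le_trans zc cc0.
Qed.

Let bdD x : closure D x -> ~ D x -> closure Omega x /\ U x = c.
Proof.
move=> cx nx; have cO : closure Omega x by exact: closure_subset cx.
split=> //; have xc : U x <= c.
  apply/ler_addgt0Pr => e e0.
  have [z [[Oz zc] h]] := cx _ (closure_near cU DO cx e0).
  have := h (conj Oz zc); rewrite ltr_norml => /andP[h1 _]; move: zc h1; lra.
have [Ox|nO] := pselect (Omega x).
  by apply/eqP; rewrite eq_le xc leNgt; apply/negP => h; exact: nx.
have E := Uc0 (proj2 (frontier_open x oO) (conj cO nO)).
by apply/eqP; rewrite eq_le xc E cc0.
Qed.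

Let S_lim x (e : R) : closure D x -> ~ D x -> 0 < e ->
  \forall z \near x, D z -> `|S z - G ^+ 2| < e.
Proof.
move=> cx nx e0; have [cO Ux] := bdD cx nx; have [ex gE] := LG cO Ux.
have := cgrad_near ex (@sqn_continuous R 0) e0.
apply: filterS => z h Dz; have := h (DO Dz); rewrite !subr0 -sqr_enorm gE distrC.
suff -> : sqn (grad U z) = S z by [].
by rewrite /sqn -[(grad U z).1]/(pderiv [:: false] U z) -[(grad U z).2]/(pderiv [:: true] U z) UxE UyE sqrrN.
Qed.

Lemma P_jet : exists g h, [/\ jet2 D P g h, forall z, D z -> h false z + h true z = 0,
  forall z, D z -> g false z = 2 * (a 0 z * a 1 z + b 0 z * b 1 z) / S z - k^-1 * a 0 z &
  forall z, D z -> g true z = 2 * (b 0 z * a 1 z - a 0 z * b 1 z) / S z + k^-1 * b 0 z].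
Proof.
have S0 z : D z -> 0 < a 0 z ^+ 2 + b 0 z ^+ 2 + 0 by rewrite addr0; exact: S_gt0.
have [g [h [j [lap [gx gy]]]]] := hol_ln_jet2 (hol_sub DO (ab 0)) (hol_sub DO (ab 1)) S0.
have hl : harmonic_on Omega U by split; [exact: sU|exact: lU].
have ju := jet2Z (- k^-1) (jet2_sub DO (harmonic_on_jet2 hl)).
have jP := jet2D j ju.
have E : (fun z => ln (a 0 z ^+ 2 + b 0 z ^+ 2 + 0) + - k^-1 * U z) = P.
  by apply/funext => z; rewrite /P /S mulNr.
rewrite E in jP; do 2!eexists; split; first exact: jP.
- move=> z Dz /=; have := lU (DO Dz); rewrite /laplacian /= => lz.
  rewrite addrACA lap// -mulrDr; by rewrite lz !(mulr0, mul0r, addr0).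
- move=> z Dz; rewrite -[LHS]/(g false z + - k^-1 * pderiv [:: false] U z).
  by rewrite gx// addr0 (mulNr k^-1).
- move=> z Dz; rewrite -[LHS]/(g true z + - k^-1 * pderiv [:: true] U z).
  rewrite UyE gy// addr0.
  by rewrite mulrNN.
Qed.

Let hP : harmonic D P.
Proof. by have [g [h [j l _ _]]] := P_jet; exists g, h. Qed.

Let hB : harmonic D (fun z => c - U z).
Proof. exact: harmonicB (harmonic_cst _ _) (harmonic_sub DO hU). Qed.

Let B0 z : D z -> 0 <= c - U z. Proof. by move=> [_ /ltW]; rewrite subr_ge0. Qed.

Let bar_inf (N : R) (s : R) : exists r, forall z, D z -> r <= sqn z -> N <= s * (c - U z) \/ s <= 0.
Proof.
have [s0|s0] := leP s 0; first by exists 0 => z _ _; right.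
have [r rP] := log_growth_lt k0 gU (c - N / s).
exists r => z Dz zr; left; have := rP z (DO Dz) zr.
rewrite -ler_pdivrMl// => h; move: h; rewrite [s^-1 * N]mulrC; move: (N / s) (U z) => A B; lra.
Qed.

(** The sign [s] gives the upper and the lower bound together. The barrier is [c - U] itself, which
    is positive on [D] and tends to infinity at infinity, where [P] is bounded. *)
Lemma P_le (s m : R) : s = 1 \/ s = -1 ->
  (forall x e, closure D x -> ~ D x -> 0 < e -> \forall z \near x, D z -> s * P z - m < e) ->
  forall z, D z -> s * P z <= m.
Proof.
move=> s1 bd z Dz; rewrite -subr_le0.
apply: (@maximum_principle_barrier _ D (fun z => s * P z - m) (fun z => c - U z)) => //.
- exact/harmonic_subharmonic/harmonicB/harmonic_cst/harmonicZ.
- move=> x cx nx d e d0 e0; apply: filterS (bd x e cx nx e0) => w h Dw.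
  by apply: le_lt_trans (h Dw); rewrite gerBl mulr_ge0 ?B0// ltW.
- move=> d e d0 e0; have [N [r rP]] := P_bounded.
  have [r' r'P] := bar_inf (N + `|m|) d.
  exists (Num.max r r') => w Dw; rewrite ge_max => /andP[wr wr'].
  have PN := rP w (DO Dw) wr.
  have [h|h] := r'P w Dw wr'; last by move: (lt_le_trans d0 h); rewrite ltxx.
  have sN : `|s| = 1 by case: s1 => ->; rewrite ?normrN normr1.
  have : s * P w <= N by rewrite (le_trans (ler_norm _))// normrM sN mul1r.
  have := ler_norm (- m); rewrite normrN; move: h e0; lra.
Qed.

Let D_nonempty : exists p, D p.
Proof.
have [r1 [r10 r1P]] := far_in_domain hO hF.
have [r2 r2P] := log_growth_lt k0 gU c.
pose r := Num.max r1 r2.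
have zr : r < sqn ((r + 1, 0) : plane).
  have : 0 < r by rewrite lt_max r10.
  by rewrite /sqn/= expr0n addr0 expr2; nra.
exists (r + 1, 0); have [h1 h2] : r1 < sqn ((r + 1, 0) : plane) /\ r2 < sqn ((r + 1, 0) : plane).
  by move: zr; rewrite gt_max => /andP[].
by split; [exact: r1P|apply: r2P; [exact: r1P|exact: ltW]].
Qed.

Lemma P_boundary x e : closure D x -> ~ D x -> 0 < e -> G != 0 ->
  \forall z \near x, D z -> `|P z - (ln (G ^+ 2) - k^-1 * c)| < e.
Proof.
move=> cx nx e0 G0; have [cO Ux] := bdD cx nx.
have G2 : 0 < G ^+ 2 by rewrite exprn_even_gt0.
have e2 : 0 < e / 2 by rewrite divr_gt0.
have ke : 0 < k * (e / 2) by rewrite mulr_gt0.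
have N1 := closure_near cU DO cx ke.
have /nbhs_ballP[d /= d0 dP] : nbhs (G ^+ 2) [set y | `|ln (G ^+ 2) - ln y| < e / 2].
  by have := continuous_ln G2; move/cvgrPdist_lt/(_ _ e2).
have N2 := S_lim cx nx d0.
apply: filterS2 N1 N2 => z h1 h2 Dz; move: (h1 Dz) (h2 Dz) => {}h1 {}h2.
have {}h2 : `|ln (G ^+ 2) - ln (S z)| < e / 2.
  by apply: dP; rewrite -ball_normE /ball_/= distrC.
have {}h1 : `|k^-1 * (U z - c)| < e / 2.
  by rewrite normrM gtr0_norm ?invr_gt0// ltr_pdivrMl// -Ux.
have -> : P z - (ln (G ^+ 2) - k^-1 * c) = - (ln (G ^+ 2) - ln (S z)) - k^-1 * (U z - c).
  by rewrite /P addr0; ring.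
rewrite (le_lt_trans (ler_normB _ _))// normrN.
by move: h1 h2; move: (`|_|) (`|_|) => A B; lra.
Qed.

Lemma P_cst : exists m, forall z, D z -> P z = m.
Proof.
have [G0|G0] := eqVneq G 0; last first.
  exists (ln (G ^+ 2) - k^-1 * c) => z Dz; apply/eqP; rewrite eq_le; apply/andP; split.
    rewrite -[P z]mul1r; apply: P_le => // [|x e cx nx e0]; first by left.
    by apply: filterS (P_boundary cx nx e0 G0) => w h /h /ltr_normlW; rewrite mul1r.
  rewrite -[P z]opprK lerNr -mulN1r; apply: P_le => // [|x e cx nx e0]; first by right.
  apply: filterS (P_boundary cx nx e0 G0) => w h /h.
  by rewrite -normrN opprB => /ltr_normlW; rewrite mulN1r opprK addrC.
(* If the gradient vanished on the level curve, [P] would tend to minus infinity at the boundary of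
   [D], so that any constant would bound it from above, in particular [P p - 1]. *)
exfalso; have [p Dp] := D_nonempty.
have : 1 * P p <= P p - 1.
  apply: P_le => // [|x e cx nx e0]; first by left.
  have [cO Ux] := bdD cx nx.
  have N1 := closure_near cU DO cx k0.
  have N2 := S_lim cx nx (expR_gt0 (P p - 2 + k^-1 * c)).
  apply: filterS2 N1 N2 => z h1 h2 Dz; move: (h1 Dz) (h2 Dz) => {}h1.
  rewrite G0 expr0n subr0 gtr0_norm ?S_gt0// => {}h2.
  have {}h2 : ln (S z) < P p - 2 + k^-1 * c.
    by rewrite -[ltRHS]expRK ltr_ln ?posrE ?expR_gt0// S_gt0.
  have {}h1 : - 1 < k^-1 * (U z - c).
    move: h1; rewrite Ux ltr_norml => /andP[h _].
    by rewrite -(ltr_pM2l k0) mulrA divff ?gt_eqF// mul1r mulrN1.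
  rewrite mul1r {1}/P addr0; move: h1 h2 e0; rewrite mulrBr; lra.
by rewrite mul1r; lra.
Qed.

Theorem constant_gradient_circle : is_circle (frontier Omega).
Proof.
have [m Pm] := P_cst; have [g [h [j _ gx gy]]] := P_jet.
have jc := jet2_cst D m.
have zero bb z : D z -> g bb z = 0.
  by move=> Dz; exact: (pdif_near_eq oD Dz Pm (@jet2_fst _ _ _ _ _ j bb) (@jet2_fst _ _ _ _ _ jc bb)).
have kn : k != 0 by rewrite gt_eqF.
(* [f = U_x - i U_y] satisfies [f' = f^2 / (2 k)] on [D]. *)
have deriv z : D z -> a 1 z = (a 0 z ^+ 2 - b 0 z ^+ 2) / (2 * k) /\ b 1 z = a 0 z * b 0 z / k.
  move=> Dz; have Sn : S z != 0 by rewrite gt_eqF ?S_gt0.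
  have := zero false z Dz; have := zero true z Dz; rewrite gx// gy//.
  move: Sn; rewrite /S; move: (a 0 z) (b 0 z) (a 1 z) (b 1 z) => A B A1 B1 Sn e2 e1.
  have E1 : A * A1 + B * B1 = A * (A ^+ 2 + B ^+ 2) / (2 * k).
    apply/eqP; rewrite -subr_eq0; apply/eqP.
    have -> : A * A1 + B * B1 - A * (A ^+ 2 + B ^+ 2) / (2 * k) =
      (A ^+ 2 + B ^+ 2) / 2 * (2 * (A * A1 + B * B1) / (A ^+ 2 + B ^+ 2) - k^-1 * A).
      by field; rewrite Sn kn.
    by rewrite e1 mulr0.
  have E2 : B * A1 - A * B1 = - B * (A ^+ 2 + B ^+ 2) / (2 * k).
    apply/eqP; rewrite -subr_eq0; apply/eqP.
    have -> : B * A1 - A * B1 - (- B * (A ^+ 2 + B ^+ 2) / (2 * k)) =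
      (A ^+ 2 + B ^+ 2) / 2 * (2 * (B * A1 - A * B1) / (A ^+ 2 + B ^+ 2) + k^-1 * B).
      by field; rewrite Sn kn.
    by rewrite e2 mulr0.
  split; apply: (mulfI Sn).
    have -> : (A ^+ 2 + B ^+ 2) * A1 = A * (A * A1 + B * B1) + B * (B * A1 - A * B1) by ring.
    by rewrite E1 E2; field.
  have -> : (A ^+ 2 + B ^+ 2) * B1 = B * (A * A1 + B * B1) - A * (B * A1 - A * B1) by ring.
  by rewrite E1 E2; field.
have cD : connected D by exact: (@connected_below _ Omega U k c0).
have SnD z : D z -> S z != 0 by move=> Dz; rewrite gt_eqF ?S_gt0.
(* [X + i Y] is [z + 2 k / f], where [1 / f] is the conjugate of [f] divided by [S]. Its complex
   derivative [1 - 2 k f' / f^2] vanishes. *)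
pose X z := z.1 + 2 * k * (a 0 z / S z); pose Y z := z.2 - 2 * k * (b 0 z / S z).
have h0 := hol_sub DO (ab 0).
have dS bb z : D z -> is_derive z (axis R bb) S
    (if bb then 2 * (b 0 z * a 1 z - a 0 z * b 1 z) else 2 * (a 0 z * a 1 z + b 0 z * b 1 z)).
  move=> Dz; case: bb.
    have Ha := hol_re_y h0 Dz; have Hb := hol_im_y h0 Dz.
    apply: (is_derive_eq (is_deriveD (is_deriveM Ha Ha) (is_deriveM Hb Hb))).
    by rewrite /GRing.scale /=; ring.
  have Ha := hol_re_x h0 Dz; have Hb := hol_im_x h0 Dz.
  apply: (is_derive_eq (is_deriveD (is_deriveM Ha Ha) (is_deriveM Hb Hb))).
  by rewrite /GRing.scale /=; ring.
have quot (f : plane -> R) (f' : R) bb z : D z -> is_derive z (axis R bb) f f' ->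
   is_derive z (axis R bb) (fun z => 2 * k * (f z / S z))
     (2 * k * ((f' * S z - f z * (if bb then 2 * (b 0 z * a 1 z - a 0 z * b 1 z)
        else 2 * (a 0 z * a 1 z + b 0 z * b 1 z))) / S z ^+ 2)).
  move=> Dz Hf; have H := is_deriveM Hf (is_derive_inv (SnD z Dz) (dS bb z Dz)).
  apply: (is_derive_eq (@is_deriveZ _ _ _ _ (2 * k) _ _ _ H)); rewrite /GRing.scale /=.
  by move: (if bb then _ else _) => T; field; exact: SnD.
have Xc : forall z w, D z -> D w -> X z = X w.
  apply: grad0_cst => // z Dz; have Sn := SnD z Dz; have [A1 B1] := deriv z Dz.
    apply: (is_derive_eq (is_deriveD (is_derive_fst z _) (quot _ _ false z Dz (hol_re_x h0 Dz)))).
    rewrite A1 B1; move: Sn; rewrite /S /axis /=; move: (a 0 z) (b 0 z) => A B Sn.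
    by field; rewrite Sn kn.
  apply: (is_derive_eq (is_deriveD (is_derive_fst z _) (quot _ _ true z Dz (hol_re_y h0 Dz)))).
  rewrite A1 B1; move: Sn; rewrite /S /axis /=; move: (a 0 z) (b 0 z) => A B Sn.
  by field; rewrite Sn kn.
have Yc : forall z w, D z -> D w -> Y z = Y w.
  apply: grad0_cst => // z Dz; have Sn := SnD z Dz; have [A1 B1] := deriv z Dz.
    apply: (is_derive_eq (is_deriveB (is_derive_snd z _) (quot _ _ false z Dz (hol_im_x h0 Dz)))).
    rewrite A1 B1; move: Sn; rewrite /S /axis /=; move: (a 0 z) (b 0 z) => A B Sn.
    by field; rewrite Sn kn.
  apply: (is_derive_eq (is_deriveB (is_derive_snd z _) (quot _ _ true z Dz (hol_im_y h0 Dz)))).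
  rewrite A1 B1; move: Sn; rewrite /S /axis /=; move: (a 0 z) (b 0 z) => A B Sn.
  by field; rewrite Sn kn.
have [p Dp] := D_nonempty; have [[x0 fx0] _ _] := jordan_curve_facts hF.
apply: (@log_potential_circle _ Omega U (2 * k) (X p, Y p)) => //.
- by exists x0.
- by exists c0.
- by rewrite mulr_gt0.
exists p; first exact: DO.
apply: filterS (open_nbhs_nbhs (conj oD Dp)) => z Dz.
rewrite UxE UyE (Xc p z Dp Dz) (Yc p z Dp Dz) /X /Y /=.
have := SnD z Dz; rewrite /S; move: (a 0 z) (b 0 z) => A B Sn.
by split; field; rewrite Sn.
Qed.

End ConstantGradient.

(** * Primitives of holomorphic functions *)

Section Primitive.
Variable R : realType.
Local Notation plane := (R * R)%type.
Local Notation mu := (@lebesgue_measure R).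
Implicit Types (p q v w z : plane) (D : set plane).

Lemma is_derive_Rintegral01 (f f' : R -> R -> R) (d C : R) : 0 < d ->
  (forall h t : R, `|h| < d -> 0 <= t <= 1 -> is_derive h 1 (f^~ t) (f' h t)) ->
  (forall h t : R, `|h| < d -> 0 <= t <= 1 -> `|f' h t| <= C) ->
  (forall h t : R, `|h| < d -> 0 <= t <= 1 -> {for t, continuous (f h)}) ->
  is_derive (0 : R) 1 (fun h => \int[mu]_(t in `[0, 1]) f h t) (\int[mu]_(t in `[0, 1]) f' 0 t).
Proof.
move=> d0 df bf cf.
have I0 : (`]- d, d[%classic : set R) 0 by rewrite /= in_itv/= oppr_lt0 d0.
have Ih (h : R) : (`]- d, d[%classic : set R) h -> `|h| < d by rewrite /= in_itv/= ltr_norml.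
have int (h : R) : (`]- d, d[%classic : set R) h -> mu.-integrable `[0, 1] (EFin \o f h).
  move=> /Ih hd; apply: continuous_compact_integrable; first exact: segment_compact.
  apply: continuous_in_subspaceT => t; rewrite inE/= in_itv/= => t01.
  exact: cf.
have der (h t : R) : (`]- d, d[%classic : set R) h -> (`[0, 1]%classic : set R) t -> derivable (f^~ t) h 1.
  by move=> /Ih hd; rewrite /= in_itv/= => t01; have [] := df h t hd t01.
have val (h t : R) : `|h| < d -> 0 <= t <= 1 -> partial1of2 f h t = f' h t.
  by move=> hd t01; rewrite partial1of2E; have [_] := df h t hd t01.
have C0 (y : R) : 0 <= `|C| by [].
have iC : mu.-integrable `[0, 1] (EFin \o fun=> `|C|).
  apply: continuous_compact_integrable; first exact: segment_compact.
  by apply: continuous_subspaceT => t; exact: cst_continuous.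
have ub (h t : R) : (`]- d, d[%classic : set R) h -> (`[0, 1]%classic : set R) t -> `|partial1of2 f h t| <= `|C|.
  move=> /Ih hd; rewrite /= in_itv/= => t01.
  by rewrite val// (le_trans (bf h t hd t01))// ler_norm.
split.
  exact: (@derivable_under_integral _ _ _ mu f `[0, 1]%classic _ 0 (- d) d I0 int der _ C0 iC ub).
rewrite -derive1E (@differentiation_under_integral _ _ _ mu f `[0, 1]%classic _ 0 (- d) d I0 int der _ C0 iC ub)//.
apply: eq_Rintegral => t; rewrite inE/= in_itv/= => t01.
by rewrite val// normr0.
Qed.

Lemma Rintegral01_derive (F f : R -> R) : (forall t : R, 0 <= t <= 1 -> is_derive t 1 F (f t)) ->
  (forall t : R, 0 <= t <= 1 -> {for t, continuous f}) -> \int[mu]_(t in `[0, 1]) f t = F 1 - F 0.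
Proof.
move=> dF cf; have cF (t : R) : 0 <= t <= 1 -> {for t, continuous F}.
  move=> /dF[df _]; apply/differentiable_continuous.
  exact/derivable1_diffP.
rewrite /Rintegral (@continuous_FTC2 _ f F 0 1)//.
- apply: continuous_in_subspaceT => t; rewrite inE/= in_itv/= => t01.
  exact: cf.
- split.
  + by move=> t; rewrite in_itv/= => /andP[t0 t1]; have [] := dF t; rewrite ?(ltW t0) ?(ltW t1).
  + by apply: cvg_at_right_filter; apply: cF; rewrite lexx ler01.
  + by apply: cvg_at_left_filter; apply: cF; rewrite lexx ler01.
- move=> t; rewrite in_itv/= derive1E => /andP[t0 t1].
  by have [] := dF t; rewrite ?(ltW t0) ?(ltW t1).
Qed.

(** The remainder estimate with [e = 1] shows that [f] is Lipschitz at [p]; this provides the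
    continuity fields of [hol] for primitives. *)
Lemma C1_continuous D f (fx fy : plane -> R) p : nbhs p D ->
  pdif D false f fx -> pdif D true f fy ->
  {for p, continuous fx} -> {for p, continuous fy} -> {for p, continuous f}.
Proof.
move=> pD dx dy cx cy; have [r r0 rP] := differential_remainder ltr01 pD dx dy cx cy.
apply/cvgrPdist_lt => e e0; apply/nbhs_boxP.
pose C := `|fx p| + `|fy p| + 2.
have C0 : 0 < C by rewrite ltr_wpDl// addr_ge0.
exists (Num.min r (e / C)); first by rewrite lt_min r0 divr_gt0.
move=> s t; rewrite !lt_min => /andP[sr se] /andP[tr te].
rewrite distrC; have := rP s t sr tr.
move: se te; rewrite !ltr_pdivlMr// mul1r => se te H.
have H2 : `|s * fx p + t * fy p| <= `|s| * `|fx p| + `|t| * `|fy p|.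
  by rewrite (le_trans (ler_normD _ _))// !normrM.
have := ler_normD (f (p.1 + s, p.2 + t) - f p - (s * fx p + t * fy p)) (s * fx p + t * fy p).
rewrite subrK => H3; apply: le_lt_trans H3 _.
move: se te H H2; rewrite /C.
have := normr_ge0 s; have := normr_ge0 t; have := normr_ge0 (fx p); have := normr_ge0 (fy p).
move: (`|f (p.1 + s, p.2 + t) - f p - _|) (`|s * fx p + t * fy p|) (`|s|) (`|t|) (`|fx p|) (`|fy p|).
move=> A B S T X Y.
have [TS|/ltW TS] := leP T S; nra.
Qed.

Section Disc.
Variables (p : plane) (r : R).
Let D := [set z | sqn (z - p) < r].

Let oD : open D. Proof. by apply: open_ltr; exact: sqn_continuous. Qed.

(* [prim a b] is the real part of the integral of [a + i b] along the ray from [p]. *)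
Definition prim (a b : plane -> R) q := \int[mu]_(t in `[0, 1])
  ((q - p).1 * a (p + t *: (q - p)) - (q - p).2 * b (p + t *: (q - p))).

Variables (a b a1 b1 : plane -> R).
Hypothesis ab : hol D a b a1 b1.
Hypothesis ca1 : forall z, D z -> {for z, continuous a1}.
Hypothesis cb1 : forall z, D z -> {for z, continuous b1}.

(** Differentiation under the integral sign produces, thanks to the Cauchy-Riemann equations, the
    derivative in [t] of [t * phi (p + t *: w)], where [phi] is the announced partial derivative;
    the integral is then [phi q]. *)
Lemma prim_derive bb q : D q ->
  is_derive q (axis R bb) (prim a b) (if bb then - b q else a q).
Proof.
move=> Dq; set e := axis R bb; pose w := q - p.
(* A squared radius between those of [q] and of the disc: it gives a compact disc, on which
   everything is bounded, with room to move [q]. *)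
pose r2 := (sqn w + r) / 2.
have wr2 : sqn w < r2 by move: Dq; rewrite /D/= -/w /r2; lra.
have r2r : r2 < r by move: Dq; rewrite /D/= -/w /r2; lra.
have r20 : 0 <= r2 by rewrite (le_trans (sqn_ge0 w))// ltW.
pose Z (h t : R) := p + t *: w + h *: (t *: e).
have ZE (h t : R) : Z h t = p + t *: (w + h *: e) by rewrite /Z (scalerDr t w) addrA !scalerA [h * t]mulrC.
have [d d0 dP] : exists2 d : R, 0 < d & forall h, `|h| < d -> sqn (w + h *: e) < r2.
  have N : nbhs q [set z | sqn (z - p) < r2].
    by apply: open_nbhs_nbhs; split; first by apply: open_ltr; exact: sqn_continuous.
  have /nbhs_ballP[d /= d0 dP] := near_line e N.
  exists d => // h hd; have := dP h; rewrite /ball/= sub0r normrN => /(_ hd).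
  by rewrite /= addrAC.
have Zr2 (h t : R) : `|h| < d -> 0 <= t <= 1 -> sqn (Z h t - p) <= r2.
  move=> hd /andP[t0 t1]; rewrite ZE addrC addKr sqnZ.
  by rewrite (le_trans _ (ltW (dP h hd)))// ler_piMl ?sqn_ge0// expr_le1.
have ZD (h t : R) : `|h| < d -> 0 <= t <= 1 -> D (Z h t).
  by move=> hd t01; apply: le_lt_trans r2r; exact: Zr2.
have r2D z : sqn (z - p) <= r2 -> D z by move=> h; exact: le_lt_trans r2r.
pose da z := if bb then - b1 z else a1 z; pose db z := if bb then a1 z else b1 z.
pose f (h t : R) := (w.1 + h * e.1) * a (Z h t) - (w.2 + h * e.2) * b (Z h t).
pose f' (h t : R) := (e.1 * a (Z h t) - e.2 * b (Z h t)) +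
  t * ((w.1 + h * e.1) * da (Z h t) - (w.2 + h * e.2) * db (Z h t)).
have dlin (x y h : R) : is_derive h 1 (fun h => x + h * y) y.
  have H := is_deriveD (is_derive_cst x h 1) (is_deriveM (is_derive_id h (1 : R)) (is_derive_cst y h 1)).
  by apply: (is_derive_eq H); rewrite scaler0 add0r -[_ *: _]/(y * 1) mulr1 !add0r.
have da' z : D z -> is_derive z e a (da z).
  move=> Dz; have H b' : is_derive z (axis R b') a (if b' then - b1 z else a1 z).
    by case: b'; [exact: hol_re_y ab z Dz|exact: hol_re_x ab z Dz].
  exact: H.
have db' z : D z -> is_derive z e b (db z).
  move=> Dz; have H b' : is_derive z (axis R b') b (if b' then a1 z else b1 z).
    by case: b'; [exact: hol_im_y ab z Dz|exact: hol_im_x ab z Dz].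
  exact: H.
have lineD (g : plane -> R) (g' h t : R) : is_derive (Z h t) e g g' ->
    is_derive h 1 (fun h => g (Z h t)) (t * g').
  by move=> H; apply: is_derive_line; exact: is_deriveZdir.
have df (h t : R) : `|h| < d -> 0 <= t <= 1 -> is_derive h 1 (f^~ t) (f' h t).
  move=> hd t01; have Dz := ZD h t hd t01.
  have H := is_deriveB (is_deriveM (dlin w.1 e.1 h) (lineD _ _ _ _ (da' _ Dz)))
    (is_deriveM (dlin w.2 e.2 h) (lineD _ _ _ _ (db' _ Dz))).
  by apply: (is_derive_eq H); rewrite /f' /GRing.scale /=; ring.
have [Ca HCa] := disc_bound r20 (hol_re_cont ab) r2D.
have [Cb HCb] := disc_bound r20 (hol_im_cont ab) r2D.
have [Ca1 HCa1] := disc_bound r20 ca1 r2D.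
have [Cb1 HCb1] := disc_bound r20 cb1 r2D.
have bf (h t : R) : `|h| < d -> 0 <= t <= 1 ->
    `|f' h t| <= Ca + Cb + (1 + r2) * ((Ca1 + Cb1) + (Ca1 + Cb1)).
  move=> hd t01; have zr := Zr2 h t hd t01.
  have B0 := normr_ge0 (a1 (Z h t)); have B1 := normr_ge0 (b1 (Z h t)).
  have A := HCa _ zr; have B := HCb _ zr; have A1 := HCa1 _ zr; have B2 := HCb1 _ zr.
  have a3 : `|da (Z h t)| <= Ca1 + Cb1.
    by rewrite /da; case: (bb); rewrite ?normrN; move: B0 B1 A1 B2; lra.
  have b3 : `|db (Z h t)| <= Ca1 + Cb1.
    by rewrite /db; case: (bb); move: B0 B1 A1 B2; lra.
  have W := dP h hd.
  have bd (x y : R) : x ^+ 2 + y ^+ 2 < r2 -> `|x| <= 1 + r2 /\ `|y| <= 1 + r2.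
    move=> xy; have le1 (v : R) : v ^+ 2 < r2 -> `|v| <= 1 + r2.
      by rewrite -(real_normK (num_real v)) => v2; have := sqr_ge0 (`|v| - 1); move: v2 r20; lra.
    by split; apply: le1; apply: le_lt_trans xy; rewrite ?lerDl ?lerDr sqr_ge0.
  have [w1 w2] := bd _ _ W; rewrite -[(w + _).1]/(w.1 + h * e.1) in w1.
  rewrite -[(w + _).2]/(w.2 + h * e.2) in w2.
  rewrite /f' (le_trans (ler_normD _ _))// lerD//.
    rewrite (le_trans (ler_normB _ _))// !normrM.
    have [-> ->] : `|e.1| = (~~ bb)%:R /\ `|e.2| = bb%:R.
      by rewrite /e; case: (bb) => /=; rewrite normr0 normr1.
    have := normr_ge0 (a (Z h t)); have := normr_ge0 (b (Z h t)).
    by move: A B; case: (bb) => /=; lra.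
  have /andP[t0 t1] := t01.
  rewrite normrM (ger0_norm t0) (le_trans (ler_piMl _ t1))//.
  rewrite (le_trans (ler_normB _ _))// !normrM mulrDr lerD// ler_pM//.
have cf (h t : R) : `|h| < d -> 0 <= t <= 1 -> {for t, continuous (f h)}.
  move=> hd t01; have Dz := ZD h t hd t01.
  have cZ : {for t, continuous (Z h)}.
    have -> : Z h = (fun t => p + t *: (w + h *: e)) by apply/funext => u; rewrite ZE.
    by apply: cvgD; [exact: cvg_cst|apply: cvgZr_tmp; exact: cvg_id].
  apply: cvgB; apply: cvgM; try exact: cvg_cst.
    by apply: (@continuous_comp _ _ _ (Z h) a t cZ); exact: hol_re_cont ab _ Dz.
  by apply: (@continuous_comp _ _ _ (Z h) b t cZ); exact: hol_im_cont ab _ Dz.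
have H := is_derive_Rintegral01 d0 df bf cf.
have pE (h : R) : prim a b (q + h *: e) = \int[mu]_(t in `[0, 1]) f h t.
  apply: eq_Rintegral => t _; rewrite /f ZE.
  have -> : q + h *: e - p = w + h *: e by rewrite addrAC.
  by [].
apply: is_derive_lineV; rewrite (funext pE); apply: (is_derive_eq H).
pose phi z := if bb then - b z else a z.
pose phix z := if bb then - b1 z else a1 z; pose phiy z := if bb then - a1 z else - b1 z.
have z0 : `|0 : R| < d by rewrite normr0.
have Z0 (t : R) : Z 0 t = p + t *: w by rewrite /Z scale0r addr0.
have dphix : pdif D false phi phix.
  move=> z Dz; rewrite /phi /phix; case: (bb); last exact: hol_re_x ab z Dz.
  exact: is_deriveN (hol_im_x ab Dz).
have dphiy : pdif D true phi phiy.
  move=> z Dz; rewrite /phi /phiy; case: (bb); last exact: hol_re_y ab z Dz.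
  exact: is_deriveN (hol_im_y ab Dz).
have cphix z : D z -> {for z, continuous phix}.
  by move=> Dz; rewrite /phix; case: (bb); [apply: cvgN; exact: cb1|exact: ca1].
have cphiy z : D z -> {for z, continuous phiy}.
  by move=> Dz; rewrite /phiy; case: (bb); apply: cvgN; [exact: ca1|exact: cb1].
have dPhi (t : R) : 0 <= t <= 1 -> is_derive t 1 (fun t => t * phi (p + t *: w)) (f' 0 t).
  move=> t01; have Dz := ZD 0 t z0 t01; rewrite Z0 in Dz.
  have N : nbhs (p + t *: w) D by apply: open_nbhs_nbhs.
  have K := is_derive_line (C1_is_derive w N dphix dphiy (cphix _ Dz) (cphiy _ Dz)).
  apply: (is_derive_eq (is_deriveM (is_derive_id t 1) K)).
  rewrite /f' Z0 /phi /phix /phiy /da /db /e /GRing.scale /=.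
  by case: (bb) => /=; ring.
have cf' (t : R) : 0 <= t <= 1 -> {for t, continuous (f' 0)}.
  move=> t01; have Dz := ZD 0 t z0 t01.
  have cZ : {for t, continuous (Z 0)}.
    have -> : Z 0 = (fun t => p + t *: w) by apply/funext => u; rewrite Z0.
    by apply: cvgD; [exact: cvg_cst|apply: cvgZr_tmp; exact: cvg_id].
  have comp (g : plane -> R) : {for Z 0 t, continuous g} -> {for t, continuous (fun t => g (Z 0 t))}.
    by move=> cg; apply: (@continuous_comp _ _ _ (Z 0) g t cZ).
  have c_a : {for t, continuous (fun t => a (Z 0 t))} by apply: comp; exact: hol_re_cont ab _ Dz.
  have c_b : {for t, continuous (fun t => b (Z 0 t))} by apply: comp; exact: hol_im_cont ab _ Dz.
  have c_da : {for t, continuous (fun t => da (Z 0 t))} by apply: comp; exact: cphix.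
  have c_db : {for t, continuous (fun t => db (Z 0 t))}.
    by apply: comp; rewrite /db; case: (bb); [exact: ca1|exact: cb1].
  apply: cvgD; first by apply: cvgB; apply: cvgM => //; exact: cvg_cst.
  apply: cvgM; first exact: cvg_id.
  by apply: cvgB; apply: cvgM => //; exact: cvg_cst.
rewrite (Rintegral01_derive dPhi cf') mul1r mul0r subr0 scale1r.
by rewrite /w subrKC.
Qed.

End Disc.

(** The imaginary part of a primitive [F] is the real part of [- i F], and
    [- i (a + i b) = b - i a]; so it is again a [prim]. *)
Lemma hol_primitive p (r : R) (a b a1 b1 : plane -> R) :
  hol [set z | sqn (z - p) < r] a b a1 b1 ->
  (forall z, sqn (z - p) < r -> {for z, continuous a1}) ->
  (forall z, sqn (z - p) < r -> {for z, continuous b1}) ->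
  hol [set z | sqn (z - p) < r] (prim p a b) (prim p b (fun z => - a z)) a b.
Proof.
set D := [set z | _] => ab ca1 cb1.
have oD : open D by apply: open_ltr; exact: sqn_continuous.
have ba : hol D b (fun z => - a z) b1 (fun z => - a1 z).
  have [h1 h2 h3 h4 h5 h6] := ab; split=> //.
  - by move=> z Dz; apply: cvgN; exact: h1.
  - by move=> z Dz; rewrite opprK; exact: h6.
  - by move=> z Dz; apply: is_deriveN; exact: h3.
  - by move=> z Dz; rewrite -[b1 z]opprK; apply: is_deriveN; exact: h4.
have cNa1 z : D z -> {for z, continuous (fun z => - a1 z)} by move=> Dz; apply: cvgN; exact: ca1.
have dA := prim_derive ab ca1 cb1; have dB := prim_derive ba cb1 cNa1.
have cNb z : D z -> {for z, continuous (fun z => - b z)}.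
  by move=> Dz; apply: cvgN; exact: hol_im_cont ab z Dz.
have By z : D z -> is_derive z (axis R true) (prim p b (fun z => - a z)) (a z).
  by move=> Dz; apply: (is_derive_eq (dB true z Dz)); rewrite opprK.
split=> [z Dz|z Dz|z Dz|z Dz|z Dz|//].
- apply: (@C1_continuous D _ a (fun z => - b z) z) => //; first exact: open_nbhs_nbhs.
  + by move=> w Dw; exact: dA false w Dw.
  + by move=> w Dw; exact: dA true w Dw.
  + exact: hol_re_cont ab z Dz.
  + exact: cNb.
- apply: (@C1_continuous D _ b a z) => //; first exact: open_nbhs_nbhs.
  + by move=> w Dw; exact: dB false w Dw.
  + exact: hol_im_cont ab z Dz.
  + exact: hol_re_cont ab z Dz.
- exact: dA false z Dz.
- exact: dA true z Dz.
- exact: dB false z Dz.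
Qed.

(* [hol_unique_continuation] needs two complex derivatives; here the function has
   only one, so it is applied to a primitive. *)
Lemma hol_disc_eq0 p (r : R) (a b a1 b1 : plane -> R) : 0 < r ->
  hol [set z | sqn (z - p) < r] a b a1 b1 ->
  (forall z, sqn (z - p) < r -> {for z, continuous a1}) ->
  (forall z, sqn (z - p) < r -> {for z, continuous b1}) ->
  (\forall z \near p, a z = 0 /\ b z = 0) ->
  forall z, sqn (z - p) < r -> a z = 0 /\ b z = 0.
Proof.
move=> r0 ab ca1 cb1 ab0; have AB := hol_primitive ab ca1 cb1.
set D := [set z | _] in ab AB.
have oD : open D by apply: open_ltr; exact: sqn_continuous.
have pp : D p by rewrite /D/= subrr sqn0.
have ABz : \forall z \near p, prim p a b z ^+ 2 + prim p b (fun z => - a z) z ^+ 2 = 0.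
  move: ab0 => /nbhs_sqnP[s s0 sP]; apply/nbhs_sqnP; exists s => // z zs.
  have seg (t : R) : `[0, 1]%classic t -> a (p + t *: (z - p)) = 0 /\ b (p + t *: (z - p)) = 0.
    rewrite /= in_itv/= => t01; apply: sP; apply: segment_near => //.
    by rewrite subrr sqn0 exprn_gt0.
  have z1 : prim p a b z = 0.
    rewrite /prim -[RHS](mul0r (fine (mu `[0, 1]))) -Rintegral_cst//.
    by apply: eq_Rintegral => t; rewrite inE => /seg[-> ->]; rewrite !mulr0 subr0.
  have z2 : prim p b (fun z => - a z) z = 0.
    rewrite /prim -[RHS](mul0r (fine (mu `[0, 1]))) -Rintegral_cst//.
    by apply: eq_Rintegral => t; rewrite inE => /seg[-> ->]; rewrite oppr0 !mulr0 subr0.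
  by rewrite z1 z2 expr0n addr0.
have E := hol_unique_continuation oD (@disc_connected _ p r r0) AB ab (ex_intro2 _ _ p pp ABz).
have z0 z : D z -> prim p a b z = 0.
  by move=> /E/eqP; rewrite paddr_eq0 ?sqr_ge0// !sqrf_eq0 => /andP[/eqP].
have jc := jet2_cst D 0.
move=> z Dz; split.
  exact: (pdif_near_eq oD Dz z0 (hol_re_x AB) (@jet2_fst _ _ _ _ _ jc false)).
have := pdif_near_eq oD Dz z0 (hol_re_y AB) (@jet2_fst _ _ _ _ _ jc true).
by move/eqP; rewrite oppr_eq0 => /eqP.
Qed.

End Primitive.

(** * Circles in Jordan curves *)

Section CircleInJordanCurve.
Variable R : realType.
Local Notation plane := (R * R)%type.
Implicit Types (p q v w z a : plane) (L : set plane).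

(* The stereographic projection from [p] parametrizes the circle minus [p]. *)
Lemma punctured_circle_connected a (r : R) p : 0 < r -> sqn (p - a) = r ^+ 2 ->
  connected [set z | sqn (z - a) = r ^+ 2 /\ z <> p].
Proof.
move=> r0 pr; pose u1 := p.1 - a.1; pose u2 := p.2 - a.2.
have U : u1 ^+ 2 + u2 ^+ 2 = r ^+ 2 by [].
have r2 : 0 < r ^+ 2 by rewrite exprn_gt0.
have s1 (s : R) : s ^+ 2 + 1 != 0 by rewrite gt_eqF// (ltr_wpDl (sqr_ge0 s) ltr01).
(* [c + i d = (s + i)^2 / (s^2 + 1)] runs through the unit circle without 1, and [X + i Y] is
   reached at [s = Y / (1 - X)]. The map [f] scales and rotates so that the missing point becomes
   [p]. *)
pose c (s : R) := (s ^+ 2 - 1) / (s ^+ 2 + 1); pose d (s : R) := 2 * s / (s ^+ 2 + 1).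
pose f (s : R) : plane := (a.1 + (c s * u1 - d s * u2), a.2 + (c s * u2 + d s * u1)).
have cf : continuous f.
  move=> s; have c1 : {for s, continuous c}.
    apply: cvgM; first by apply: cvgB; [rewrite expr2; apply: cvgM; exact: cvg_id|exact: cvg_cst].
    apply: cvgV; first exact: s1.
    by apply: cvgD; [rewrite expr2; apply: cvgM; exact: cvg_id|exact: cvg_cst].
  have c2 : {for s, continuous d}.
    apply: cvgM; first by apply: cvgM; [exact: cvg_cst|exact: cvg_id].
    apply: cvgV; first exact: s1.
    by apply: cvgD; [rewrite expr2; apply: cvgM; exact: cvg_id|exact: cvg_cst].
  have f1 : {for s, continuous (fun s => a.1 + (c s * u1 - d s * u2))}.
    by apply: cvgD; [exact: cvg_cst|apply: cvgB; apply: cvgM => //; exact: cvg_cst].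
  have f2 : {for s, continuous (fun s => a.2 + (c s * u2 + d s * u1))}.
    by apply: cvgD; [exact: cvg_cst|apply: cvgD; apply: cvgM => //; exact: cvg_cst].
  exact: (cvg_pair f1 f2).
suff -> : [set z | sqn (z - a) = r ^+ 2 /\ z <> p] = f @` [set: R].
  apply: connected_continuous_connected; first exact: setT_connected.
  exact: continuous_subspaceT.
apply/seteqP; split=> [z [zr zp]|_ [s _ <-]].
  pose v1 := z.1 - a.1; pose v2 := z.2 - a.2.
  have V : v1 ^+ 2 + v2 ^+ 2 = r ^+ 2 by [].
  pose X := (v1 * u1 + v2 * u2) / r ^+ 2; pose Y := (v2 * u1 - v1 * u2) / r ^+ 2.
  have XY : X ^+ 2 + Y ^+ 2 = 1.
    have : (v1 * u1 + v2 * u2) ^+ 2 + (v2 * u1 - v1 * u2) ^+ 2 = (r ^+ 2) ^+ 2.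
      by rewrite [in RHS]expr2 -{1}V -U; ring.
    rewrite /X /Y => H; rewrite !expr_div_n -mulrDl H divff//.
    by rewrite expf_neq0// gt_eqF.
  have E1 : v1 = X * u1 - Y * u2.
    have -> : X * u1 - Y * u2 = v1 * (u1 ^+ 2 + u2 ^+ 2) / r ^+ 2 by rewrite /X /Y; field; rewrite gt_eqF.
    by rewrite U mulfK// gt_eqF.
  have E2 : v2 = X * u2 + Y * u1.
    have -> : X * u2 + Y * u1 = v2 * (u1 ^+ 2 + u2 ^+ 2) / r ^+ 2 by rewrite /X /Y; field; rewrite gt_eqF.
    by rewrite U mulfK// gt_eqF.
  have X1 : 1 - X != 0.
    rewrite subr_eq0; apply/eqP => X1; apply: zp.
    have Y0 : Y = 0.
      by apply/eqP; rewrite -sqrf_eq0; apply/eqP; move: XY; rewrite -X1 expr1n; lra.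
    move: E1 E2; rewrite -X1 Y0 !mul1r !mul0r subr0 addr0 /v1 /v2 /u1 /u2 => /addIr e1 /addIr e2.
    by rewrite [z]surjective_pairing e1 e2 -surjective_pairing.
  exists (Y / (1 - X)) => //; have S1 := s1 (Y / (1 - X)).
  have Y2 : Y ^+ 2 = (1 - X) * (1 + X) by move: XY; move: (X) (Y) => A B; rewrite !expr2; lra.
  have Q : (Y / (1 - X)) ^+ 2 = (1 + X) / (1 - X).
    by rewrite expr_div_n Y2 [(1 - X) ^+ 2]expr2 -mulf_div divff// mul1r.
  have cX : c (Y / (1 - X)) = X.
    rewrite /c Q; have -> : (1 + X) / (1 - X) - 1 = 2 * X / (1 - X) by field.
    have -> : (1 + X) / (1 - X) + 1 = 2 / (1 - X) by field.
    by field.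
  have dY : d (Y / (1 - X)) = Y.
    rewrite /d Q; have -> : (1 + X) / (1 - X) + 1 = 2 / (1 - X) by field.
    by field.
  rewrite /f cX dY -E1 -E2 /v1 /v2 !(addrC _ (- _)) !addNKr.
  by rewrite [RHS]surjective_pairing; congr pair; ring.
have cd : c s ^+ 2 + d s ^+ 2 = 1 by rewrite /c /d; field.
split.
  rewrite /sqn -[(f s - a).1]/((f s).1 - a.1) -[(f s - a).2]/((f s).2 - a.2) /=.
  have -> : a.1 + (c s * u1 - d s * u2) - a.1 = c s * u1 - d s * u2 by ring.
  have -> : a.2 + (c s * u2 + d s * u1) - a.2 = c s * u2 + d s * u1 by ring.
  have -> : (c s * u1 - d s * u2) ^+ 2 + (c s * u2 + d s * u1) ^+ 2 =
    (c s ^+ 2 + d s ^+ 2) * (u1 ^+ 2 + u2 ^+ 2) by ring.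
  by rewrite cd U mul1r.
move=> fp; have := congr1 fst fp; have := congr1 snd fp; rewrite /= => e2 e1.
have F1 : c s * u1 - d s * u2 = u1 by rewrite [in RHS]/u1 -e1; ring.
have F2 : c s * u2 + d s * u1 = u2 by rewrite [in RHS]/u2 -e2; ring.
have : c s * (u1 ^+ 2 + u2 ^+ 2) = u1 ^+ 2 + u2 ^+ 2.
  transitivity (u1 * (c s * u1 - d s * u2) + u2 * (c s * u2 + d s * u1)); first by ring.
  by rewrite F1 F2 !expr2.
rewrite U => /eqP; rewrite -subr_eq0 -{2}[r ^+ 2]mul1r -mulrBl mulf_eq0 [_ ^+ 2 == 0]gt_eqF// orbF subr_eq0 => /eqP.
have := s1 s; rewrite /c; move: (s ^+ 2) => y y1 /(congr1 (fun x : R => x * (y + 1))).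
by rewrite mulfVK// mul1r; lra.
Qed.

(** If [gam t0] were off the circle, the circle would be covered by the parameters strictly between
    [t0] and [t0 + 1], where [gam] is injective. Of three points of the circle, remove the one with
    the middle parameter [s]: the rest is connected, yet it is split by the compact arcs over
    [[t0, s]] and [[s, t0 + 1]], both of which it meets. *)
Lemma jordan_curve_contains_circle L a (r : R) : smooth_jordan_curve L -> 0 < r ->
  [set z | sqn (z - a) = r ^+ 2] `<=` L -> L = [set z | sqn (z - a) = r ^+ 2].
Proof.
move=> [gam [[sm _ per inj] <-]] r0; set C := [set z | _] => CL.
have cg : continuous gam.
  by move=> t; apply: differentiable_continuous; apply/derivable1_diffP; exact: (sm 0%N t).
have perN (n : nat) s : gam (s + n%:R) = gam s.
  elim: n s => [|n IH] s; first by rewrite addr0.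
  by rewrite -natr1 addrA per IH.
have perZ (n : int) s : gam (s + n%:~R) = gam s.
  case: n => n; first exact: perN.
  by rewrite NegzE mulrNz -(perN n.+1 (s - n.+1%:~R)) subrK.
have fl (t : R) : 0 <= t - (Num.floor t)%:~R < 1.
  rewrite subr_ge0 ge_floor/= ltrBlDr addrC.
  by have := lt_succ_floor t; rewrite intrD.
apply/seteqP; split=> // _ [t0 _ <-]; apply: contrapT => nC0.
have sur z : C z -> exists t, [/\ t0 < t, t < t0 + 1 & gam t = z].
  move=> Cz; have [t _ tz] := CL z Cz; have /andP[f0 f1] := fl (t - t0).
  exists (t - (Num.floor (t - t0))%:~R).
  have E : gam (t - (Num.floor (t - t0))%:~R) = z by rewrite -mulrNz perZ.
  split=> //; last by move: f1; lra.
  rewrite lt_neqAle; apply/andP; split; last by move: f0; lra.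
  by apply/eqP => tt; apply: nC0; rewrite tt E.
have inj' s t : t0 < s -> s < t0 + 1 -> t0 < t -> t < t0 + 1 -> gam s = gam t -> s = t.
  move=> s0 s1 t0' t1 st.
  have E : s - (Num.floor s)%:~R = t - (Num.floor t)%:~R.
    by apply: inj => //; rewrite -!mulrNz !perZ.
  have D : s - t = (Num.floor s - Num.floor t)%:~R by rewrite intrB; move: E; lra.
  have : `|s - t| < 1 by rewrite ltr_norml; apply/andP; split; lra.
  rewrite D -intr_norm -[1]/(1%:~R) ltr_int => n1.
  have n0 : Num.floor s - Num.floor t = 0 by apply/eqP; rewrite -normr_le0 -ltzD1 add0r.
  by move: D; rewrite n0; lra.
have sep s s1 s2 : t0 < s1 -> s1 < s -> s < s2 -> s2 < t0 + 1 ->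
    C (gam s1) -> C (gam s) -> C (gam s2) -> False.
  move=> h1 h2 h3 h4 C1 C0 C2.
  have cK (x y : R) : closed (gam @` `[x, y]).
    apply: compact_closed; first exact: norm_hausdorff.
    by apply: continuous_compact; [exact: continuous_subspaceT|exact: segment_compact].
  pose P := [set z | C z /\ z <> gam s].
  have cP : connected P by exact: punctured_circle_connected.
  have cut z : P z -> (gam @` `[t0, s]) z -> (gam @` `[s, t0 + 1]) z -> False.
    move=> [Cz zs] [x /=]; rewrite in_itv/= => /andP[x0 x1] xz [y /=].
    rewrite in_itv/= => /andP[y0 y1] yz.
    have nx : x != t0 by apply/eqP => E; apply: nC0; rewrite -E xz.
    have ny : y != t0 + 1 by apply/eqP => E; apply: nC0; rewrite -per -E yz.
    have E : x = y.
      apply: inj'; rewrite ?xz ?yz//.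
      + by rewrite lt_neqAle eq_sym nx.
      + by apply: le_lt_trans x1 _; lra.
      + by apply: lt_le_trans y0; lra.
      + by rewrite lt_neqAle ny.
    by apply: zs; rewrite -xz; congr gam; apply/eqP; rewrite eq_le x1 E y0.
  have cov z : P z -> (gam @` `[t0, s]) z \/ (gam @` `[s, t0 + 1]) z.
    move=> [/sur[t [t1 t2 tz]] _]; have [ts|st] := leP t s; [left|right]; exists t => //.
      by rewrite /= in_itv/= ts (ltW t1).
    by rewrite /= in_itv/= (ltW t2) (ltW st).
  have P1 : P (gam s1).
    split=> // E; have := inj' s1 s h1 (lt_trans h2 (lt_trans h3 h4)) (lt_trans h1 h2) (lt_trans h3 h4) E.
    by move=> e; rewrite e ltxx in h2.
  have P2 : P (gam s2).
    split=> // E; have := inj' s2 s (lt_trans h1 (lt_trans h2 h3)) h4 (lt_trans h1 h2) (lt_trans h3 h4) E.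
    by move=> e; rewrite e ltxx in h3.
  have K1 : (gam @` `[t0, s]) (gam s1) by exists s1 => //=; rewrite in_itv/= !ltW.
  have K2 : (gam @` `[s, t0 + 1]) (gam s2) by exists s2 => //=; rewrite in_itv/= !ltW.
  have E : P `&` gam @` `[t0, s] = P.
    apply: cP; first by exists (gam s1).
    - exists (~` (gam @` `[s, t0 + 1])); first by apply: closed_openC.
      apply/seteqP; split=> z [Pz Kz]; split=> //; first by move=> K; exact: cut Kz K.
      by have [] := cov z Pz.
    - by exists (gam @` `[t0, s]).
  by move: P2; rewrite -E => -[P2 K]; exact: cut K2.
have pt (x y : R) : x ^+ 2 + y ^+ 2 = r ^+ 2 -> C (a.1 + x, a.2 + y).
  move=> xy; rewrite /C /= /sqn -[(_ - a).1]/(a.1 + x - a.1) -[(_ - a).2]/(a.2 + y - a.2) -xy.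
  by congr (_ ^+ 2 + _ ^+ 2); ring.
have C1 := pt r 0; have C2 := pt (- r) 0; have C3 := pt 0 r.
rewrite !expr0n sqrrN addr0 add0r in C1 C2 C3.
have [x [x0 x1 xz]] := sur _ (C1 erefl); have [y [y0 y1 yz]] := sur _ (C2 erefl).
have [z [z0 z1 zz]] := sur _ (C3 erefl).
have xy : x != y.
  by apply/eqP => E; move: yz; rewrite -E xz => -[]; lra.
have xz' : x != z.
  by apply/eqP => E; move: zz; rewrite -E xz => -[]; lra.
have yz' : y != z.
  by apply/eqP => E; move: zz; rewrite -E yz => -[]; lra.
have Cx : C (gam x) by rewrite xz; exact: C1.
have Cy : C (gam y) by rewrite yz; exact: C2.
have Cz : C (gam z) by rewrite zz; exact: C3.
case/lt_total/orP: xy => xy; case/lt_total/orP: xz' => xz2; case/lt_total/orP: yz' => yz2.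
- exact: (sep y x z).
- exact: (sep z x y).
- by have := lt_trans xy (lt_trans yz2 xz2); rewrite ltxx.
- exact: (sep x z y).
- exact: (sep x y z).
- by have := lt_trans xy (lt_trans xz2 yz2); rewrite ltxx.
- exact: (sep z y x).
- exact: (sep y z x).
Qed.

End CircleInJordanCurve.

(** * The interior problem *)

Section InteriorDomain.
Variable R : realType.
Local Notation plane := (R * R)%type.
Implicit Types (p q v w z x : plane) (D E A : set plane).

Lemma near_neq0 x : x <> 0 -> \forall z \near x, z <> 0.
Proof.
move=> x0; have : \forall z \near x, 0 < sqn (z - 0).
  by apply: near_gtr; [exact: sqn_continuous|rewrite subr0 sqn_gt0; apply/eqP].
by apply: filterS => z; rewrite subr0 sqn_gt0 => /eqP.
Qed.

Variables (Omega : set plane) (G : plane -> R).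
Hypotheses (hO : unbounded_domain Omega) (hF : smooth_jordan_curve (frontier Omega)).
Hypotheses (O0 : ~ closure Omega 0) (hG : interior_green Omega G).

Let oO : open Omega. Proof. by case: hO. Qed.
Let Delta := ~` closure Omega.
Let D' := punctured_interior Omega.

(** [1 / (4 pi)], the coefficient of [- ln |z|^2] in the singularity at the pole. *)
Definition green_const : R := (2 * pi)^-1 / 2.
Local Notation kap := green_const.

Let kap0 : 0 < kap.
Proof. by rewrite divr_gt0// invr_gt0 mulr_gt0// pi_gt0. Qed.

Let oDelta : open Delta. Proof. by apply: closed_openC; exact: closed_closure. Qed.

Let D'E z : D' z <-> Delta z /\ z <> 0.
Proof.
split=> [h|[h1 h2] []//].
by split=> e; apply: h; [left|right].
Qed.

Let oD' : open D'.
Proof.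
have -> : D' = Delta `&` [set z | 0 < sqn (z - 0)].
  apply/seteqP; split=> z; first move=> /D'E[Dz z0].
    by split=> //=; rewrite subr0 sqn_gt0; apply/eqP.
  by move=> [Dz]; rewrite /= subr0 sqn_gt0 => /eqP z0; apply/D'E.
by apply: openI => //; apply: open_gtr; exact: sqn_continuous.
Qed.

Let nOmega z : Delta z -> ~ Omega z. Proof. by move=> h /subset_closure. Qed.

Let interior_or_frontier z : ~ Omega z -> Delta z \/ frontier Omega z.
Proof.
move=> nz; have [cz|] := pselect (closure Omega z); last by left.
by right; apply/(frontier_open z oO).
Qed.

Let closure_nOmega A z : A `<=` Delta -> closure A z -> ~ Omega z.
Proof.
move=> AD cz Oz; have [w [/AD Dw Ow]] := cz _ (open_nbhs_nbhs (conj oO Oz)).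
exact: nOmega Ow.
Qed.

Let bdd : exists2 r : R, 0 < r & forall z, ~ Omega z -> sqn z < r.
Proof.
have [_ _ uO] := hO; have [_ cF _] := jordan_curve_facts hF.
have [r [r0 rF]] := compact_sqn_bounded 0 cF.
exists (r + 1); first by rewrite ltr_wpDl.
move=> z nz; rewrite ltNge; apply/negP => zr; apply: nz.
by apply: (exterior_sub r0 oO uO rF); rewrite /= subr0; lra.
Qed.

Let far (f : plane -> R) (e : R) : exists r, forall z, Delta z -> r <= sqn z -> f z < e.
Proof.
have [r r0 rP] := bdd; exists r => z /nOmega/rP zr /le_lt_trans/(_ zr).
by rewrite ltxx.
Qed.

Let contG x (e : R) : ~ Omega x -> x <> 0 -> 0 < e ->
  \forall z \near x, ~ Omega z -> z <> 0 -> `|G z - G x| < e.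
Proof.
move=> nx x0 e0; have Ax : (~` (Omega `|` [set 0])) x by case.
apply: filterS (within_cont_near (ig_continuous hG) Ax e0) => z h nz z0.
by apply: h; case.
Qed.

Let pole : exists M, \forall z \near (0 : plane), z <> 0 -> `|G z + kap * ln (sqn z)| <= M.
Proof.
have [M H] := ig_pole hG; exists M; move: H; rewrite near_withinE.
apply: filterS => z h /eqP z0; have := h z0.
by rewrite enorm_lnE ?sqn_gt0// /green_const mulrA mulrAC.
Qed.

Let ln_pole (A : R) : \forall z \near (0 : plane), z <> 0 -> ln (sqn z) < A.
Proof.
have [r r0 rP] := ln_ge_ball (0 : plane) A; apply/nbhs_sqnP.
exists (Num.sqrt r); first by rewrite sqrtr_gt0.
by move=> z; rewrite sqr_sqrtr ?ltW// => zr z0; have := rP z zr z0; rewrite subr0.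
Qed.

Let blow (K : R) : \forall z \near (0 : plane), z <> 0 -> K < G z.
Proof.
have [M H] := pole; apply: filterS2 H (ln_pole (- (K + M) / kap)) => z h1 h2 z0.
have := h2 z0; have := h1 z0; rewrite ltr_pdivlMr// mulrC ler_norml => /andP[a _] b.
by move: a b; lra.
Qed.

Let hGh : harmonic D' G. Proof. exact: harmonic_on_harmonic (ig_harmonic hG). Qed.

Let G_ge0 z : ~ Omega z -> z <> 0 -> 0 <= G z.
Proof.
move=> nz z0; have [Dz|fz] := interior_or_frontier nz; last by rewrite (ig_frontier hG).
have D'z : D' z by apply/D'E.
rewrite -oppr_le0 -mulN1r.
apply: (@maximum_principle _ D' (fun z => - 1 * G z)) D'z => //.
- exact/harmonic_subharmonic/harmonicZ.
- move=> x cx nx e e0; have nOx : ~ Omega x.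
    by apply: (@closure_nOmega D') => // w /D'E[].
  have [->|x0] := eqVneq x 0.
    by apply: filterS (blow 0) => w h /D'E[_ w0]; have := h w0; lra.
  move/eqP: x0 => x0; have fx : frontier Omega x.
    by have [Dx|//] := interior_or_frontier nOx; exfalso; apply/nx/D'E.
  apply: filterS (contG nOx x0 e0) => w h /D'E[Dw w0]; have := h (nOmega Dw) w0.
  by rewrite (ig_frontier hG fx) subr0 ltr_norml => /andP[]; lra.
- by move=> e e0; have [r rP] := far (fun z => - 1 * G z) e; exists r => w /D'E[Dw _]; exact: rP.
Qed.

(** [G] is of class C^2 only, so the holomorphic gradient is given with a single complex
    derivative. *)
Let hol_grad : hol D' (pderiv [:: false] G) (fun z => - pderiv [:: true] G z)
  (pderiv [:: false; false] G) (fun z => - pderiv [:: true; false] G z).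
Proof.
have [ck lap] := ig_harmonic hG; split=> z Dz.
- exact: (@Ck_cont _ 2 D' G [:: false]).
- by apply: cvgN; exact: (@Ck_cont _ 2 D' G [:: true]).
- exact: (@Ck_pdif _ 2 D' G [:: false] false ck).
- by rewrite opprK; exact: (@Ck_pdif _ 2 D' G [:: false] true ck).
- have -> : pderiv [:: true; false] G z = pderiv [:: false; true] G z.
    apply: (@mixed_partials _ D' G (pderiv [:: false] G) (pderiv [:: true] G)).
    + exact: open_nbhs_nbhs.
    + exact: (@Ck_pdif _ 2 D' G [::] false).
    + exact: (@Ck_pdif _ 2 D' G [::] true).
    + exact: (@Ck_pdif _ 2 D' G [:: false] true).
    + exact: (@Ck_pdif _ 2 D' G [:: true] false).
    + exact: (@Ck_cont _ 2 D' G [:: true; false]).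
    + exact: (@Ck_cont _ 2 D' G [:: false; true]).
  by apply: is_deriveN; exact: (@Ck_pdif _ 2 D' G [:: true] false).
- have -> : pderiv [:: false; false] G z = - pderiv [:: true; true] G z.
    by apply/eqP; rewrite -addr_eq0; apply/eqP; exact: lap.
  by apply: is_deriveN; exact: (@Ck_pdif _ 2 D' G [:: true] true).
Qed.

(** The points around which [G] is a given radial logarithm. The set is open, and its relative
    closedness, proved next, is the form of unique continuation that is used for [G]. *)
Let log_near (C : R) := [set z | D' z /\ \forall w \near z, G w = C - kap * ln (sqn w)].

(** Around a point [p] of the set close to [x], the function [(G_x - i G_y) z + 2 kap] vanishes,
    hence it vanishes on a disc [Q] about [p] that contains [x]. There [G + kap ln |z|^2] has zero
    gradient, so it keeps the value [C]. *)
Let log_near_closed C x : D' x -> closure (log_near C) x -> log_near C x.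
Proof.
move=> D'x cx; split=> //.
have /nbhs_sqnP[r r0 rD] : nbhs x D' by exact: open_nbhs_nbhs.
have r2 : 0 < r / 2 by rewrite divr_gt0.
have s0 : 0 < (r / 2) ^+ 2 by rewrite exprn_gt0.
have N : nbhs x [set z | sqn (z - x) < (r / 2) ^+ 2] by apply/nbhs_sqnP; exists (r / 2).
have [p [[D'p pE] /= px]] := cx _ N.
pose Q := [set z | sqn (z - p) < (r / 2) ^+ 2].
have QD : Q `<=` D'.
  move=> z zp; apply: rD; rewrite sqn_lt ?(ltW r0)//.
  have := enormD (z - p) (p - x); rewrite addrA subrK.
  by move: zp px; rewrite /Q /= !sqn_lt ?(ltW r2)//; lra.
have oQ : open Q by apply: open_ltr; exact: sqn_continuous.
have hq := hol_sub QD hol_grad.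
have hm := holD (holM hq (hol_id Q 0)) (hol_cst Q (2 * kap) 0).
have cont (s : seq bool) z : (size s <= 2)%N -> Q z -> {for z, continuous (pderiv s G)}.
  by move=> s2 /QD; apply: Ck_cont (ig_harmonic hG).1 s2.
have c1 z : {for z, continuous (fun z : plane => z.1 - (0 : plane).1)}.
  by apply: cvgB; [exact: cvg_fst|exact: cvg_cst].
have c2 z : {for z, continuous (fun z : plane => z.2 - (0 : plane).2)}.
  by apply: cvgB; [exact: cvg_snd|exact: cvg_cst].
have [m1 m2] : (forall z, Q z -> {for z, continuous (fun p =>
      pderiv [:: false; false] G p * (p.1 - (0 : plane).1) -
      - pderiv [:: true; false] G p * (p.2 - (0 : plane).2) +
      (pderiv [:: false] G p * 1 - - pderiv [:: true] G p * 0) + 0)}) /\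
    (forall z, Q z -> {for z, continuous (fun p =>
      pderiv [:: false; false] G p * (p.2 - (0 : plane).2) +
      - pderiv [:: true; false] G p * (p.1 - (0 : plane).1) +
      (pderiv [:: false] G p * 0 + - pderiv [:: true] G p * 1) + 0)}).
  split=> z Qz; (apply: cvgD; last exact: cvg_cst); apply: cvgD.
  - by apply: cvgB; apply: cvgM; [exact: cont|exact: c1|apply: cvgN; exact: cont|exact: c2].
  - by apply: cvgB; apply: cvgM; [exact: cont|exact: cvg_cst|apply: cvgN; exact: cont|exact: cvg_cst].
  - by apply: cvgD; apply: cvgM; [exact: cont|exact: c2|apply: cvgN; exact: cont|exact: c1].
  - by apply: cvgD; apply: cvgM; [exact: cont|exact: cvg_cst|apply: cvgN; exact: cont|exact: cvg_cst].
have pos z : D' z -> 0 < sqn (z - 0).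
  by move=> /D'E[_ /eqP z0]; rewrite subr0 sqn_gt0.
pose A := D' `&` [set w | G w = C - kap * ln (sqn w)]^°.
have oA : open A by apply: openI => //; exact: open_interior.
have Ap : A p by [].
have jA := jet2D (jet2_cst A C) (jet2Z (- kap) (jet2_ln (jet2_sqn A 0) (fun z Az => pos z Az.1))).
have gradA b w : A w -> pderiv [:: b] G w =
    - kap * ((if b then 2 * w.2 else 2 * w.1) / sqn w).
  move=> Aw; have E z : A z -> G z = C + - kap * ln (sqn (z - 0)).
    by move=> [_ /interior_subset /= ->]; rewrite subr0 mulNr.
  have dA : pdif A b G (pderiv [:: b] G).
    by move=> z [D'z _]; exact: (@Ck_pdif _ 2 D' G [::] b (ig_harmonic hG).1).
  rewrite (pdif_near_eq oA Aw E dA (@jet2_fst _ _ _ _ _ jA b)) add0r subr0.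
  by case: b {dA} => /=; rewrite !subr0.
have m0 : \forall z \near p, (pderiv [:: false] G z * (z.1 - (0 : plane).1) -
      - pderiv [:: true] G z * (z.2 - (0 : plane).2) + 2 * kap = 0) /\
    (pderiv [:: false] G z * (z.2 - (0 : plane).2) +
      - pderiv [:: true] G z * (z.1 - (0 : plane).1) + 0 = 0).
  apply: filterS (open_nbhs_nbhs (conj oA Ap)) => z Az.
  rewrite !gradA//= !subr0; have := pos z Az.1; rewrite subr0 /sqn => z0.
  by split; field; rewrite gt_eqF.
have {}m0 := hol_disc_eq0 s0 hm m1 m2 m0.
have V0 b z : Q z -> is_derive z (axis R b) (fun z => G z + kap * ln (sqn (z - 0))) 0.
  move=> Qz; have D'z := QD z Qz.
  have jl := jet2Z kap (jet2_ln (jet2_sqn D' 0) pos).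
  have := is_deriveD (@Ck_pdif _ 2 D' G [::] b (ig_harmonic hG).1 isT z D'z)
    (@jet2_fst _ _ _ _ _ jl b z D'z).
  move=> H; apply: (is_derive_eq H); have [] := m0 z Qz.
  rewrite /= !subr0 !addr0; have := pos z D'z; rewrite subr0 => z0.
  move=> e1 e2; have n0 : sqn z != 0 by rewrite gt_eqF.
  have e3 : pderiv [:: false] G z * sqn z = - (2 * kap) * z.1.
    have -> : pderiv [:: false] G z * sqn z =
      z.1 * (pderiv [:: false] G z * z.1 - - pderiv [:: true] G z * z.2 + 2 * kap) +
      z.2 * (pderiv [:: false] G z * z.2 + - pderiv [:: true] G z * z.1) - (2 * kap) * z.1.
      by rewrite /sqn; ring.
    by rewrite e1 e2; ring.
  have e4 : pderiv [:: true] G z * sqn z = - (2 * kap) * z.2.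
    have -> : pderiv [:: true] G z * sqn z =
      z.2 * (pderiv [:: false] G z * z.1 - - pderiv [:: true] G z * z.2 + 2 * kap) -
      z.1 * (pderiv [:: false] G z * z.2 + - pderiv [:: true] G z * z.1) - (2 * kap) * z.2.
      by rewrite /sqn; ring.
    by rewrite e1 e2; ring.
  apply: (mulIf n0); rewrite mul0r mulrDl; clear H.
  have c4 (y : R) : kap * (2 * y / sqn z) * sqn z = 2 * kap * y by field.
  by case: b => /=; rewrite c4 ?e3 ?e4; ring.
have cV := grad0_cst oQ (@disc_connected _ p _ s0) (V0 false) (V0 true).
have Qp : Q p by rewrite /Q /= subrr sqn0.
have Qx : Q x by rewrite /Q /= -sqnN opprB.
apply: filterS (open_nbhs_nbhs (conj oQ Qx)) => z Qz.
have := cV z p Qz Qp; have := nbhs_singleton pE; rewrite /= !subr0 => ->.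
by rewrite subrK => <-; rewrite addrK.
Qed.

Variables (c k : R) (r0 : plane).
Hypotheses (nOr0 : ~ Omega r0) (r00 : r0 <> 0) (Gr0 : G r0 = c).
Hypothesis LG : forall r, ~ Omega r -> r <> 0 -> G r = c ->
  cgrad_exists D' G r /\ enorm (cgrad D' G r) = k.

Let c0 : 0 <= c. Proof. by rewrite -Gr0; exact: G_ge0. Qed.

(** Filling in the pole makes this a bounded open neighbourhood of 0 whose frontier [K] lies on the
    level curve. *)
Let D := [set z | Delta z /\ (z = 0 \/ c < G z)].

Let DDelta : D `<=` Delta. Proof. by move=> z []. Qed.

Let D0 : D 0. Proof. by split=> //; left. Qed.

Let oD : open D.
Proof.
rewrite openE => z [Dz h]; rewrite /interior/=.
have N := open_nbhs_nbhs (conj oDelta Dz).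
have [z0|z0] := eqVneq z 0.
  rewrite z0 in N *; apply: filterS2 N (blow c) => w Dw h'; split=> //.
  by have [->|/eqP w0] := eqVneq w 0; [left|right; exact: h'].
case: h => [h|h]; first by rewrite h eqxx in z0.
have D'z : D' z by apply/D'E; split=> //; exact/eqP.
by apply: filterS2 N (near_gtr (harmonic_cont hGh D'z) h) => w Dw h'; split=> //; right.
Qed.

Let bdD x : closure D x -> ~ D x -> [/\ ~ Omega x, x <> 0 & G x = c].
Proof.
move=> cx nx; have nOx : ~ Omega x by exact: closure_nOmega cx.
have x0 : x <> 0 by move=> x0; apply: nx; rewrite x0.
split=> //; apply/eqP; rewrite eq_le; apply/andP; split.
  have [Dx|fx] := interior_or_frontier nOx; last by rewrite (ig_frontier hG fx).
  by rewrite leNgt; apply/negP => h; apply: nx; split=> //; right.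
apply/ler_addgt0Pr => e e0.
have [z [Dz [z0 h]]] := cx _ (filterI (near_neq0 x0) (contG nOx x0 e0)).
case: (Dz) => Dz' [|cz]; first by move=> /z0.
have := h (nOmega Dz') z0; rewrite ltr_norml => /andP[_]; move: cz; lra.
Qed.

Let sub_D (C : set plane) : connected C -> C 0 -> (forall x, C x -> closure D x -> ~ D x -> False) -> C `<=` D.
Proof.
move=> cC C0 h; apply: connected_sub_open => //; first by exists 0.
by move=> x Cx /(frontier_open x oD)[]; exact: h.
Qed.

Let bd_nonempty : exists x, closure D x /\ ~ D x.
Proof.
apply: contrapT => h; have [r r1 rP] := bdd.
pose v : plane := (r + 1, 0).
have : D v.
  apply: (@sub_D [set 0 + t *: v | t in `[0, 1 : R]]).
  - exact: segment_plane_connected.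
  - by exists 0; rewrite ?scale0r ?addr0//= in_itv/= lexx ler01.
  - by move=> x _ cx nx; apply: h; exists x.
  - by exists 1; rewrite ?scale1r ?add0r//= in_itv/= lexx ler01.
move=> /DDelta/nOmega/rP; rewrite /v /sqn /= expr0n addr0 expr2; nra.
Qed.

Let K := closure D `&` ~` D.

Let cK : compact K.
Proof.
have [r r1 rP] := bdd; apply: (@compact_bounded_closed _ _ r).
  by apply: closedI; [exact: closed_closure|exact: open_closedC].
by move=> z [cz nz]; apply: rP; have [] := bdD cz nz.
Qed.

Let K0 : K !=set0. Proof. by have [x [cx nx]] := bd_nonempty; exists x. Qed.

Let ball_sub (s : R) : 0 < s -> (forall x, K x -> s <= sqn x) -> forall z, sqn z < s -> D z.
Proof.
move=> s0 sK z zs; apply: (@sub_D [set z | sqn (z - 0) < s]); last by rewrite /= subr0.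
- exact: disc_connected.
- by rewrite /= subrr sqn0.
- by move=> x; rewrite /= subr0 ltNge => /negP h cx nx; apply: h; exact: sK.
Qed.

Let D_le (s : R) : 0 <= s -> (forall x, K x -> sqn x <= s) -> forall z, D z -> sqn z <= s.
Proof.
move=> s0 sK z Dz; rewrite leNgt; apply/negP => zs.
have sub : [set z : plane | s < sqn (z - 0)] `<=` D.
  apply: connected_sub_open => //; first exact: exterior_connected.
    by exists z; split=> //=; rewrite subr0.
  move=> x /=; rewrite subr0 => xs /(frontier_open x oD)[cx nx].
  by have := sK x (conj cx nx); rewrite leNgt xs.
have [r r1 rP] := bdd; pose v : plane := (r + s + 1, 0).
have v2 : sqn v = (r + s + 1) ^+ 2 by rewrite /v /sqn/= expr0n addr0.
have : D v by apply: sub; rewrite /= subr0 v2 expr2; nra.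
by move=> /DDelta/nOmega/rP; rewrite v2 expr2; nra.
Qed.

(** The logarithm dominates [c] on [D], whose points have squared norm at most [s]. At the pole the
    difference is only known to be bounded, and the barrier [ln s - ln |z|^2], nonnegative on [D]
    and infinite at 0, absorbs it. *)
Let G_le (s : R) z : (forall x, K x -> sqn x <= s) -> D z -> z <> 0 ->
  G z <= c + kap * (ln s - ln (sqn z)).
Proof.
move=> sK Dz z0; pose E := [set z | D z /\ z <> 0].
have [x1 Kx1] := K0; have s0 : 0 <= s by exact: le_trans (sqn_ge0 x1) (sK x1 Kx1).
have Es w : E w -> 0 < sqn w <= s.
  by move=> [Dw /eqP w0]; rewrite sqn_gt0 w0 (D_le s0).
have sgt0 : 0 < s by have /Es/andP[a b] : E z by []; exact: lt_le_trans b.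
have lnw w : E w -> ln (sqn w) <= ln s by move=> /Es/andP[a b]; rewrite ler_ln.
have oE : open E.
  have -> : E = D `&` [set z | 0 < sqn (z - 0)].
    by apply/seteqP; split=> w [Dw]; rewrite /= ?subr0 ?sqn_gt0 => /eqP w0; split=> //=; rewrite subr0 sqn_gt0.
  by apply: openI => //; apply: open_gtr; exact: sqn_continuous.
have ED' : E `<=` D' by move=> w [[Dw _] w0]; apply/D'E.
have hl : harmonic E (fun w => ln (sqn (w - 0))) by apply: harmonic_ln_sqn => -[].
have : (G z - c) + kap * (ln (sqn (z - 0)) - ln s) <= 0.
  apply: (@maximum_principle_barrier _ E (fun z => (G z - c) + kap * (ln (sqn (z - 0)) - ln s))
    (fun z => ln s - ln (sqn (z - 0)))) => //.
  - apply/harmonic_subharmonic/harmonicD.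
      by apply: harmonicB; [exact: harmonic_sub hGh|exact: harmonic_cst].
    by apply/harmonicZ/harmonicB => //; exact: harmonic_cst.
  - by apply: harmonicB => //; exact: harmonic_cst.
  - move=> x cx nx d e d0 e0.
    have [->|x0] := eqVneq x 0.
      have [M H] := pole; pose N := M - c - kap * ln s.
      apply: filterS2 H (ln_pole (ln s - N / d)) => w h1 h2 [Dw w0]; rewrite subr0.
      have := h2 w0; have := h1 w0; rewrite ler_norml => /andP[_ a].
      rewrite ltrBrDl -ltrBrDr ltr_pdivrMr// [_ * d]mulrC; move: a e0; rewrite /N; lra.
    move/eqP: x0 => x0; have cDx : closure D x by apply: closure_subset cx => w [].
    have nDx : ~ D x by move=> Dx; exact: nx.
    have [nOx _ Gx] := bdD cDx nDx.
    apply: filterS (contG nOx x0 e0) => w h Ew; have [[Dw _] w0] := Ew.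
    have := h (nOmega Dw) w0; rewrite Gx ltr_norml => /andP[_ h'].
    have := lnw w Ew; rewrite subr0 => l.
    have l1 : 0 <= d * (ln s - ln (sqn w)) by rewrite mulr_ge0 ?(ltW d0)// subr_ge0.
    have l2 : kap * (ln (sqn w) - ln s) <= 0 by rewrite pmulr_rle0// subr_le0.
    by move: h' l1 l2; lra.
  - move=> d e d0 e0; have [r rP] := far (fun=> 0) e.
    have [r' r1 r'P] := bdd; exists r' => w [[/nOmega/r'P h _] _] h'.
    by have := lt_le_trans h h'; rewrite ltxx.
by rewrite subr0; move: (G z) (ln (sqn z)) (ln s) => A B C; lra.
Qed.

Let G_ge (s : R) z : 0 < s -> (forall x, K x -> s <= sqn x) -> z <> 0 -> sqn z < s ->
  c + kap * (ln s - ln (sqn z)) <= G z.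
Proof.
move=> s0 sK z0 zs; pose E := [set z | sqn z < s /\ z <> 0].
have ED w : E w -> D w by move=> [ws _]; exact: ball_sub ws.
have Gc w : E w -> c < G w by move=> Ew; have [_ w0] := Ew; have [_ []] := ED w Ew.
have E0 w : E w -> 0 < sqn w by move=> [_ /eqP w0]; rewrite sqn_gt0.
have lnw w : E w -> ln (sqn w) <= ln s.
  by move=> Ew; have [/ltW ws _] := Ew; rewrite ler_ln ?posrE//; exact: E0.
have oE : open E.
  have -> : E = [set z | sqn (z - 0) < s] `&` [set z | 0 < sqn (z - 0)].
    apply/seteqP; split=> w; rewrite /E /= ?subr0 ?sqn_gt0.
      by move=> [ws /eqP].
    by move=> [ws /eqP].
  by apply: openI; [apply: open_ltr|apply: open_gtr]; exact: sqn_continuous.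
have ED' : E `<=` D' by move=> w Ew; apply/D'E; split; [exact/DDelta/ED|case: Ew].
have hl : harmonic E (fun w => ln (sqn (w - 0))) by apply: harmonic_ln_sqn => -[].
have : (c - G z) + kap * (ln s - ln (sqn (z - 0))) <= 0.
  apply: (@maximum_principle_barrier _ E (fun z => (c - G z) + kap * (ln s - ln (sqn (z - 0))))
    (fun z => ln s - ln (sqn (z - 0)))) => //.
  - apply/harmonic_subharmonic/harmonicD.
      by apply: harmonicB; [exact: harmonic_cst|exact: harmonic_sub hGh].
    by apply/harmonicZ/harmonicB => //; exact: harmonic_cst.
  - by apply: harmonicB => //; exact: harmonic_cst.
  - move=> x cx nx d e d0 e0.
    have [->|x0] := eqVneq x 0.
      have [M H] := pole; pose N := M + c + kap * ln s.
      apply: filterS2 H (ln_pole (ln s - N / d)) => w h1 h2 [Dw w0]; rewrite subr0.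
      have := h2 w0; have := h1 w0; rewrite ler_norml => /andP[a _].
      rewrite ltrBrDl -ltrBrDr ltr_pdivrMr// [_ * d]mulrC; move: a e0; rewrite /N; lra.
    move/eqP: x0 => x0; have xs : sqn x = s.
      apply/eqP; rewrite eq_le; apply/andP; split; last first.
        by rewrite leNgt; apply/negP => h; exact: nx.
      by rewrite -[x]subr0; apply: closure_ler_sqn cx => w [/ltW]; rewrite subr0.
    have ek : 0 < e / kap by rewrite divr_gt0.
    have cl : {for x, continuous (fun w => ln (sqn (w - 0)))}.
      apply: (@continuous_comp _ _ _ (fun w => sqn (w - 0)) (@ln R)).
        exact: sqn_continuous.
      by apply: continuous_ln; rewrite subr0 xs.
    (* Continuity of [G] up to this circle is not at stake: inside it [G > c], and the logarithm
       tends to [ln s]. *)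
    have h : ln s - e / kap < ln (sqn (x - 0)) by rewrite subr0 xs; lra.
    apply: filterS (near_gtr cl h) => w {}h Ew; rewrite subr0 in h *.
    have l := lnw w Ew; have g := Gc w Ew.
    have l1 : 0 <= d * (ln s - ln (sqn w)) by rewrite mulr_ge0 ?(ltW d0)// subr_ge0.
    have l2 : kap * (ln s - ln (sqn w)) < e.
      by rewrite mulrC -ltr_pdivlMr//; move: h; lra.
    by move: l1 l2 g; lra.
  - move=> d e d0 e0; exists s => w [ws _] /(lt_le_trans ws).
    by rewrite ltxx.
by rewrite subr0; move: (G z) (ln (sqn z)) (ln s) => A B C; lra.
Qed.

Let gx z := pderiv [:: false] G z.
Let gy z := pderiv [:: true] G z.

Let dG z v : D' z -> is_derive z v G (v.1 * gx z + v.2 * gy z).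
Proof.
move=> Dz; have [ck _] := ig_harmonic hG.
apply: (@C1_is_derive _ D').
- exact: open_nbhs_nbhs.
- exact: (@Ck_pdif _ 2 D' G [::] false).
- exact: (@Ck_pdif _ 2 D' G [::] true).
- exact: (@Ck_cont _ 2 D' G [:: false]).
- exact: (@Ck_cont _ 2 D' G [:: true]).
Qed.

Let grad_lim x : K x -> exists2 g : plane, enorm g = k & forall (f : R * R -> R), continuous f ->
  forall e : R, 0 < e -> \forall z \near x, D' z -> `|f g - f (gx z, gy z)| < e.
Proof.
move=> [cx nx]; have [nOx x0 Gx] := bdD cx nx; have [ex gk] := LG nOx x0 Gx.
exists (cgrad D' G x) => // f cf e e0; exact: cgrad_near.
Qed.

(** Otherwise, by the limit of the gradient at [x], the derivative of [G] along [- x] would stay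
    below some [m < 2 kap] on the inner radius near [x], whereas [G_ge] forces an increase of at
    least [2 kap t] from [x] to [x - t x]. *)
Let near_touch x : K x -> (forall y, K y -> sqn x <= sqn y) -> 2 * kap <= enorm x * k.
Proof.
move=> Kx xm; have [nOx x0 Gx] := bdD Kx.1 Kx.2; rewrite leNgt; apply/negP => lt.
have [g gk gl] := grad_lim Kx.
have s0 : 0 < sqn x by rewrite sqn_gt0; apply/eqP.
pose m := (enorm x * k + 2 * kap) / 2.
have m1 : enorm x * k < m by rewrite /m; lra.
have m2 : m < 2 * kap by rewrite /m; lra.
have cf : continuous (fun w => dotp x w : R).
  by move=> w; apply: cvgD; apply: cvgM; [exact: cvg_cst|exact: cvg_fst|exact: cvg_cst|exact: cvg_snd].
have m3 : 0 < m - enorm x * k by rewrite subr_gt0.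
have N := gl _ cf _ m3.
have {}N : \forall z \near x, D' z -> - m < dotp x (gx z, gy z).
  apply: filterS N => z h /h; have := dotp_le x g; rewrite gk ltr_norml ler_norml.
  by move=> /andP[a _] /andP[_ b]; move: a b; lra.
have /near_right0P[t1 t10 t1P] : \forall t \near (0 : R)^'+, D' (x + t *: - x) ->
    - m < dotp x (gx (x + t *: - x), gy (x + t *: - x)).
  have := near_line (- x) N; exact: cvg_within.
have zE (t : R) : x + t *: - x = (1 - t) *: x by rewrite scalerN scalerBl scale1r.
have zD (t : R) : 0 < t < 1 -> D (x + t *: - x) /\ x + t *: - x <> 0.
  move=> /andP[t0 tl1]; have q : sqn (x + t *: - x) < sqn x.
    by rewrite zE sqnZ -[ltRHS]mul1r ltr_pM2r// expr_lt1 ?subr_ge0 ?(ltW tl1)//; lra.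
  split; first by apply: (ball_sub s0) q => y; exact: xm.
  apply/eqP; rewrite zE -sqn_eq0 sqnZ mulf_neq0 ?gt_eqF//.
  by rewrite exprn_gt0// subr_gt0.
pose t := Num.min t1 1 / 2.
have [t0 [tt1 tl1]] : 0 < t /\ t < t1 /\ t < 1.
  have : 0 < Num.min t1 1 by rewrite lt_min t10 ltr01.
  have : Num.min t1 1 <= t1 by rewrite ge_min lexx.
  have : Num.min t1 1 <= 1 by rewrite ge_min lexx orbT.
  by rewrite /t; move: (Num.min t1 1) => y; lra.
(* [|x - t x| = (1 - t) |x|], and [ln (1 - t) <= - t]. *)
have lower : c + 2 * kap * t <= G (x + t *: - x).
  have [zDt z0t] : D (x + t *: - x) /\ x + t *: - x <> 0 by apply: zD; rewrite t0.
  have zs : sqn (x + t *: - x) < sqn x.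
    by rewrite zE sqnZ -[ltRHS]mul1r ltr_pM2r// expr_lt1 ?subr_ge0 ?(ltW tl1)//; lra.
  have H : c + kap * (ln (sqn x) - ln (sqn (x + t *: - x))) <= G (x + t *: - x).
    by apply: G_ge => // y; exact: xm.
  apply: le_trans H; rewrite lerD2l zE sqnZ.
  have t1p : 0 < 1 - t by rewrite subr_gt0.
  rewrite lnM ?posrE ?exprn_gt0// lnXn// [2 * kap]mulrC -mulrA ler_pM2l//.
  have := @le_ln1Dx _ (- t); rewrite ltrN2 => /(_ tl1) l.
  by move: l; rewrite mulr2n; lra.
pose ep := (2 * kap - m) * t; have ep0 : 0 < ep by rewrite mulr_gt0// subr_gt0.
have /near_right0P[d1 d10 d1P] : \forall t \near (0 : R)^'+, ~ Omega (x + t *: - x) ->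
    x + t *: - x <> 0 -> `|G (x + t *: - x) - G x| < ep.
  have := near_line (- x) (contG nOx x0 ep0); exact: cvg_within.
(* The mean value theorem starts from [x - d x] instead of [x], which may be a frontier point of
   [Omega] where [G] is merely continuous; the error made is less than the gap [ep]. *)
pose d := Num.min d1 t / 2.
have [d0 [dd1 dt]] : 0 < d /\ d < d1 /\ d < t.
  have : 0 < Num.min d1 t by rewrite lt_min d10 t0.
  have : Num.min d1 t <= d1 by rewrite ge_min lexx.
  have : Num.min d1 t <= t by rewrite ge_min lexx orbT.
  by rewrite /d; move: (Num.min d1 t) => y; lra.
have [dD d00] : D (x + d *: - x) /\ x + d *: - x <> 0 by apply: zD; rewrite d0 (lt_trans dt).
have := d1P d d0 dd1 (nOmega (DDelta dD)) d00; rewrite Gx ltr_norml => /andP[_ Gd].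
have [||u /andP[u0 u1] E] := @line_MVT _ D' G
    (fun z => ((t - d) *: - x).1 * gx z + ((t - d) *: - x).2 * gy z) (x + d *: - x) ((t - d) *: - x).
- by move=> q Dq; exact: dG.
- move=> u /andP[u0 u1]; rewrite -addrA scalerA -scalerDl.
  apply/D'E; have [h1 h2] : D (x + (d + u * (t - d)) *: - x) /\ x + (d + u * (t - d)) *: - x <> 0.
    by apply: zD; apply/andP; split; nra.
  by split; first exact: DDelta.
move: E; rewrite -addrA -scalerDl [d + _]addrC subrK.
rewrite -addrA scalerA -scalerDl; set q := d + u * (t - d) => E.
have q01 : 0 < q < t by apply/andP; split; rewrite /q; nra.
have [q0 qt] := andP q01.
have [qD qn0] : D (x + q *: - x) /\ x + q *: - x <> 0 by apply: zD; rewrite q0 (lt_trans qt).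
have D'q : D' (x + q *: - x) by apply/D'E; split=> //; exact: DDelta.
have := t1P q q0 (lt_trans qt tt1) D'q; move: E; rewrite /dotp /=.
move: (gx _) (gy _) => X Y E F.
have {}E : G (x + t *: - x) - G (x + d *: - x) = - (t - d) * (x.1 * X + x.2 * Y).
  by rewrite E /GRing.scale /=; ring.
have : - (t - d) * (x.1 * X + x.2 * Y) <= (t - d) * m.
  by rewrite mulNr -mulrN ler_pM2l ?subr_gt0//; lra.
rewrite -E; have dm : 0 <= d * m.
  apply: mulr_ge0; first exact: ltW.
  by apply: le_trans (ltW m1); rewrite mulr_ge0 ?enorm_ge0// -gk enorm_ge0.
by move: lower Gd; rewrite /ep; lra.
Qed.

(* If [k] were larger, then maximizing [G z - k' |z - z0|] over the part of [D] in a
   small disc centred at [z0], close to [x], would give a value of [G] exceeding [G_le]. *)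
Let far_touch x : K x -> (forall y, K y -> sqn y <= sqn x) -> 0 < k -> enorm x * k <= 2 * kap.
Proof.
move=> Kx xm kp; have [nOx x0 Gx] := bdD Kx.1 Kx.2; rewrite leNgt; apply/negP => lt.
have [g gk gl] := grad_lim Kx; set l := enorm x in lt *.
have l0 : 0 < l by apply: enorm_gt0; apply/eqP.
(* [k'] lies strictly between [2 kap / l] and [k], and [eta > 0] is the excess of [k' l] over
   [2 kap]. *)
pose k' := (k + 2 * kap / l) / 2; pose eta := k' * l - 2 * kap.
have kl : 2 * kap / l < k by rewrite ltr_pdivrMr// [k * l]mulrC.
have k2 : k' < k by rewrite /k'; lra.
have k1 : 2 * kap / l < k' by rewrite /k'; lra.
have k'0 : 0 < k' by apply: lt_trans k1; rewrite divr_gt0// mulr_gt0.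
have eta0 : 0 < eta by rewrite subr_gt0 -ltr_pdivrMr.
have kk : 0 < k ^+ 2 - k' ^+ 2 by rewrite subr_gt0 ltr_pXn2r// nnegrE ltW.
have /nbhs_sqnP[d d0 dP] := gl _ (@sqn_continuous R 0) _ kk.
have {dP}steep z : sqn (z - x) < d ^+ 2 -> D' z -> k' < enorm (gx z, gy z).
  move=> zd Dz; have := dP z zd Dz; rewrite !subr0 -sqr_enorm gk -sqr_enorm ltr_norml => /andP[_ h].
  have {}h : k' ^+ 2 < enorm (gx z, gy z) ^+ 2 by move: h; lra.
  by move: h; rewrite ltr_pXn2r// nnegrE ?enorm_ge0// ltW.
(* [th] and [u] are chosen so that [2 kap th <= eta / 2] and [2 k' u <= eta / 2], hence
   [k' (l - (1 + th) u) >= 2 kap (1 + th)], which the end of the proof contradicts. Moreover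
   [u <= d / 3] keeps the disc where the gradient exceeds [k'], and [u <= l / 4] keeps it away from
   the pole. *)
pose th := Num.min 1 (eta / (4 * kap)).
have [th0 [th1 thk]] : 0 < th /\ th <= 1 /\ th * (4 * kap) <= eta.
  have K4 : 0 < 4 * kap by rewrite mulr_gt0.
  by rewrite -ler_pdivlMr// /th lt_min ltr01 divr_gt0// !ge_min !lexx orbT.
pose u := Num.min (d / 3) (Num.min (l / 4) (eta / (4 * k'))).
have [u0 [ud [ul uk]]] : 0 < u /\ u <= d / 3 /\ u <= l / 4 /\ u * (4 * k') <= eta.
  have K4 : 0 < 4 * k' by rewrite mulr_gt0.
  by rewrite -ler_pdivlMr// /u !lt_min !divr_gt0// !ge_min !lexx !orbT.
have [z0 [Dz0 z00 z0x]] : exists z0, [/\ D z0, z0 <> 0 & enorm (z0 - x) <= th * u].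
  have N : nbhs x [set z | sqn (z - x) < (th * u) ^+ 2].
    by apply/nbhs_sqnP; exists (th * u); rewrite // mulr_gt0.
  have [z [Dz [zx z0]]] := Kx.1 _ (filterI N (near_neq0 x0)).
  exists z; split=> //; rewrite -(ler_pXn2r (_ : (0 < 2)%N))// ?nnegrE ?enorm_ge0//.
    by rewrite sqr_enorm ltW.
  by rewrite mulr_ge0// ltW.
have thu : th * u <= u by rewrite ler_piMl// ltW.
have Gz0 : c < G z0 by have [_ []] := Dz0.
pose B := [set z : plane | sqn (z - z0) <= u ^+ 2] `&` closure D.
have Bu z : B z -> enorm (z - z0) <= u.
  move=> [zu _]; rewrite -(ler_pXn2r (_ : (0 < 2)%N))// ?nnegrE ?enorm_ge0// ?sqr_enorm//.
  exact: ltW.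
have Bx z : B z -> enorm (z - x) <= (1 + th) * u.
  move=> /Bu zu; have := enormD (z - z0) (z0 - x); rewrite addrA subrK.
  by rewrite mulrDl mul1r; move: zu z0x; lra.
have Bn z : B z -> l - (1 + th) * u <= enorm z.
  move=> /Bx zx; have := enormD z (x - z); rewrite subrKC.
  have -> : enorm (x - z) = enorm (z - x) by rewrite !enorm_sqn -sqnN opprB.
  by rewrite -/l; move: zx; lra.
have thu2 : (1 + th) * u <= 2 * u by rewrite ler_pM2r//; lra.
have Bpos z : B z -> 0 < enorm z by move=> /Bn; move: thu2 ul l0; lra.
have B0 z : B z -> z <> 0.
  by move=> /Bpos + z0'; rewrite z0' enorm_sqn sqn0 sqrtr0 ltxx.
have cB : compact B by apply: compact_closedI; [exact: closed_disc_compact|exact: closed_closure].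
have Bz0 : B z0.
  by split; [rewrite /= subrr sqn0 sqr_ge0|exact: subset_closure].
pose H z := G z - k' * enorm (z - z0).
have cH : {within B, continuous H}.
  apply/subspace_continuousP => z Bz; have [_ cz] := Bz.
  have cl : {for z, continuous (fun z => k' * enorm (z - z0))}.
    apply: cvgM; first exact: cvg_cst.
    apply: (@continuous_comp _ _ _ (fun z => sqn (z - z0)) (@Num.sqrt R)).
      exact: sqn_continuous.
    exact: sqrt_continuous.
  apply: cvgB; last exact: cvg_within_filter cl.
  apply/cvgrPdist_lt => e e0; rewrite near_withinE.
  have nz : ~ Omega z by exact: closure_nOmega cz.
  apply: filterS (contG nz (B0 z Bz) e0) => w h Bw; rewrite distrC; apply: h; last exact: B0.
  by have [_ cw] := Bw; exact: closure_nOmega cw.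
have [zs /set_mem Bzs zmax] := compact_EVT_max (ex_intro _ z0 Bz0) cB cH.
have {}zmax z : B z -> H z <= H zs by move=> Bz; apply: zmax; rewrite inE.
have Hz0 : H z0 = G z0.
  by rewrite /H subrr enorm_sqn sqn0 sqrtr0 mulr0 subr0.
have Gzs : c + k' * enorm (zs - z0) < G zs.
  by have := zmax z0 Bz0; rewrite Hz0 /H; move: Gz0; lra.
(* On the frontier of [D] the value of [H] is at most [c], less than [H z0 = G z0]. *)
have Dzs : D zs.
  apply: contrapT => nD; have [_ _ E] := bdD Bzs.2 nD; move: Gzs; rewrite E.
  by rewrite -subr_gt0 opprD addNKr oppr_gt0 ltNge mulr_ge0 ?enorm_ge0// ltW.
have D'zs : D' zs by apply/D'E; split; [exact: DDelta|exact: B0].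
have [lu|] := ltP (sqn (zs - z0)) (u ^+ 2).
  pose V : plane := (gx zs, gy zs).
  have kV : k' < enorm V.
    apply: steep => //; rewrite -sqr_enorm ltr_pXn2r// ?nnegrE ?enorm_ge0 ?(ltW d0)//.
    by have := Bx zs Bzs; move: thu2 ud d0; lra.
  (* An interior maximum is impossible: along its gradient [V], [G] grows at the rate [|V|^2], while
     [k' |z - z0|] grows at most at the rate [k' |V|], which is smaller. *)
  pose phi (t : R) := G (zs + t *: V) - t * (k' * enorm V).
  have dphi : is_derive (0 : R) 1 phi (sqn V - k' * enorm V).
    have h1 : is_derive (0 : R) 1 (fun t : R => G (zs + t *: V)) (sqn V).
      apply: is_derive_line; rewrite scale0r addr0.
      by apply: (is_derive_eq (dG V D'zs)); rewrite /sqn !expr2.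
    have h2 := is_deriveM (is_derive_id (0 : R) (1 : R)) (is_derive_cst (k' * enorm V) (0 : R) (1 : R)).
    apply: (is_derive_eq (is_deriveB h1 h2)).
    by rewrite scaler0 add0r -[_ *: 1]/(k' * enorm V * 1) mulr1.
  have pos : 0 < sqn V - k' * enorm V.
    rewrite -sqr_enorm expr2 -mulrBl mulr_gt0 ?subr_gt0//.
    exact: lt_trans kV.
  have N1 := pos_derive_right dphi pos.
  have Nz : nbhs zs (D `&` [set z | sqn (z - z0) < u ^+ 2]).
    by apply: open_nbhs_nbhs; split=> //; apply: openI => //; apply: open_ltr; exact: sqn_continuous.
  have N2 : \forall t \near (0 : R)^'+, (D `&` [set z | sqn (z - z0) < u ^+ 2]) (zs + t *: V).
    by have := near_line V Nz; exact: cvg_within.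
  have [t [[pt [Dt ut]] t0]] := filter_ex (filterI (filterI N1 N2) (nbhs_right_gt (0 : R))).
  have Bt : B (zs + t *: V) by split; [exact: ltW|exact: subset_closure].
  have := zmax _ Bt; move: pt; rewrite /phi /H add0r scale0r addr0 mul0r subr0.
  have := enormD (zs - z0) (t *: V); rewrite enormZ ?(ltW t0)// addrAC => tri.
  have {}tri : k' * enorm (zs + t *: V - z0) <= k' * (enorm (zs - z0) + t * enorm V) by rewrite ler_pM2l.
  by move: tri; lra.
move=> ul2; have ue : enorm (zs - z0) = u.
  apply/eqP; rewrite eq_le Bu//= -(ler_pXn2r (_ : (0 < 2)%N))// ?nnegrE ?enorm_ge0 ?(ltW u0)//.
  by rewrite sqr_enorm.
have := G_le xm Dzs (B0 zs Bzs); rewrite -!sqr_enorm -/l.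
have z1 := Bpos zs Bzs; have z2 := Bn zs Bzs.
rewrite !lnXn// => up; rewrite ue in Gzs.
have q0 : 0 < l / enorm zs by rewrite divr_gt0.
have : ln (l / enorm zs) <= l / enorm zs - 1.
  have := @le_ln1Dx _ (l / enorm zs - 1); rewrite subrKC; apply.
  by rewrite ltrBrDr addNr.
rewrite ln_div ?posrE// => lq.
have : k' * u < 2 * kap * (l / enorm zs - 1).
  have : kap * (ln l *+ 2 - ln (enorm zs) *+ 2) <= 2 * kap * (l / enorm zs - 1).
    rewrite (_ : 2 * kap * _ = kap * (2 * (l / enorm zs - 1))); last by ring.
    by rewrite ler_pM2l// !mulr2n; move: lq; lra.
  by move: up Gzs; lra.
have -> : l / enorm zs - 1 = (l - enorm zs) / enorm zs by field; rewrite gt_eqF.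
rewrite mulrA ltr_pdivlMr// => h.
have h1 : k' * u * (l - (1 + th) * u) <= k' * u * enorm zs by rewrite ler_pM2l// mulr_gt0.
have h2 : 2 * kap * (l - enorm zs) <= 2 * kap * ((1 + th) * u).
  have K2 : 0 < 2 * kap by rewrite mulr_gt0.
  by rewrite (ler_pM2l K2); move: z2; move: ((1 + th) * u) => y; lra.
have : u * (k' * (l - (1 + th) * u)) < u * (2 * kap * (1 + th)) by move: h h1 h2; lra.
rewrite ltr_pM2l// ltNge => /negP; apply.
have h3 : k' * ((1 + th) * u) <= k' * (2 * u) by rewrite ler_pM2l.
by move: thk uk h3; rewrite /eta; lra.
Qed.

Lemma green_level_disc : exists2 s : R, 0 < s & forall z, z <> 0 -> sqn z < s ->
  D' z /\ G z = c + kap * (ln s - ln (sqn z)).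
Proof.
have cs : {within K, continuous (fun z => sqn (z - 0))}.
  by apply: continuous_subspaceT; exact: sqn_continuous.
have [x1 /set_mem Kx1 m1] := compact_EVT_min K0 cK cs.
have [x2 /set_mem Kx2 m2] := compact_EVT_max K0 cK cs.
have {}m1 y : K y -> sqn x1 <= sqn y by move=> Ky; have := m1 y; rewrite !subr0 inE; apply.
have {}m2 y : K y -> sqn y <= sqn x2 by move=> Ky; have := m2 y; rewrite !subr0 inE; apply.
have pos x : K x -> 0 < enorm x.
  by move=> Kx; apply: enorm_gt0; apply/eqP; have [] := bdD Kx.1 Kx.2.
have n1 := near_touch Kx1 m1.
have k0 : 0 < k by rewrite -(pmulr_rgt0 _ (pos _ Kx1)); apply: lt_le_trans n1; rewrite mulr_gt0.
have n2 := far_touch Kx2 m2 k0.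
have E : sqn x2 <= sqn x1.
  rewrite -!sqr_enorm ler_pXn2r// ?nnegrE ?enorm_ge0//.
  by rewrite -(ler_pM2r k0) (le_trans n2).
have s0 : 0 < sqn x1 by rewrite -sqr_enorm exprn_gt0// pos.
exists (sqn x1) => // z z0 zs; have Dz : D z by exact: (ball_sub s0) zs.
split; first by apply/D'E; split=> //; exact: DDelta.
apply/eqP; rewrite eq_le G_ge// andbT; apply: G_le => // y Ky.
exact: le_trans (m2 y Ky) E.
Qed.

Theorem green_constant_gradient_circle :
  exists rho : R, 0 < rho /\ frontier Omega = circle 0 rho.
Proof.
have [s0 s00 sP] := green_level_disc; pose C := c + kap * ln s0.
have near0 z : z <> 0 -> sqn z < s0 -> log_near C z.
  move=> z0 zs; have [D'z _] := sP z z0 zs; split=> //.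
  have N : nbhs z [set w | sqn (w - 0) < s0].
    by apply: open_nbhs_nbhs; split; [apply: open_ltr; exact: sqn_continuous|rewrite /= subr0].
  apply: filterS2 N (near_neq0 z0) => w /=; rewrite subr0 => ws w0.
  by have [_ ->] := sP w w0 ws; rewrite /C mulrBr addrA.
have [F0 cF _] := jordan_curve_facts hF.
have cs : {within frontier Omega, continuous (fun z => sqn (z - 0))}.
  by apply: continuous_subspaceT; exact: sqn_continuous.
have [y1 /set_mem Fy1 m1] := compact_EVT_min F0 cF cs; pose s := sqn y1.
have {}m1 y : frontier Omega y -> s <= sqn y.
  by move=> Fy; have := m1 y; rewrite !subr0 inE; apply.
have F_neq0 y : frontier Omega y -> y <> 0.
  by move=> /(frontier_open y oO)[cy _] y0; apply: O0; rewrite -y0.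
have s1 : 0 < s by rewrite /s sqn_gt0; apply/eqP/F_neq0.
have ball0 : [set z : plane | sqn (z - 0) < s] 0 by rewrite /= subrr sqn0.
have inD z : sqn z < s -> Delta z.
  move=> zs; suff sub : [set z : plane | sqn (z - 0) < s] `<=` Delta by apply: sub; rewrite /= subr0.
  apply: connected_sub_open => //; first exact: disc_connected.
    by exists 0.
  move=> x /=; rewrite subr0 ltNge => /negP xs /(frontier_open x oDelta)[cx nx]; apply: xs; apply: m1.
  by have [] := interior_or_frontier (closure_nOmega (@subset_refl _ Delta) cx).
(* Adding the pole allows the full disc to serve as the connected set. *)
pose O := [set z | z = 0 \/ log_near C z].
have oO' : open O.
  rewrite openE => z [->|[D'z Ez]]; rewrite /interior/=.
    have N : nbhs (0 : plane) [set w | sqn (w - 0) < s0].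
      apply: open_nbhs_nbhs; split; first by apply: open_ltr; exact: sqn_continuous.
      by rewrite /= subrr sqn0.
    apply: filterS N => w /=; rewrite subr0 => ws.
    by have [->|/eqP w0] := eqVneq w 0; [left|right; exact: near0].
  have N := open_nbhs_nbhs (conj oD' D'z).
  by apply: filterS2 N (nbhs_interior Ez) => w D'w Ew; right.
have formula z : z <> 0 -> sqn z < s -> log_near C z.
  move=> z0 zs; suff sub : [set z : plane | sqn (z - 0) < s] `<=` O.
    by have [|//|//] := sub z; rewrite /= subr0.
  apply: connected_sub_open => //; first exact: disc_connected.
    by exists 0; split=> //; left.
  move=> x /=; rewrite subr0 => xs /(frontier_open x oO')[cx nx]; apply: nx.
  have [->|/eqP x0] := eqVneq x 0; [by left|right].
  apply: log_near_closed; first by apply/D'E; split=> //; exact: inD.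
  move=> N xN; have [w [[w0|Ew] [Nw w0']]] := cx _ (filterI xN (near_neq0 x0)); first by [].
  by exists w.
have inside y (t : R) : sqn y = s -> 0 < t < 1 -> y + t *: - y <> 0 /\ sqn (y + t *: - y) < s.
  move=> ys /andP[t0 t1].
  have E : sqn (y + t *: - y) = (1 - t) ^+ 2 * s.
    by rewrite -ys -sqnZ scalerN scalerBl scale1r.
  split; last by rewrite E -[ltRHS]mul1r ltr_pM2r// expr_lt1 ?subr_ge0 ?(ltW t1)//; lra.
  by apply/eqP; rewrite -sqn_eq0 E mulf_neq0 ?gt_eqF// exprn_gt0// subr_gt0.
have y_neq0 y : sqn y = s -> y <> 0.
  by move=> ys; apply/eqP; rewrite -sqn_gt0 ys.
have along y (A : set plane) : sqn y = s -> nbhs y A ->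
    exists z, [/\ A z, z <> 0 & sqn z < s].
  move=> ys yA; have N : \forall t \near (0 : R)^'+, A (y + t *: - y).
    by have := near_line (- y) yA; exact: cvg_within.
  have [t [[At t0] t1]] := filter_ex (filterI (filterI N (nbhs_right_gt (0 : R))) (nbhs_right_lt ltr01)).
  by have [h1 h2] := inside y t ys (introT andP (conj t0 t1)); exists (y + t *: - y).
have nO y : sqn y = s -> ~ Omega y.
  move=> ys Oy; have [z [Oz _ zs]] := along y Omega ys (open_nbhs_nbhs (conj oO Oy)).
  exact: nOmega (inD z zs) Oz.
have Gy y : sqn y = s -> G y = C - kap * ln s.
  move=> ys; apply/eqP; rewrite -subr_eq0 -normr_le0; apply/ler_addgt0Pr => e e0; rewrite add0r.
  have e2 : 0 < e / 2 by rewrite divr_gt0.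
  have cl : {for y, continuous (fun w => kap * ln (sqn (w - 0)))}.
    apply: cvgM; first exact: cvg_cst.
    apply: (@continuous_comp _ _ _ (fun w => sqn (w - 0)) (@ln R)).
      exact: sqn_continuous.
    by apply: continuous_ln; rewrite subr0 ys.
  have N2 : \forall w \near y, `|kap * ln (sqn (y - 0)) - kap * ln (sqn (w - 0))| < e / 2.
    by move/cvgrPdist_lt: cl; exact.
  have [z [[/= h1 h2] z0 zs]] := along y _ ys (filterI (contG (nO y ys) (y_neq0 y ys) e2) N2).
  have [_ /nbhs_singleton Ez] := formula z z0 zs.
  have {}h1 := h1 (nOmega (inD z zs)) z0; move: h1 h2; rewrite Ez !subr0 ys.
  rewrite !ltr_norml ler_norml => /andP[a1 a2] /andP[b1 b2].
  by apply/andP; split; move: a1 a2 b1 b2; lra.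
have C0 : C = kap * ln s.
  by have := Gy y1 erefl; rewrite (ig_frontier hG)// => /eqP; rewrite eq_sym subr_eq0 => /eqP.
(* If a point of this circle were interior to the domain, the formula would persist slightly beyond
   it, where [kap (ln s - ln |z|^2)] is negative, against [G >= 0]. *)
have sub : [set z : plane | sqn (z - 0) = (Num.sqrt s) ^+ 2] `<=` frontier Omega.
  move=> y /=; rewrite subr0 sqr_sqrtr ?(ltW s1)// => ys.
  have [Dy|//] := interior_or_frontier (nO y ys); exfalso.
  have D'y : D' y by apply/D'E; split=> //; exact: y_neq0.
  have cy : closure (log_near C) y.
    by move=> N yN; have [z [Nz z0 zs]] := along y N ys yN; exists z; split=> //; exact: formula.
  have [_ Ey] := log_near_closed D'y cy.
  have N0 : nbhs y (D' `&` [set w | G w = C - kap * ln (sqn w)]).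
    by apply: filterI => //; exact: open_nbhs_nbhs.
  have N1 : \forall t \near (0 : R)^'+, (D' `&` [set w | G w = C - kap * ln (sqn w)]) (y + t *: y).
    by have := near_line y N0; exact: cvg_within.
  have [t [[/D'E[Dt z0] Et] t0]] := filter_ex (filterI N1 (nbhs_right_gt (0 : R))).
  have := G_ge0 (nOmega Dt) z0; rewrite Et C0 -mulrBr pmulr_rge0// subr_ge0.
  have E : sqn (y + t *: y) = (1 + t) ^+ 2 * s by rewrite -ys -sqnZ scalerDl scale1r.
  have st : s < sqn (y + t *: y).
    by rewrite E -[ltLHS]mul1r ltr_pM2r// expr_gt1 ?ltrDl// ltW// ltr_wpDl.
  by rewrite ler_ln ?posrE ?(lt_trans s1 st)// => /(lt_le_trans st); rewrite ltxx.
have q0 : 0 < Num.sqrt s by rewrite sqrtr_gt0.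
exists (Num.sqrt s); split=> //; rewrite circleE//.
exact: jordan_curve_contains_circle.
Qed.

End InteriorDomain.

(** * The three statements assembled *)

Theorem theorem3p5 (R : realType) (Omega : set (R * R))
  (hOmega : unbounded_domain Omega)
  (hfrontier : smooth_jordan_curve (frontier Omega)) :
  [/\ forall (Phi : R) (U : R * R -> R), exterior_dirichlet Omega Phi U ->
        (exists c : R, is_circle (exterior_equipotential Omega U c)) ->
        is_circle (frontier Omega),
      forall (Phi : R) (U : R * R -> R), exterior_dirichlet Omega Phi U ->
        (exists c : R, exterior_equipotential Omega U c !=set0 /\
           grad_norm_constant_on (exterior_equipotential Omega U c) Omega U) ->
        is_circle (frontier Omega)
    & forall G : R * R -> R, ~ closure Omega (0, 0) -> interior_green Omega G ->
        (exists c : R, interior_equipotential Omega G c !=set0 /\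
           grad_norm_constant_on (interior_equipotential Omega G c)
             (punctured_interior Omega) G) ->
        exists rho : R, 0 < rho /\ frontier Omega = circle (0, 0) rho].
Proof.
have [oO _ _] := hOmega.
have kpos (Phi : R) : 0 < Phi -> 0 < Phi / (2 * pi) / 2.
  by move=> P0; rewrite !divr_gt0// mulr_gt0// pi_gt0.
split=> [Phi U hU [c [a [rho [r0 E]]]]|Phi U hU [c [L0 [k LG]]]|G O0 hG [c [[r0 [nr0 Gr0]] [k LG]]]].
- have [hh nc [sm ct _] [c0 fr] P0 _ _] := hU.
  exact: (level_circle hOmega hfrontier sm hh.2 ct fr (kpos _ P0) (exterior_growth hU) r0 E).
- have [hh nc [sm ct _] [c0 fr] P0 _ _] := hU.
  apply: (@constant_gradient_circle _ Omega U _ c0 hOmega hfrontier sm hh.2 ct fr (kpos _ P0)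
    (exterior_growth hU) nc c k L0).
  by move=> r cr Ur; exact: LG.
- have nO z : ~ (Omega `|` [set 0]) z <-> ~ Omega z /\ z <> 0.
    by split=> [h|[h1 h2] []//]; split=> e; apply: h; [left|right].
  have [n1 n2] := (nO r0).1 nr0.
  apply: (@green_constant_gradient_circle _ Omega G hOmega hfrontier O0 hG c k r0 n1 n2 Gr0).
  by move=> r h1 h2 Gr; apply: LG; split=> //; apply/nO.
Qed.
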